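(* Let $\mathfrak C$ be a cancellative small category, and assume that the groupoid $I_l\ltimes\Omega$ is Hausdorff. Then the quotient map $q_\partial\colon C^*_r(I_l\ltimes\Omega)\to C^*_r(I_l\ltimes\partial\Omega)$ is completely isometric on $\mathcal A_r(\mathfrak C)$.
   Context: A small category $\mathfrak C$ is identified with its set of morphisms and each object with its identity morphism; $\mathfrak d,\mathfrak t\colon\mathfrak C\to\mathfrak C^0$ are the domain and target maps, and $cd$ is defined iff $\mathfrak d(c)=\mathfrak t(d)$. $\mathfrak C$ is left cancellative if $cx=cy$ implies $x=y$ whenever $\mathfrak d(c)=\mathfrak t(x)=\mathfrak t(y)$; right cancellative is defined symmetrically, and cancellative means both. Put $\mathfrak d(c)\mathfrak C=\{x\in\mathfrak C:\mathfrak t(x)=\mathfrak d(c)\}$ and $c\mathfrak C=\{cx:x\in\mathfrak d(c)\mathfrak C\}$. Groupoid. Each $c\in\mathfrak C$ defines a partial bijection $\mathfrak d(c)\mathfrak C\to c\mathfrak C$, $x\mapsto cx$, also denoted $c$. $I_l$ is the inverse semigroup of partial bijections of $\mathfrak C$ generated by these; $\mathrm{dom}(s),\mathrm{im}(s)$ are the domain and image of $s\in I_l$. $\mathcal J=\{\mathrm{dom}(s):s\in I_l\}$ is the semilattice of constructible right ideals, $\mathcal J^\times$ its nonempty members. A character on $\mathcal J$ is a nonzero map $\chi\colon\mathcal J\to\{0,1\}$ with $\chi(X\cap Y)=\chi(X)\chi(Y)$ and $\chi(\emptyset)=0$ if $\emptyset\in\mathcal J$. $\Omega\subseteq\{0,1\}^{\mathcal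 J}$ (subspace topology) is the space of characters such that whenever $X,X_1,\dots,X_n\in\mathcal J^\times$ and $X=\bigcup_iX_i$, $\chi(X)=1$ implies $\chi(X_i)=1$ for some $i$. A character $\chi$ is maximal if $\chi^{-1}(1)$ is maximal under inclusion among the sets $\gamma^{-1}(1)$, $\gamma$ a character; maximal characters lie in $\Omega$, and $\partial\Omega$ is the closure in $\Omega$ of the set of maximal characters. Put $\Omega(X)=\{\chi\in\Omega:\chi(X)=1\}$. For $s\in I_l$ and $\chi\in\Omega(\mathrm{dom}(s))$ set $(s.\chi)(X)=\chi(s^{-1}(X\cap\mathrm{im}(s)))$. $I_l\ltimes\Omega$ is the set of classes $[s,\chi]$ of pairs with $s\in I_l$, $\chi\in\Omega(\mathrm{dom}(s))$, where $(s,\chi)\sim(t,\chi)$ iff there is $X\in\mathcal J$ with $\chi(X)=1$ and $s(x)=t(x)$ for all $x\in X$; operations $[s,t.\chi][t,\chi]=[st,\chi]$, $[s,\chi]^{-1}=[s^{-1},s.\chi]$; source $\chi$, range $s.\chi$; topology generated by the sets $[s,U]=\{[s,\chi]:\chi\in U\}$, $U\subseteq\Omega(\mathrm{dom}(s))$ compact open. It is a locally compact étale groupoid with unit space $\Omega$; $\partial\Omega$ is closed and invariant, and $I_l\ltimes\partial\Omega$ is the restriction to $\partial\Omega$. $C^*_r$ denotes the reduced groupoid C*-algebra of a Hausdorff étale groupoid, and $1_{[s,U]}$ the characteristic function of the compact open bisection $[s,U]$. $\mathcal A_r(\mathfrak C)$ is the norm-closed subalgebra of $C^*_r(I_l\ltimes\Omega)$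 generated by $\{1_{[c,\Omega(\mathfrak d(c)\mathfrak C)]}:c\in\mathfrak C\}$. The boundary quotient map $q_\partial$ is the surjective *-homomorphism determined by $q_\partial(f)=f|_{I_l\ltimes\partial\Omega}$ for $f\in C_c(I_l\ltimes\Omega)$. *)

(* Defs.v *)
From HB Require Import structures.
From mathcomp Require Import all_boot all_order all_algebra.
From mathcomp Require Import complex.
From mathcomp Require Import ring lra.
From mathcomp Require Import all_classical all_reals.
From mathcomp Require Import topology normedtype sequences numfun esum.

Set Implicit Arguments.
Unset Strict Implicit.
Unset Printing Implicit Defensive.

Import Order.TTheory GRing.Theory Num.Theory.
Import numFieldNormedType.Exports.

Local Open Scope classical_set_scope.
Local Open Scope ring_scope.

(* Objects are the identity morphisms, i.e. the values of [dm] and [tg].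
   [comp c d] is the product [cd]; its value is junk unless [dm c = tg d]. *)
Record small_category := SmallCategory {
  mor :> Type;
  dm : mor -> mor;
  tg : mor -> mor;
  comp : mor -> mor -> mor;
  dm_dm : forall c, dm (dm c) = dm c;
  tg_dm : forall c, tg (dm c) = dm c;
  dm_tg : forall c, dm (tg c) = tg c;
  tg_tg : forall c, tg (tg c) = tg c;
  dm_comp : forall c d, dm c = tg d -> dm (comp c d) = dm d;
  tg_comp : forall c d, dm c = tg d -> tg (comp c d) = tg c;
  comp_dm : forall c, comp c (dm c) = c;
  tg_mor : forall c, comp (tg c) c = c;
  compA : forall b c d, dm b = tg c -> dm c = tg d ->
    comp b (comp c d) = comp (comp b c) d }.

Definition left_cancellative (C : small_category) :=
  forall c x y : C, dm c = tg x -> dm c = tg y -> comp c x = comp c y -> x = y.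

Definition right_cancellative (C : small_category) :=
  forall c x y : C, dm x = tg c -> dm y = tg c -> comp x c = comp y c -> x = y.

Definition cancellative (C : small_category) :=
  left_cancellative C /\ right_cancellative C.

Section Groupoid.
Variable C : small_category.

(* Partial bijections are represented by their graphs: [s x y] is s(x) = y.
   The elements of [Il] are partial bijections when C is left cancellative. *)
Definition graph := C -> C -> Prop.

Definition graph_comp (s t : graph) : graph :=
  fun x z => exists2 y, t x y & s y z.

Definition graph_inv (s : graph) : graph := fun x y => s y x.

Definition graph_dom (s : graph) : set C := [set x | exists y, s x y].

Definition lmul (c : C) : graph := fun x y => tg x = dm c /\ y = comp c x.

Inductive Il_gen : graph -> Prop :=
| Il_lmul c : Il_gen (lmul c)
| Il_comp s t : Il_gen s -> Il_gen t -> Il_gen (graph_comp s t)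
| Il_inv s : Il_gen s -> Il_gen (graph_inv s).

Definition Il : set graph := [set s | Il_gen s].

Lemma Il_gen_val (s : Il) : Il_gen (val s).
Proof. by case: s => s /= /set_mem. Qed.

Definition Il_of (s : graph) (hs : Il_gen s) : Il :=
  exist (fun s => s \in Il) s (mem_set hs).

Definition Ilmul (s t : Il) : Il :=
  Il_of (Il_comp (Il_gen_val s) (Il_gen_val t)).

Definition Ilgen (c : C) : Il := Il_of (Il_lmul c).

Definition J : set (set C) := graph_dom @` Il.

Definition domJ (s : Il) : J :=
  exist (fun X => X \in J) (graph_dom (val s))
    (mem_set (ex_intro2 _ _ (val s) (Il_gen_val s) erefl)).

(* [preimJ s X] is s^{-1}(X `&` im s). *)
Lemma preimJ_subproof (s : Il) (X : J) :
  J [set x | exists2 y, (val X : set C) y & (val s : graph) x y].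
Proof.
case: X => X /= /set_mem [t ht <-].
exists (graph_comp t (val s)); first exact: Il_comp ht (Il_gen_val s).
apply/seteqP; split => x /=.
  by move=> [z [y sxy tyz]]; exists y => //; exists z.
by move=> [y [z tyz] sxy]; exists z, y.
Qed.

Definition preimJ (s : Il) (X : J) : J :=
  exist (fun X => X \in J) _ (mem_set (preimJ_subproof s X)).

(* [J] is stable under intersection when [C] is left cancellative; [Z] below is
   X `&` Y as an element of [J]. *)
Definition is_character (chi : {ptws J -> bool}) :=
  [/\ exists X, chi X,
      forall X Y Z : J, val Z = val X `&` val Y -> chi Z = chi X && chi Y &
      forall X : J, val X = set0 -> chi X = false].

Definition Omega : set {ptws J -> bool} := [set chi | is_character chi /\
  forall (X : J) (n : nat) (Xs : 'I_n -> J),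
    val X !=set0 -> (forall i, val (Xs i) !=set0) ->
    val X = \bigcup_i val (Xs i) -> chi X -> exists i, chi (Xs i)].

Definition maximal_character (chi : {ptws J -> bool}) :=
  is_character chi /\
  forall gam, is_character gam -> [set X | chi X] `<=` [set X | gam X] ->
    [set X | gam X] = [set X | chi X].

Definition bdOmega : set Omega :=
  closure [set chi : Omega | maximal_character (val chi)].

Definition OmegaX (X : J) : set Omega := [set chi : Omega | val chi X].

(* s.chi, meaningful for chi in OmegaX (domJ s) *)
Definition act (s : Il) (chi : {ptws J -> bool}) : {ptws J -> bool} :=
  fun X => chi (preimJ s X).

Definition germ_eqv (p q : Il * Omega) :=
  p.2 = q.2 /\
  exists2 X : J, val p.2 X &
    forall x, (val X : set C) x ->
      exists2 y, (val p.1 : graph) x y & (val q.1 : graph) x y.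

Definition germ_class (s : Il) (chi : Omega) : set (Il * Omega) :=
  [set q | OmegaX (domJ q.1) q.2 /\ germ_eqv (s, chi) q].

(* The arrows of the groupoid of germs of I_l on Omega are the equivalence
   classes [s, chi] themselves. *)
Definition germs : Type :=
  {A : set (Il * Omega) |
    exists s chi, OmegaX (domJ s) chi /\ A = germ_class s chi}.

HB.instance Definition _ := gen_eqMixin germs.
HB.instance Definition _ := gen_choiceMixin germs.

Definition is_germ (g : germs) (s : Il) (chi : Omega) :=
  OmegaX (domJ s) chi /\ sval g = germ_class s chi.

(* The graph of the partial multiplication: [germ_mul g h k] is gh = k. *)
Definition germ_mul (g h k : germs) := exists (s t : Il) (chi psi : Omega),
  [/\ val psi = act t (val chi), is_germ g s psi, is_germ h t chi &
      is_germ k (Ilmul s t) chi].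

Definition bisection (s : Il) (U : set Omega) : set germs :=
  [set g | exists2 chi, U chi & is_germ g s chi].

Definition basic_bisections : set (set germs) :=
  [set A | exists s U, [/\ U `<=` OmegaX (domJ s), compact U, open U &
                           A = bisection s U]].

HB.instance Definition _ :=
  isSubBaseTopological.Build germs basic_bisections id.

(* The arrows with source and range in bdOmega; as a type, it carries the
   subspace topology. *)
Definition bd_germs : set germs := [set g | exists s (chi psi : Omega),
  [/\ is_germ g s chi, val psi = act s (val chi), bdOmega chi & bdOmega psi]].

Definition bd_germ_mul (g h k : bd_germs) :=
  germ_mul (val g) (val h) (val k).

End Groupoid.

(* Declared as a [numClosedFieldType] so that its norm topology is inferred. *)
Definition cplx (R : realType) : numClosedFieldType := R[i].

Definition modulus (R : realType) (z : cplx R) : R := ComplexField.Normc.normc z.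

Section Ell2.
Variables (R : realType) (I : choiceType).

Definition sqsum (xi : I -> cplx R) : \bar R :=
  \esum_(i in [set: I]) ((modulus (xi i)) ^+ 2)%:E.

Definition ell2_pred : {pred (I -> cplx R)} :=
  mem [set xi : I -> cplx R | (sqsum xi < +oo)%E].

Lemma sqsum_lincomb_le (k : cplx R) (u v : I -> cplx R) :
  exists n : nat,
    (sqsum (k *: u + v)%R <= \sum_(j < n) sqsum u + \sum_(j < 2) sqsum v)%E.
Proof.
pose n := (Num.bound (2 * modulus k ^+ 2)); exists n.
rewrite /sqsum -!esum_sum; try by move=> *; rewrite lee_fin sqr_ge0.
rewrite -esumD; try by move=> *; apply: sume_ge0 => *; rewrite lee_fin sqr_ge0.
apply: le_esum => i _; rewrite !sumEFin -EFinD lee_fin !sumr_const !card_ord.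
have hM : modulus ((k *: u + v) i) <= modulus k * modulus (u i) + modulus (v i).
  by rewrite /modulus -ComplexField.Normc.normcM; exact: le_normcD.
have h0 (z : cplx R) : 0 <= modulus z.
  by rewrite /modulus /ComplexField.Normc.normc; case: z => ? ?; exact: sqrtr_ge0.
have hn : 2 * modulus k ^+ 2 <= n%:R.
  by apply/ltW/archi_boundP; rewrite mulr_ge0 ?sqr_ge0.
have h1 : modulus ((k *: u + v) i) ^+ 2 <=
    (modulus k * modulus (u i) + modulus (v i)) ^+ 2.
  by rewrite lerXn2r ?nnegrE ?addr_ge0 ?mulr_ge0.
have h2 : (2 * modulus k ^+ 2) * modulus (u i) ^+ 2 <=
    n%:R * modulus (u i) ^+ 2 by rewrite ler_wpM2r ?sqr_ge0.
have h3 := sqr_ge0 (modulus k * modulus (u i) - modulus (v i)).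
rewrite -[_ *+ n]mulr_natl -[_ *+ 2]mulr_natl.
apply: (le_trans h1); nra.
Qed.

Lemma ell2_submod_closed : submod_closed ell2_pred.
Proof.
split=> [|k u v].
  apply/mem_set => /=.
  have -> : sqsum 0 = 0%E; last exact: ltry.
  by apply: esum1 => i _; rewrite /modulus ComplexField.Normc.normc0 expr0n.
move=> /set_mem /= hu /set_mem /= hv; apply/mem_set => /=.
have [n] := sqsum_lincomb_le k u v; move/le_lt_trans; apply.
by rewrite lte_add_pinfty // lte_sum_pinfty.
Qed.

HB.instance Definition _ :=
  GRing.isSubmodClosed.Build (cplx R) (I -> cplx R) ell2_pred
    ell2_submod_closed.

Record ell2 := Ell2 { ell2_fun :> I -> cplx R; _ : ell2_fun \in ell2_pred }.

HB.instance Definition _ := [isSub for ell2_fun].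
HB.instance Definition _ := [Choice of ell2 by <:].
HB.instance Definition _ := [SubChoice_isSubLmodule of ell2 by <:].

Definition ell2_norm (xi : ell2) : R := Num.sqrt (fine (sqsum xi)).

(* The sum of u when u is absolutely summable. *)
Definition rsum (u : I -> R) : R :=
  fine (\esum_(i in [set: I]) (Num.max (u i) 0)%:E) -
  fine (\esum_(i in [set: I]) (Num.max (- u i) 0)%:E).

Definition csum (u : I -> cplx R) : cplx R :=
  Complex (rsum (fun i => complex.Re (u i))) (rsum (fun i => complex.Im (u i))).

Definition inner (xi eta : ell2) : cplx R := csum (fun i => xi i * (eta i)^*).

Definition op := ell2 -> ell2.

Definition bounded_op (T : op) :=
  linear T /\ exists M : R, forall xi, ell2_norm (T xi) <= M * ell2_norm xi.

Definition op_norm (T : op) : R :=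
  sup [set ell2_norm (T xi) | xi in [set xi | ell2_norm xi <= 1]].

Definition adjoint_pair (S T : op) :=
  forall xi eta, inner (S xi) eta = inner xi (T eta).

Definition norm_closure (A : set op) : set op :=
  [set T | bounded_op T /\
    forall e : R, 0 < e -> exists2 S, A S & op_norm (T - S) < e].

Definition closed_subalgebra (A : set op) :=
  [/\ A `<=` bounded_op, A 0,
      forall (k : cplx R) S T, A S -> A T -> A (k *: S + T),
      forall S T, A S -> A T -> A (S \o T) &
      norm_closure A `<=` A].

Definition closed_algebra_gen (G : set op) : set op :=
  \bigcap_(A in [set A | closed_subalgebra A /\ G `<=` A]) A.

(* The norm of M_n(B(l^2)), i.e. of operators on the Hilbert sum of n copies of
   [ell2]. *)
Definition mx_op_norm (n : nat) (a : 'M[op]_n) : R :=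
  sup [set Num.sqrt (\sum_i ell2_norm (\sum_j a i j (xi j)) ^+ 2)
      | xi in [set xi : 'I_n -> ell2 | \sum_j ell2_norm (xi j) ^+ 2 <= 1]].

End Ell2.

Section Homomorphisms.
Variables (R : realType) (I I' : choiceType).
Variables (A : set (op R I)) (B : set (op R I')) (q : op R I -> op R I').

Definition star_hom :=
  [/\ forall a, A a -> B (q a),
      forall (k : cplx R) a b, A a -> A b -> q (k *: a + b) = k *: q a + q b,
      forall a b, A a -> A b -> q (a \o b) = q a \o q b &
      forall a b, A a -> A b -> adjoint_pair a b -> adjoint_pair (q a) (q b)].

Definition completely_isometric_on :=
  forall (n : nat) (a : 'M[op R I]_n),
    (forall i j, A (a i j)) -> mx_op_norm (map_mx q a) = mx_op_norm a.

End Homomorphisms.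

Section Reduced.
Variables (R : realType) (G : topologicalType).
(* [m g h k] is [gh = k]. *)
Variable m : G -> G -> G -> Prop.

Definition Cc (f : G -> cplx R) :=
  continuous f /\ compact (closure [set g | f g != 0]).

(* T is convolution by f on l^2(G), i.e. the direct sum over the units x of the
   regular representations on l^2(G_x).  For f in Cc the sum is finite. *)
Definition is_regular_rep (f : G -> cplx R) (T : op R G) :=
  bounded_op T /\ forall (xi : ell2 R G) (g : G),
    T xi g = \sum_(p \in [set p : G * G | m p.1 p.2 g]) f p.1 * xi p.2.

Definition Cstar_r : set (op R G) :=
  norm_closure [set T | exists2 f, Cc f & is_regular_rep f T].

End Reduced.

Section Boundary.
Variables (R : realType) (C : small_category).

(* [Cstar_r] is norm closed among the bounded operators, so the closed subalgebra
   generated inside it is the one generated inside the bounded operators. *)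
Definition Ar : set (op R (germs C)) :=
  closed_algebra_gen [set T | exists c : C,
    is_regular_rep (@germ_mul C)
      (\1_(bisection (Ilgen c) (OmegaX (domJ (Ilgen c))))) T].

Definition is_boundary_quotient (q : op R (germs C) -> op R (@bd_germs C)) :=
  [/\ star_hom (Cstar_r (@germ_mul C)) (Cstar_r (@bd_germ_mul C)) q,
      set_surj (Cstar_r (@germ_mul C)) (Cstar_r (@bd_germ_mul C)) q &
      forall f T, Cc f -> is_regular_rep (@germ_mul C) f T ->
        is_regular_rep (@bd_germ_mul C) (f \o val) (q T)].

End Boundary.

(* Main.v *)
(* Let lam_s be left multiplication by [s, Omega(dom s)] on l^2 of the groupoid.
   On the closed span of the lam_s, q is the compression to the boundary germs:
   this holds for each lam_s, and q is continuous because, if |a| <= 1/2, then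
   a*a = 2c - c^2 for some c = c* in the algebra, so that
   |q(a)x|^2 + |x - q(c)x|^2 = |x|^2.  Hence q is completely contractive.

   Conversely, for x in C let chi_x be the character of all ideals containing x;
   these characters are dense in Omega, and the germ [s, chi_x] is determined by
   the arrow s(x).  Choose a maximal character omega containing all ideals
   through d(x).  By right cancellation y |-> [y, omega] is injective on the
   arrows y with d(y) = d(x), and it intertwines the lam_c, c in C.  As the
   groupoid is Hausdorff, finitely many germs over any chi in Omega coincide or
   differ exactly as they do over chi_x, for x close to chi.  So a matrix over
   the span of the lam_c acts on finitely supported vectors of the fibre over
   chi as its image under q acts on vectors of the same norms in the fibre over
   the boundary point omega. *)
Require Import Defs.
From mathcomp Require Import all_boot all_order all_algebra.
From mathcomp Require Import finmap complex ring lra.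
From mathcomp Require Import all_classical all_reals.
From mathcomp Require Import ereal topology normedtype numfun esum.

Set Implicit Arguments.
Unset Strict Implicit.
Unset Printing Implicit Defensive.

Import Order.TTheory GRing.Theory Num.Theory.
Import numFieldNormedType.Exports.

Local Open Scope classical_set_scope.
Local Open Scope ring_scope.

(** * Sums of nonnegative families *)

(** The point x and the maximal character omega depend on the finitely many germs in play, so they
    are chosen only after matrix entries and vectors have been replaced by finite data. Hence no
    single isometry intertwines a matrix with its image under q, and the boundary vectors are not
    claimed to converge: only the bound by the norm of the image passes to the limit.

    The maximal omega may contain more ideals than those through d(x). So [c^-1 y, omega] may exist
    although y does not lie in cC: the germs [y, omega] are compatible with left multiplication by
    c, but in general not with its adjoint. This confines the lower estimate to the nonselfadjoint
    algebra. The span of all lam_s is selfadjoint; it serves to prove q continuous, as q is given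
    explicitly only on C_c.

    Inner products are handled through their real parts, which polarization expresses by norms, and
    limits are taken at the rate 2^-n. *)

Section Sums.
Variables (R : realType) (I : choiceType).
Implicit Types (a b : I -> R).

Definition nsum a : \bar R := \esum_(i in [set: I]) (a i)%:E.

Definition nsummable a := (forall i, 0 <= a i) /\ (nsum a < +oo)%E.

Lemma nsum_ge0 a : (forall i, 0 <= a i) -> (0 <= nsum a)%E.
Proof. by move=> h; apply: esum_ge0 => i _; rewrite lee_fin. Qed.

Lemma nsum_fin a : nsummable a -> nsum a = (fine (nsum a))%:E.
Proof.
move=> [h1 h2]; rewrite fineK // ge0_fin_numE //; exact: nsum_ge0.
Qed.

Lemma nsumD a b : (forall i, 0 <= a i) -> (forall i, 0 <= b i) ->
  nsum (fun i => a i + b i) = (nsum a + nsum b)%E.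
Proof.
move=> h1 h2; rewrite /nsum -esumD; try by move=> i _; rewrite lee_fin.
by apply: eq_esum => i _; rewrite EFinD.
Qed.

Lemma nsum_le a b : (forall i, a i <= b i) -> (nsum a <= nsum b)%E.
Proof. by move=> h; apply: le_esum => i _; rewrite lee_fin. Qed.

Lemma nsum_fset_le (F : {fset I}) a : (forall i, 0 <= a i) ->
  ((\sum_(i <- F) a i)%:E <= nsum a)%E.
Proof.
move=> h; apply: esum_ge; exists [set` F]; first by split=> //; exact: finite_fset.
by rewrite fsbig_finite //= set_fsetK sumEFin.
Qed.

Lemma nsum_ub a (M : R) :
  (forall F : {fset I}, \sum_(i <- F) a i <= M) -> (nsum a <= M%:E)%E.
Proof.
move=> h; apply: ge_ereal_sup => _ [A [finA _] <-].
by rewrite fsbig_finite //= sumEFin lee_fin.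
Qed.

Lemma nsum_approx a (e : R) : nsummable a -> 0 < e ->
  exists F : {fset I}, fine (nsum a) - e < \sum_(i <- F) a i.
Proof.
move=> ha e0; apply/not_existsP => h.
have : (nsum a <= (fine (nsum a) - e)%:E)%E.
  by apply: nsum_ub => F; rewrite leNgt; apply/negP; exact: h.
by rewrite {1}nsum_fin // lee_fin; lra.
Qed.

Lemma nsumZ a (k : R) : 0 <= k -> (forall i, 0 <= a i) ->
  nsum (fun i => k * a i) = (k%:E * nsum a)%E.
Proof.
have le (c : R) b : 0 <= c -> (forall i, 0 <= b i) ->
    (nsum (fun i => c * b i)%R <= c%:E * nsum b)%E.
  move=> c0 b0; apply: ge_ereal_sup => _ [A [finA _] <-].
  rewrite fsbig_finite //= sumEFin -mulr_sumr EFinM.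
  by rewrite lee_wpmul2l ?lee_fin //; exact: nsum_fset_le.
move=> k0 a0; apply/eqP; rewrite eq_le le //=.
move: k0; rewrite [(0 <= k)%R]le_eqVlt => /predU1P[<-|k0].
  by rewrite mul0e; apply: nsum_ge0 => i; rewrite mul0r.
rewrite -lee_pdivlMl //.
apply: (le_trans _ (@le k^-1 (fun i => k * a i) _ _)).
- by apply: nsum_le => i; rewrite mulKf // gt_eqF.
- by rewrite invr_ge0 ltW.
- by move=> i; rewrite mulr_ge0 // ltW.
Qed.

Lemma nsummableD a b : nsummable a -> nsummable b ->
  nsummable (fun i => a i + b i).
Proof.
move=> [a0 ha] [b0 hb]; split; first by move=> i; rewrite addr_ge0.
by rewrite nsumD // lte_add_pinfty.
Qed.

Lemma nsummableZ a (k : R) : 0 <= k -> nsummable a ->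
  nsummable (fun i => k * a i).
Proof.
move=> k0 ha; have [a0 _] := ha; split; first by move=> i; rewrite mulr_ge0.
by rewrite nsumZ // (nsum_fin ha) -EFinM ltry.
Qed.

Lemma fine_nsumD a b : nsummable a -> nsummable b ->
  fine (nsum (fun i => a i + b i)) = fine (nsum a) + fine (nsum b).
Proof.
move=> ha hb; have [a0 _] := ha; have [b0 _] := hb.
by rewrite nsumD // (nsum_fin ha) (nsum_fin hb).
Qed.

Lemma fine_nsumZ a (k : R) : 0 <= k -> nsummable a ->
  fine (nsum (fun i => k * a i)) = k * fine (nsum a).
Proof. by move=> k0 ha; have [a0 _] := ha; rewrite nsumZ // (nsum_fin ha). Qed.

(** [rsum] is defined by positive and negative parts, yet any difference of summable nonnegative
    families computes it, because max(a-b, 0) + b = max(b-a, 0) + a. *)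
Lemma rsumB a b : nsummable a -> nsummable b ->
  rsum (fun i => a i - b i) = fine (nsum a) - fine (nsum b).
Proof.
move=> ha hb; have [a0 _] := ha; have [b0 _] := hb.
have sub (c d : I -> R) : nsummable c -> nsummable d ->
    nsummable (fun i => Num.max (c i - d i) 0).
  move=> [c0 hc] [d0 _]; split; first by move=> i; rewrite le_max lexx orbT.
  apply: le_lt_trans hc; apply: nsum_le => i.
  by rewrite ge_max c0 andbT lerBlDr lerDl.
have hp := sub _ _ ha hb; have hn := sub _ _ hb ha.
have -> : rsum (fun i => a i - b i) =
    fine (nsum (fun i => Num.max (a i - b i) 0)) -
    fine (nsum (fun i => Num.max (b i - a i) 0)).
  rewrite /rsum; congr (_ - _); rewrite /nsum.
  by congr fine; apply: eq_esum => i _; rewrite opprB.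
have := fine_nsumD hp hb; have := fine_nsumD hn ha.
have -> : (fun i => Num.max (b i - a i) 0 + a i) =
    (fun i => Num.max (a i - b i) 0 + b i).
  apply/funext => i; case: (leP (a i) (b i)) => h.
    by rewrite max_l ?subr_ge0 // max_r ?subr_le0 // subrK add0r.
  by rewrite max_r ?subr_le0 1?ltW // max_l ?subr_ge0 1?ltW // subrK add0r.
by move=> ->; lra.
Qed.

Definition absum (u : I -> R) :=
  exists a b, [/\ nsummable a, nsummable b & u = (fun i => a i - b i)].

Lemma rsumD (u v : I -> R) : absum u -> absum v ->
  rsum (fun i => u i + v i) = rsum u + rsum v.
Proof.
move=> [a [b [ha hb ->]]] [c [d [hc hd ->]]].
have -> : (fun i => a i - b i + (c i - d i)) =
    (fun i => (a i + c i) - (b i + d i)).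
  by apply/funext => i; rewrite opprD addrACA.
rewrite (rsumB (nsummableD ha hc) (nsummableD hb hd)) (rsumB ha hb).
by rewrite (rsumB hc hd) (fine_nsumD ha hc) (fine_nsumD hb hd) opprD addrACA.
Qed.

End Sums.

(** * The Hilbert space l^2 *)

Section Ell2Theory.
Variable R : realType.

Lemma Re_mul_conj (x y : cplx R) : complex.Re (x * y^*) =
  complex.Re x * complex.Re y + complex.Im x * complex.Im y.
Proof. by case: x y => a b [c d] /=; ring. Qed.

Lemma modulus_sq (x : cplx R) :
  modulus x ^+ 2 = complex.Re x ^+ 2 + complex.Im x ^+ 2.
Proof. by case: x => a b; rewrite /modulus /= sqr_sqrtr // addr_ge0 // sqr_ge0. Qed.

Lemma modulus_ge0 (x : cplx R) : 0 <= modulus x.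
Proof. by rewrite /modulus; case: x => a b; exact: sqrtr_ge0. Qed.

Lemma modulusM (x y : cplx R) : modulus (x * y) = modulus x * modulus y.
Proof. exact: ComplexField.Normc.normcM. Qed.

Lemma modulus0 : modulus (0 : cplx R) = 0.
Proof. exact: ComplexField.Normc.normc0. Qed.

Lemma modulus_eq0 (x : cplx R) : modulus x = 0 -> x = 0.
Proof. exact: ComplexField.Normc.eq0_normc. Qed.

Definition creal (t : R) : cplx R := Complex t 0.

Lemma modulus_creal (t : R) : 0 <= t -> modulus (creal t) = t.
Proof.
by move=> t0; rewrite /modulus /= expr0n /= addr0 sqrtr_sqr ger0_norm.
Qed.

Lemma modulus1 : modulus (1 : cplx R) = 1.
Proof. exact: (modulus_creal ler01). Qed.

Lemma modulusN (x : cplx R) : modulus (- x) = modulus x.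
Proof. by case: x => a b; rewrite /modulus /= !sqrrN. Qed.

(** Termwise polarization: the series of an inner product becomes a difference of two summable
    nonnegative families, so its convergence needs no separate estimate. *)
Lemma Re_mul_conj_polar (x y : cplx R) : complex.Re (x * y^*) =
  2^-1 * (modulus x ^+ 2 + modulus y ^+ 2) - 2^-1 * modulus (x - y) ^+ 2.
Proof.
rewrite Re_mul_conj !modulus_sq; by case: x y => a b [c d] /=; lra.
Qed.

Variable I : choiceType.
Implicit Types (xi eta : ell2 R I).

Lemma ell2P xi eta : (forall i, xi i = eta i) -> xi = eta.
Proof. by move=> h; apply/val_inj/funext. Qed.

Lemma ell2D xi eta i : (xi + eta) i = xi i + eta i. Proof. by []. Qed.
Lemma ell2N xi i : (- xi) i = - xi i. Proof. by []. Qed.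
Lemma ell2B xi eta i : (xi - eta) i = xi i - eta i. Proof. by []. Qed.
Lemma ell2Z k xi i : (k *: xi) i = k * xi i. Proof. by []. Qed.

Lemma ell2_sum J (r : seq J) (P : pred J) (F : J -> ell2 R I) i :
  (\sum_(j <- r | P j) F j) i = \sum_(j <- r | P j) F j i.
Proof.
by apply: (big_morph (fun xi : ell2 R I => xi i)).
Qed.

Definition nsq xi : R := fine (sqsum xi).

Lemma ell2_nsummable xi : nsummable (fun i => modulus (xi i) ^+ 2).
Proof.
split=> [i|]; first exact: sqr_ge0.
by have /set_mem := valP xi.
Qed.

Lemma nsqE xi : sqsum xi = (nsq xi)%:E.
Proof. exact: nsum_fin (ell2_nsummable xi). Qed.

Lemma nsq_ge0 xi : 0 <= nsq xi.
Proof. by rewrite -lee_fin -nsqE; apply: nsum_ge0 => i; rewrite sqr_ge0. Qed.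

Lemma ell2_norm_ge0 xi : 0 <= ell2_norm xi.
Proof. exact: sqrtr_ge0. Qed.

Lemma ell2_norm_sq xi : ell2_norm xi ^+ 2 = nsq xi.
Proof. by rewrite sqr_sqrtr // nsq_ge0. Qed.

Lemma ell2_norm_le xi (M : R) : 0 <= M ->
  (ell2_norm xi <= M) = (nsq xi <= M ^+ 2).
Proof.
by move=> M0; rewrite -ell2_norm_sq ler_sqr ?nnegrE // ell2_norm_ge0.
Qed.

Lemma nsqZ k xi : nsq (k *: xi) = modulus k ^+ 2 * nsq xi.
Proof.
rewrite /nsq -(fine_nsumZ (sqr_ge0 _) (ell2_nsummable xi)).
congr (fine (nsum _)); apply/funext => i.
by rewrite ell2Z modulusM exprMn.
Qed.

Lemma ell2_normZ k xi : ell2_norm (k *: xi) = modulus k * ell2_norm xi.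
Proof.
rewrite /ell2_norm -/(nsq _) nsqZ sqrtrM ?sqr_ge0 //.
by rewrite sqrtr_sqr ger0_norm // modulus_ge0.
Qed.

Lemma ell2_norm0 : ell2_norm (0 : ell2 R I) = 0.
Proof. by rewrite -(scale0r (0 : ell2 R I)) ell2_normZ modulus0 mul0r. Qed.

Lemma ell2_normN xi : ell2_norm (- xi) = ell2_norm xi.
Proof. by rewrite -scaleN1r ell2_normZ modulusN modulus1 mul1r. Qed.

Lemma nsqN xi : nsq (- xi) = nsq xi.
Proof. by rewrite -!ell2_norm_sq ell2_normN. Qed.

Lemma fset_nsq_le (F : {fset I}) xi :
  \sum_(i <- F) modulus (xi i) ^+ 2 <= nsq xi.
Proof.
rewrite -lee_fin -nsqE; apply: (@nsum_fset_le _ _ F (fun i => modulus (xi i) ^+ 2)).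
by move=> i; exact: sqr_ge0.
Qed.

Lemma modulus_le_norm xi i : modulus (xi i) <= ell2_norm xi.
Proof.
rewrite -ler_sqr ?nnegrE ?modulus_ge0 ?ell2_norm_ge0 // ell2_norm_sq.
by apply: le_trans (fset_nsq_le [fset i]%fset xi); rewrite big_seq_fset1.
Qed.

Lemma ell2_norm_eq0 xi : ell2_norm xi = 0 -> xi = 0.
Proof.
move=> h; apply: ell2P => i; apply: modulus_eq0; apply/eqP.
by rewrite eq_le modulus_ge0 andbT -h modulus_le_norm.
Qed.

Lemma Re_csum (u : I -> cplx R) :
  complex.Re (csum u) = rsum (fun i => complex.Re (u i)).
Proof. by []. Qed.

Lemma csumE (u : I -> cplx R) : csum u =
  Complex (rsum (fun i => complex.Re (u i))) (rsum (fun i => complex.Im (u i))).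
Proof. by []. Qed.

(** The real inner product under the complex one. It is symmetric and determined by norms, and
    [inner_redot] recovers the full inner product from it, so adjoints and Gram matrices can be
    treated over the reals. *)
Definition redot xi eta := complex.Re (inner xi eta).

Lemma redotE xi eta : redot xi eta = 2^-1 * (nsq xi + nsq eta - nsq (xi - eta)).
Proof.
have hx := ell2_nsummable xi; have hy := ell2_nsummable eta.
have hxy := ell2_nsummable (xi - eta).
have h0 : 0 <= (2^-1 : R) by rewrite invr_ge0.
rewrite /redot /inner /csum /=.
under [X in rsum X]funext do rewrite Re_mul_conj_polar.
rewrite (rsumB (nsummableZ h0 (nsummableD hx hy)) (nsummableZ h0 hxy)).
rewrite (fine_nsumZ h0 (nsummableD hx hy)) (fine_nsumZ h0 hxy).
by rewrite (fine_nsumD hx hy) -mulrBr.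
Qed.

Lemma redotC xi eta : redot xi eta = redot eta xi.
Proof. by rewrite !redotE -(nsqN (xi - eta)) opprB [nsq xi + _]addrC. Qed.

Lemma redot_absum xi eta : absum (fun i => complex.Re (xi i * (eta i)^*)).
Proof.
have hx := ell2_nsummable xi; have hy := ell2_nsummable eta.
have hxy := ell2_nsummable (xi - eta).
have h0 : 0 <= (2^-1 : R) by rewrite invr_ge0.
exists (fun i => 2^-1 * (modulus (xi i) ^+ 2 + modulus (eta i) ^+ 2)).
exists (fun i => 2^-1 * modulus ((xi - eta) i) ^+ 2).
split; [exact: nsummableZ (nsummableD hx hy)|exact: nsummableZ|].
by apply/funext => i; rewrite Re_mul_conj_polar.
Qed.

Lemma redotDl xi xi' eta : redot (xi + xi') eta = redot xi eta + redot xi' eta.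
Proof.
rewrite /redot /inner /csum /= -(rsumD (redot_absum _ _) (redot_absum _ _)).
congr rsum; apply/funext => i; rewrite mulrDl.
by case: (xi i * _) => ? ?; case: (xi' i * _) => ? ?.
Qed.

Lemma redotDr xi eta eta' : redot xi (eta + eta') = redot xi eta + redot xi eta'.
Proof. by rewrite redotC redotDl !(redotC _ xi). Qed.

Lemma redot0l eta : redot 0 eta = 0.
Proof. by have := redotDl 0 0 eta; rewrite addr0 -[X in X = _]addr0 => /addrI. Qed.

Lemma redotNl xi eta : redot (- xi) eta = - redot xi eta.
Proof. by apply/eqP; rewrite -addr_eq0 -redotDl addNr redot0l. Qed.

Lemma redotNr xi eta : redot xi (- eta) = - redot xi eta.
Proof. by rewrite redotC redotNl redotC. Qed.

Lemma redotBl xi xi' eta : redot (xi - xi') eta = redot xi eta - redot xi' eta.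
Proof. by rewrite redotDl redotNl. Qed.

Lemma redotBr xi eta eta' : redot xi (eta - eta') = redot xi eta - redot xi eta'.
Proof. by rewrite redotDr redotNr. Qed.

Lemma redot_self xi : redot xi xi = nsq xi.
Proof. by rewrite redotE subrr -ell2_norm_sq -(ell2_norm_sq 0) ell2_norm0; field. Qed.

Lemma redot_suml J (r : seq J) (F : J -> ell2 R I) eta :
  redot (\sum_(j <- r) F j) eta = \sum_(j <- r) redot (F j) eta.
Proof.
elim: r => [|j r IH]; first by rewrite !big_nil redot0l.
by rewrite !big_cons redotDl IH.
Qed.

Lemma redot_sumr J (r : seq J) (F : J -> ell2 R I) eta :
  redot eta (\sum_(j <- r) F j) = \sum_(j <- r) redot eta (F j).
Proof. by rewrite redotC redot_suml; apply: eq_bigr => j _; rewrite redotC. Qed.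

Lemma redot_scale_inv (t : R) xi eta : t != 0 ->
  redot (creal t *: xi) (creal t^-1 *: eta) = redot xi eta.
Proof.
move=> t0; rewrite /redot /inner !Re_csum; congr rsum; apply/funext => i.
rewrite !ell2Z !Re_mul_conj; case: (xi i) (eta i) => a b [c d] /=.
field.
exact: t0.
Qed.

(** Cauchy-Schwarz from 2<u,v> <= |u|^2 + |v|^2, which is [redotE] with a square dropped, after
    rescaling by [t] and [t^-1], which leaves [redot] unchanged. *)
Lemma redot_le_norm xi eta : redot xi eta <= ell2_norm xi * ell2_norm eta.
Proof.
have [/eqP /ell2_norm_eq0 ->|x0] := boolP (ell2_norm xi == 0).
  by rewrite redot0l ell2_norm0 mul0r.
have [/eqP /ell2_norm_eq0 ->|y0] := boolP (ell2_norm eta == 0).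
  by rewrite redotC redot0l ell2_norm0 mulr0.
have xp : 0 < ell2_norm xi by rewrite lt_def x0 ell2_norm_ge0.
have yp : 0 < ell2_norm eta by rewrite lt_def y0 ell2_norm_ge0.
(* This [t] balances the two squares: |t xi|^2 and |t^-1 eta|^2 both become |xi| |eta|. *)
set t := Num.sqrt (ell2_norm eta / ell2_norm xi).
have tp : 0 < t by rewrite sqrtr_gt0 divr_gt0.
have t2 : t ^+ 2 = ell2_norm eta / ell2_norm xi.
  by rewrite sqr_sqrtr // divr_ge0 // ell2_norm_ge0.
rewrite -(redot_scale_inv _ _ (lt0r_neq0 tp)) redotE.
rewrite -!ell2_norm_sq !ell2_normZ !modulus_creal ?invr_ge0; try exact: ltW.
rewrite !exprMn exprVn t2 ell2_norm_sq.
set N := nsq _; have : 0 <= N by exact: nsq_ge0.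
have -> : ell2_norm eta / ell2_norm xi * ell2_norm xi ^+ 2 =
  ell2_norm xi * ell2_norm eta by field.
have -> : (ell2_norm eta / ell2_norm xi)^-1 * ell2_norm eta ^+ 2 =
  ell2_norm xi * ell2_norm eta by field; rewrite x0 y0.
move=> HN.
lra.
Qed.

Lemma nsqD xi eta : nsq (xi + eta) = nsq xi + nsq eta + 2 * redot xi eta.
Proof. by rewrite -!redot_self redotDl !redotDr (redotC eta xi); ring. Qed.

Lemma nsqB xi eta : nsq (xi - eta) = nsq xi + nsq eta - 2 * redot xi eta.
Proof. by rewrite nsqD nsqN redotNr; ring. Qed.

Lemma ler_ell2_normD xi eta :
  ell2_norm (xi + eta) <= ell2_norm xi + ell2_norm eta.
Proof.
rewrite ell2_norm_le ?addr_ge0 ?ell2_norm_ge0 // nsqD -!ell2_norm_sq.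
by have := redot_le_norm xi eta; lra.
Qed.

Lemma ler_ell2_normB xi eta :
  ell2_norm (xi - eta) <= ell2_norm xi + ell2_norm eta.
Proof. by rewrite -(ell2_normN eta) ler_ell2_normD. Qed.

Lemma ler_ell2_norm_sum J (r : seq J) (F : J -> ell2 R I) :
  ell2_norm (\sum_(j <- r) F j) <= \sum_(j <- r) ell2_norm (F j).
Proof.
elim: r => [|j r IH]; first by rewrite !big_nil ell2_norm0.
by rewrite !big_cons (le_trans (ler_ell2_normD _ _)) // lerD2l.
Qed.

(** Im z = Re(-i z), and the conjugate-linear second slot turns -i into i. *)
Lemma inner_redot xi eta :
  inner xi eta = Complex (redot xi eta) (redot xi (Complex 0 1 *: eta)).
Proof.
rewrite /redot /inner !Re_csum csumE; congr Complex; congr rsum; apply/funext => i.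
rewrite ell2Z Re_mul_conj; case: (xi i) (eta i) => a b [c d] /=.
ring.
Qed.

Lemma linear0_op (V W : lmodType (cplx R)) (T : V -> W) : linear T -> T 0 = 0.
Proof.
move=> linT; have := linT 1 0 0; rewrite !scale1r addr0.
by rewrite -[X in X = _]addr0 => /addrI.
Qed.

Lemma linearD_op (V W : lmodType (cplx R)) (T : V -> W) : linear T ->
  forall u v, T (u + v) = T u + T v.
Proof. by move=> linT u v; have := linT 1 u v; rewrite !scale1r. Qed.

Lemma linearZ_op (V W : lmodType (cplx R)) (T : V -> W) : linear T ->
  forall k u, T (k *: u) = k *: T u.
Proof.
by move=> linT k u; have := linT k u 0; rewrite addr0 (linear0_op linT) addr0.
Qed.

Lemma linearB_op (V W : lmodType (cplx R)) (T : V -> W) : linear T ->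
  forall u v, T (u - v) = T u - T v.
Proof.
move=> linT u v; rewrite (linearD_op linT) -scaleN1r (linearZ_op linT).
by rewrite scaleN1r.
Qed.

Lemma linear_sum_op (V W : lmodType (cplx R)) (T : V -> W) : linear T ->
  forall J (r : seq J) (F : J -> V),
  T (\sum_(j <- r) F j) = \sum_(j <- r) T (F j).
Proof.
move=> linT J r F.
apply: (big_morph T); [exact: linearD_op|exact: linear0_op].
Qed.

(** Imaginary parts agree along with real parts, since [T] commutes with multiplication by i. *)
Lemma adjoint_pairP (S T : op R I) : linear T ->
  adjoint_pair S T <-> forall xi eta, redot (S xi) eta = redot xi (T eta).
Proof.
move=> linT; split=> h xi eta; first by rewrite /redot h.
rewrite !inner_redot h h; congr Complex; congr redot.
by rewrite (linearZ_op linT).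
Qed.

End Ell2Theory.

(** * Limits at geometric rate *)

Section Geometric.
Variable R : realType.
Local Notation h := (2^-1 : R).

Lemma half_ge0 n : 0 <= h ^+ n.
Proof. by rewrite exprn_ge0 // invr_ge0. Qed.

Lemma mulrn_half_le1 n : n%:R * h ^+ n <= 1.
Proof.
rewrite exprVn ler_pdivrMr ?exprn_gt0 // mul1r -natrX ler_nat.
exact/ltnW/ltn_expl.
Qed.

(** If x > 0, take n with K < n x; then x <= K 2^-n < n 2^-n x <= x. This turns estimates valid for
    every n into exact identities. *)
Lemma geom_le0 (x K : R) : (forall n, x <= K * h ^+ n) -> x <= 0.
Proof.
move=> hx; rewrite leNgt; apply/negP => x0.
have [n hn] : exists n : nat, K < n%:R * x.
  exists (Num.bound (K / x)); rewrite -ltr_pdivrMr //.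
  have [K0|K0] := leP 0 K; first by apply: archi_boundP; rewrite divr_ge0 // ltW.
  by apply: lt_le_trans (ler0n _ _); rewrite pmulr_llt0 // invr_gt0.
have hp : 0 < h ^+ n by rewrite exprn_gt0 // invr_gt0.
have := mulrn_half_le1 n; have := hx n.
have : K * h ^+ n < (n%:R * x) * h ^+ n by rewrite ltr_pM2r.
have -> : n%:R * x * h ^+ n = x * (n%:R * h ^+ n) by ring.
move=> h1 h2 h3.
have : x * (n%:R * h ^+ n) <= x by rewrite ler_piMr // ltW.
lra.
Qed.

Lemma geom_small (K e : R) : 0 < e -> exists n, K * h ^+ n < e.
Proof.
move=> e0; apply/not_existsP => hn.
have := @geom_le0 e K; rewrite leNgt e0 => /(_ _)/negP; apply => // n.
by rewrite leNgt; apply/negP/hn.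
Qed.

(** The limit is the supremum of the lower bounds [r n - K * h ^+ n]; every [r m + K * h ^+ m] lies
    above all of them. *)
Lemma real_geom_limit (r : nat -> R) (K : R) : 0 <= K ->
  (forall n m, (n <= m)%N -> `|r m - r n| <= K * h ^+ n) ->
  exists l, forall n, `|l - r n| <= K * h ^+ n.
Proof.
move=> K0 hr.
have hK n : 0 <= K * h ^+ n by rewrite mulr_ge0 // half_ge0.
have ub n m : r n - K * h ^+ n <= r m + K * h ^+ m.
  have := hK n; have := hK m.
  case: (leqP n m) => [/hr|/ltnW /hr]; rewrite ler_norml => /andP[]; lra.
exists (sup [set r n - K * h ^+ n | n in [set: nat]]) => n.
have hs : has_sup [set r n - K * h ^+ n | n in [set: nat]].
  split; first by exists (r 0%N - K * h ^+ 0), 0%N.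
  by exists (r 0%N + K * h ^+ 0) => _ [k _ <-].
have h1 : r n - K * h ^+ n <= sup [set r n - K * h ^+ n | n in [set: nat]].
  by apply: ub_le_sup; [case: hs|exists n].
have h2 : sup [set r n - K * h ^+ n | n in [set: nat]] <= r n + K * h ^+ n.
  by apply: ge_sup; [case: hs|move=> _ [k _ <-]].
by rewrite ler_norml; lra.
Qed.

End Geometric.

Section Ell2More.
Variables (R : realType) (I : choiceType).
Implicit Types (xi eta : ell2 R I).
Local Notation h := (2^-1 : R).

Lemma nsq_ub xi (M : R) :
  (forall F : {fset I}, \sum_(i <- F) modulus (xi i) ^+ 2 <= M) -> nsq xi <= M.
Proof. by move=> hM; rewrite -lee_fin -nsqE; exact: nsum_ub. Qed.

Lemma ell2_ub_ex (x : I -> cplx R) (M : R) :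
  (forall F : {fset I}, \sum_(i <- F) modulus (x i) ^+ 2 <= M) ->
  exists2 xi : ell2 R I, (xi : I -> cplx R) = x & nsq xi <= M.
Proof.
move=> hM; have hx : x \in ell2_pred (R := R) (I := I).
  apply/mem_set => /=; apply: (le_lt_trans (nsum_ub hM)); exact: ltry.
by exists (Ell2 hx) => //; exact: nsq_ub.
Qed.

(** Completeness of l^2 for geometric Cauchy sequences: coordinates converge by [real_geom_limit],
    and the norm estimate is checked on each finite set of coordinates. *)
Lemma ell2_geom_limit (u : nat -> ell2 R I) (K : R) : 0 <= K ->
  (forall n m, (n <= m)%N -> ell2_norm (u m - u n) <= K * h ^+ n) ->
  exists xi, forall n, ell2_norm (xi - u n) <= 2 * K * h ^+ n.
Proof.
move=> K0 hu.
have lim (f : cplx R -> R) : (forall x y, f (x - y) = f x - f y) ->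
    (forall x, `|f x| <= modulus x) -> forall i, exists l, forall n,
    `|l - f (u n i)| <= K * h ^+ n.
  move=> fB fm i; apply: real_geom_limit => // n m nm; rewrite -fB.
  apply: le_trans (fm _) _; apply: le_trans (hu n m nm).
  exact: (modulus_le_norm (u m - u n)).
have /choice[re hre] : forall i, exists l, forall n,
    `|l - complex.Re (u n i)| <= K * h ^+ n.
  apply: lim => [[a b] [c d] //|x]; rewrite -ler_sqr ?nnegrE ?modulus_ge0 //.
  by rewrite modulus_sq real_normK ?num_real // lerDl sqr_ge0.
have /choice[im him] : forall i, exists l, forall n,
    `|l - complex.Im (u n i)| <= K * h ^+ n.
  apply: lim => [[a b] [c d] //|x]; rewrite -ler_sqr ?nnegrE ?modulus_ge0 //.
  by rewrite modulus_sq real_normK ?num_real // lerDr sqr_ge0.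
pose x i : cplx R := Complex (re i) (im i).
have hx i n : modulus (x i - u n i) ^+ 2 <= 2 * (K * h ^+ n) ^+ 2.
  have hK : 0 <= K * h ^+ n by rewrite mulr_ge0 // half_ge0.
  rewrite modulus_sq /x; have := hre i n; have := him i n.
  rewrite -!(ler_sqr (x := `| _|)) ?nnegrE // !real_normK ?num_real //.
  by case: (u n i) => a b /=; lra.
have bnd n (F : {fset I}) :
    \sum_(i <- F) modulus (x i - u n i) ^+ 2 <= (2 * K * h ^+ n) ^+ 2.
  (* [m] depends on the size N of [F]: the N coordinate errors at time m contribute at most 4 N (K
     h^m)^2 = (K h^n)^2 N h^(2N) <= (K h^n)^2. The extra 1 in the exponent absorbs the factor 4. *)
  pose m := (n + #|`F|.+1)%N.
  have le i : modulus (x i - u n i) ^+ 2 <=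
      2 * modulus ((u m - u n) i) ^+ 2 + 4 * (K * h ^+ m) ^+ 2.
    have := hx i m; rewrite ell2B !modulus_sq.
    case: (x i) (u n i) (u m i) => a b [c d] [e f] /= hm.
    have := sqr_ge0 (a - e - (e - c)); have := sqr_ge0 (b - f - (f - d)); lra.
  apply: (le_trans (ler_sum _ (fun i _ => le i))).
  rewrite big_split /= -mulr_sumr big_const_seq count_predT iter_addr_0.
  have h1 : \sum_(i <- F) modulus ((u m - u n) i) ^+ 2 <= (K * h ^+ n) ^+ 2.
    apply: (le_trans (fset_nsq_le F (u m - u n))).
    by rewrite -ell2_norm_le ?mulr_ge0 ?half_ge0 //; apply: hu; exact: leq_addr.
  have h2 : #|`F|%:R * h ^+ #|`F| <= 1 by exact: mulrn_half_le1.
  have h3 : h ^+ #|`F| <= 1.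
    by rewrite exprn_ile1 ?invr_ge0 // invf_le1 // ler1n.
  have h4 : #|`F|%:R * (h ^+ #|`F|) ^+ 2 <= 1.
    rewrite expr2 mulrA (le_trans _ h3) // ler_piMl ?half_ge0 //.
  rewrite -[X in _ + X]mulr_natl.
  have -> : #|`F|%:R * (4 * (K * h ^+ m) ^+ 2) =
      (K * h ^+ n) ^+ 2 * (#|`F|%:R * (h ^+ #|`F|) ^+ 2).
    rewrite /m exprD (exprS _ #|`F|).
    move: (h ^+ n) (h ^+ #|`F|) (#|`F|%:R : R) => p r v; by field.
  have : (K * h ^+ n) ^+ 2 * (#|`F|%:R * (h ^+ #|`F|) ^+ 2) <= (K * h ^+ n) ^+ 2.
    by rewrite ler_piMr // sqr_ge0.
  have := sqr_ge0 (K * h ^+ n).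
  have e4 : (2 * K * h ^+ n) ^+ 2 = 4 * (K * h ^+ n) ^+ 2 by ring.
  rewrite e4; lra.
have [w hw _] := ell2_ub_ex (bnd 0%N).
(* Only differences from the sequence are known to be square summable; [w] is the coordinatewise
   limit minus [u 0]. *)
exists (w + u 0%N) => n; rewrite ell2_norm_le ?mulr_ge0 ?half_ge0 //.
apply: nsq_ub => F; apply: le_trans (bnd n F); apply: ler_sum => i _.
by rewrite ell2B ell2D hw subrK.
Qed.

End Ell2More.

(** * Operators given by partial injections *)

Section PartialInjections.
Variables (R : realType) (I I' : choiceType).

(** [f] points backwards, from a target index to its preimage, so that [pinj] is precomposition with
    [f] extended by 0. Translations by germs, restrictions to fibres and passage to and from the
    boundary all have this form. *)
Definition pinjective (f : I' -> option I) :=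
  forall i j k, f i = Some k -> f j = Some k -> i = j.

Lemma sum_uniq_le_nsum (s : seq I) (a : I -> R) : (forall i, 0 <= a i) ->
  uniq s -> ((\sum_(i <- s) a i)%:E <= nsum a)%E.
Proof.
move=> a0 us; have := nsum_fset_le (seq_fset tt s) a0; congr (_%:E <= _)%E.
by apply: perm_big; rewrite (perm_trans (seq_fset_perm tt s)) // undup_id.
Qed.

Lemma nsum_pinj (f : I' -> option I) (a : I -> R) : (forall i, 0 <= a i) ->
  pinjective f -> (nsum (fun i => oapp a 0 (f i))%R <= nsum a)%E.
Proof.
move=> a0 finj; apply: ge_ereal_sup => _ [A [finA _] <-].
rewrite fsbig_finite //= sumEFin.
have : uniq (fset_set A) by exact: fset_uniq.
move: (enum_fset (fset_set A)) => s us.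
(* By injectivity the values of [f] along [s] are distinct, so they form a duplicate-free list and
   give a partial sum of [nsum a]. *)
suff [t [ut _ le]] : exists t, [/\ uniq t,
    (forall k, k \in t -> exists2 i, i \in s & f i = Some k) &
    \sum_(i <- s) oapp a 0 (f i) <= \sum_(k <- t) a k].
  by apply: le_trans (sum_uniq_le_nsum a0 ut); rewrite lee_fin.
elim: s us => [_|i s IH /= /andP[nis us]].
  by exists [::]; split => //; rewrite !big_nil.
have [t [ut ht le]] := IH us; rewrite big_cons.
case fi: (f i) => [k|] /=.
  exists (k :: t); split.
  - rewrite /= ut andbT; apply/negP => /ht [j js fj].
    by rewrite (finj _ _ _ fi fj) js in nis.
  - move=> k'; rewrite inE => /predU1P[->|/ht [j js fj]].
      by exists i => //; rewrite mem_head.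
    by exists j => //; rewrite inE js orbT.
  - by rewrite big_cons lerD2l.
exists t; split => //; last by rewrite add0r.
by move=> k /ht [j js fj]; exists j => //; rewrite inE js orbT.
Qed.

Variables (f : I' -> option I) (finj : pinjective f).

Lemma pinj_subproof (xi : ell2 R I) :
  (fun i => oapp xi 0 (f i)) \in ell2_pred (R := R) (I := I').
Proof.
have [_ hx] := ell2_nsummable xi.
apply/mem_set => /=; apply: le_lt_trans hx.
apply: le_trans (nsum_pinj (fun i => sqr_ge0 (modulus (xi i))) finj).
apply: nsum_le => i; case: (f i) => [j|]; first by [].
by rewrite [oapp _ _ _]/= modulus0 expr0n.
Qed.

Definition pinj (xi : ell2 R I) : ell2 R I' := Ell2 (pinj_subproof xi).

Lemma pinjE xi i : pinj xi i = oapp xi 0 (f i). Proof. by []. Qed.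

Lemma pinj_linear : linear pinj.
Proof.
move=> k u v; apply: ell2P => i; rewrite ell2D ell2Z !pinjE.
by case: (f i) => [j|] //=; rewrite mulr0 addr0.
Qed.

Lemma pinj_nsq xi : nsq (pinj xi) <= nsq xi.
Proof.
rewrite -lee_fin -!nsqE.
apply: le_trans (nsum_pinj (fun i => sqr_ge0 (modulus (xi i))) finj).
apply: nsum_le => i; rewrite pinjE; case: (f i) => [j|]; first by [].
by rewrite [oapp _ _ _]/= modulus0 expr0n.
Qed.

Lemma pinj_norm xi : ell2_norm (pinj xi) <= ell2_norm xi.
Proof. by rewrite ell2_norm_le ?ell2_norm_ge0 // ell2_norm_sq pinj_nsq. Qed.

End PartialInjections.

Section PinjAdjoint.
Variables (R : realType) (I I' : choiceType).
Variables (f : I' -> option I) (g : I -> option I').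
Variables (finj : pinjective f) (ginj : pinjective g).
Hypothesis fg : forall i j, f i = Some j <-> g j = Some i.

Lemma nsum_pinj_eq (a : I -> R) (b : I' -> R) :
  (forall i, 0 <= a i) -> (forall i, 0 <= b i) ->
  (forall i, b i = oapp a 0 (f i)) -> (forall i, a i = oapp b 0 (g i)) ->
  nsum a = nsum b.
Proof.
move=> a0 b0 hb ha; apply/eqP; rewrite eq_le; apply/andP; split.
  rewrite [X in nsum X](_ : a = fun i => oapp b 0 (g i)); last exact/funext.
  exact: nsum_pinj.
rewrite [X in nsum X](_ : b = fun i => oapp a 0 (f i)); last exact/funext.
exact: nsum_pinj.
Qed.

Lemma pinj_adjoint (xi : ell2 R I) (eta : ell2 R I') :
  redot (pinj finj xi) eta = redot xi (pinj ginj eta).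
Proof.
rewrite /redot /inner !Re_csum /rsum.
(* [rsum] splits into positive and negative parts: [phi] is the identity for the first and negation
   for the second. Each part is a nonnegative family reindexed by the partial bijection. *)
have aux (phi : R -> R) : phi 0 = 0 ->
  nsum (fun i => Num.max (phi (complex.Re (pinj finj xi i * (eta i)^*))) 0) =
  nsum (fun i => Num.max (phi (complex.Re (xi i * (pinj ginj eta i)^*))) 0).
  move=> phi0; apply/esym/nsum_pinj_eq => i; rewrite ?pinjE.
  - by rewrite le_max lexx orbT.
  - by rewrite le_max lexx orbT.
  - case fi: (f i) => [j|] /=; last by rewrite Re_mul_conj /= !mul0r addr0 phi0 maxxx.
    by rewrite ((fg i j).1 fi).
  - case gi: (g i) => [j|] /=.
      by rewrite ((fg j i).2 gi).
    by rewrite Re_mul_conj /= !mulr0 addr0 phi0 maxxx.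
congr (fine _ - fine _); first exact: (aux id).
by apply: (aux (fun x => - x)); rewrite oppr0.
Qed.

End PinjAdjoint.

(** * Finitely supported vectors *)

Section Truncation.
Variables (R : realType) (I : choiceType).
Implicit Types (xi eta : ell2 R I).

Lemma nsq_pythagoras xi eta : (forall i, xi i = 0 \/ eta i = 0) ->
  nsq (xi + eta) = nsq xi + nsq eta.
Proof.
move=> h; rewrite /nsq -(fine_nsumD (ell2_nsummable xi) (ell2_nsummable eta)).
congr (fine (nsum _)); apply/funext => i; rewrite ell2D.
by case: (h i) => ->; rewrite modulus0 expr0n ?add0r ?addr0.
Qed.

Lemma delta_subproof (i : I) :
  (fun j => (j == i)%:R) \in ell2_pred (R := R) (I := I).
Proof.
apply/mem_set => /=; apply: (@le_lt_trans _ _ 1%:E); last exact: ltry.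
apply: nsum_ub => F.
have [iF|niF] := boolP (i \in F).
  rewrite (big_fsetD1 i iF) /= eqxx modulus1 expr1n big_seq big1 ?addr0 // => j.
  by rewrite !inE => /andP[/negbTE -> _]; rewrite modulus0 expr0n.
rewrite big_seq big1 ?ler01 // => j jF; case: eqP => [ji|_].
  by rewrite ji (negbTE niF) in jF.
by rewrite modulus0 expr0n.
Qed.

Definition delta (i : I) : ell2 R I := Ell2 (delta_subproof i).

Lemma deltaE i j : delta i j = (j == i)%:R. Proof. by []. Qed.

Lemma nsq_delta i : nsq (delta i) = 1.
Proof.
apply/eqP; rewrite eq_le; apply/andP; split; last first.
  rewrite -ell2_norm_sq -(expr1n _ 2) lerXn2r ?nnegrE ?ell2_norm_ge0 ?ler01 //.
  by apply: le_trans (modulus_le_norm _ i); rewrite deltaE eqxx modulus1.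
apply: nsq_ub => F.
have [iF|niF] := boolP (i \in F).
  rewrite (big_fsetD1 i iF) /= eqxx modulus1 expr1n big_seq big1 ?addr0 // => j.
  by rewrite !inE => /andP[/negbTE ji _]; rewrite ?deltaE ji modulus0 expr0n.
rewrite big_seq big1 ?ler01 // => j jF; rewrite deltaE; case: eqP => [ji|_].
  by rewrite ji (negbTE niF) in jF.
by rewrite modulus0 expr0n.
Qed.

Lemma redot_delta (a b : cplx R) i j :
  redot (a *: delta i) (b *: delta j) = (i == j)%:R * complex.Re (a * b^*).
Proof.
have [<-|ij] := eqVneq i j.
  rewrite redotE mul1r Re_mul_conj_polar -scalerBl !nsqZ !nsq_delta !mulr1.
  by rewrite mulrBr.
rewrite redotE nsq_pythagoras ?nsqN; first by rewrite subrr mulr0 mul0r.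
move=> k; rewrite ell2N !ell2Z !deltaE.
have [ki|] := eqVneq k i; last by left; rewrite mulr0.
by right; rewrite ki (negbTE ij) mulr0 oppr0.
Qed.

Definition trunc (F : {fset I}) xi : ell2 R I :=
  \sum_(i <- F) xi i *: delta i.

Lemma truncE F xi i : trunc F xi i = if i \in F then xi i else 0.
Proof.
rewrite ell2_sum; have [iF|niF] := boolP (i \in F).
  rewrite (big_fsetD1 i iF) ell2Z deltaE eqxx mulr1.
  rewrite big_seq big1 => [|j]; first exact: addr0.
  rewrite !inE => /andP[/negbTE ji _].
  by rewrite ell2Z deltaE eq_sym ji mulr0.
rewrite big_seq big1 // => j jF; rewrite ell2Z deltaE; case: eqP => [ij|_].
  by rewrite -ij (negbTE niF) in jF.
by rewrite mulr0.
Qed.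

Lemma nsq_trunc F xi : nsq xi = nsq (xi - trunc F xi) + nsq (trunc F xi).
Proof.
rewrite -nsq_pythagoras ?subrK // => i; rewrite ell2B truncE.
by case: ifP; [left; rewrite subrr|right].
Qed.

Lemma trunc_norm_le F xi : ell2_norm (trunc F xi) <= ell2_norm xi.
Proof.
rewrite ell2_norm_le ?ell2_norm_ge0 // ell2_norm_sq (nsq_trunc F xi).
by rewrite lerDr nsq_ge0.
Qed.

Lemma trunc_approx xi (e : R) : 0 < e ->
  exists F, ell2_norm (xi - trunc F xi) <= e.
Proof.
move=> e0; have e2 : 0 < e ^+ 2 by rewrite exprn_gt0.
have [F hF] := nsum_approx (ell2_nsummable xi) e2; exists F.
rewrite ell2_norm_le ?ltW //.
have := fset_nsq_le F (trunc F xi); have := nsq_trunc F xi.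
have -> : \sum_(i <- F) modulus (trunc F xi i) ^+ 2 =
    \sum_(i <- F) modulus (xi i) ^+ 2.
  by apply: eq_big_seq => i iF; rewrite truncE iF.
by move: hF; rewrite -/(sqsum xi) -/(nsq xi); lra.
Qed.

End Truncation.

(** The norm of a combination depends on the Gram matrix only. As [redot] sees real parts, entries
    are compared for all complex multiples. The families are allowed zeros and repetitions, because
    germs will be indexed by elements of [Il]. *)
Lemma gram_norm (R : realType) (I I' : choiceType) (X : eqType)
    (v : X -> ell2 R I) (v' : X -> ell2 R I') (Q : seq X) :
  (forall s t, s \in Q -> t \in Q -> forall a b,
     redot (a *: v s) (b *: v t) = redot (a *: v' s) (b *: v' t)) ->
  forall W : seq (cplx R * X), (forall p, p \in W -> p.2 \in Q) ->
  ell2_norm (\sum_(p <- W) p.1 *: v p.2) =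
  ell2_norm (\sum_(p <- W) p.1 *: v' p.2).
Proof.
move=> hQ W hW; rewrite /ell2_norm -!/(nsq _) -!redot_self; congr Num.sqrt.
rewrite !redot_suml; apply: eq_big_seq => p pW.
rewrite !redot_sumr; apply: eq_big_seq => p' pW'.
by apply: hQ; exact: hW.
Qed.

(** * Bounded operators and closed algebras *)

Section Operators.
Variable R : realType.
Local Notation h := (2^-1 : R).

(** A bound stated as an inequality, in place of [op_norm], whose [sup] is informative only for sets
    known to be bounded. Source and target may differ. *)
Definition opbnd (I I' : choiceType) (M : R) (T : ell2 R I -> ell2 R I') :=
  forall xi, ell2_norm (T xi) <= M * ell2_norm xi.

Lemma pinj_opbnd (I I' : choiceType) (f : I' -> option I)
  (finj : pinjective f) : opbnd 1 (pinj (R := R) finj).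
Proof. by move=> xi; rewrite mul1r pinj_norm. Qed.

Variable I : choiceType.
Implicit Types (S T : op R I) (A D : set (op R I)).

Lemma opbnd_le M M' T : M <= M' -> opbnd M T -> opbnd M' T.
Proof.
move=> le hT xi; apply: (le_trans (hT xi)).
by rewrite ler_wpM2r // ell2_norm_ge0.
Qed.

Lemma opbndD M M' S T : opbnd M S -> opbnd M' T -> opbnd (M + M') (S + T).
Proof.
move=> hS hT xi; rewrite mulrDl.
by apply: (le_trans (ler_ell2_normD _ _)); rewrite lerD.
Qed.

Lemma opbndZ M T k : opbnd M T -> opbnd (modulus k * M) (k *: T).
Proof.
move=> hT xi; rewrite ell2_normZ -mulrA ler_wpM2l ?modulus_ge0 //.
Qed.

Lemma opbndN M T : opbnd M T -> opbnd M (- T).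
Proof. by move=> hT xi; rewrite ell2_normN. Qed.

Lemma opbnd_comp M M' S T : 0 <= M -> opbnd M S -> opbnd M' T ->
  opbnd (M * M') (S \o T).
Proof.
move=> M0 hS hT xi; apply: (le_trans (hS _)).
by rewrite -mulrA ler_wpM2l.
Qed.

Lemma opbnd0 : opbnd 0 (0 : op R I).
Proof. by move=> xi; rewrite mul0r ell2_norm0. Qed.

Lemma opbnd_distC M S T : opbnd M (S - T) -> opbnd M (T - S).
Proof. by move=> /opbndN; rewrite opprB. Qed.

Lemma bounded_opbnd T : bounded_op T -> exists2 M, 0 <= M & opbnd M T.
Proof.
move=> [_ [M hM]]; exists (Num.max M 0); first by rewrite le_max lexx orbT.
by apply: opbnd_le hM; rewrite le_max lexx.
Qed.

Lemma bounded_op0 : bounded_op (0 : op R I).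
Proof.
split; last by exists 0; exact: opbnd0.
by move=> k u v; rewrite /= scaler0 addr0.
Qed.

Lemma linear_comb k S T : linear S -> linear T -> linear (k *: S + T).
Proof.
move=> lS lT c u v.
rewrite -![(k *: S + T) _]/(k *: S _ + T _) lS lT !scalerDr !scalerA mulrC.
by rewrite !addrA; congr (_ + _); rewrite -!addrA; congr (_ + _); rewrite addrC.
Qed.

Lemma bounded_op_comb k S T :
  bounded_op S -> bounded_op T -> bounded_op (k *: S + T).
Proof.
move=> [lS [M hM]] [lT [M' hM']]; split; first exact: linear_comb.
by exists (modulus k * M + M'); apply: opbndD => //; exact: opbndZ.
Qed.

Lemma opbndP_linear M T : linear T -> (0 <= M) ->
  (forall xi, ell2_norm xi <= 1 -> ell2_norm (T xi) <= M) -> opbnd M T.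
Proof.
move=> lT M0 hT xi; have [/eqP /ell2_norm_eq0 ->|x0] := boolP (ell2_norm xi == 0).
  by rewrite (linear0_op lT) ell2_norm0 mulr0.
have xp : 0 < ell2_norm xi by rewrite lt_def x0 ell2_norm_ge0.
have := hT (creal (ell2_norm xi)^-1 *: xi).
rewrite (linearZ_op lT) !ell2_normZ modulus_creal ?invr_ge0 ?ell2_norm_ge0 //.
by rewrite mulVf // lexx => /(_ isT); rewrite ler_pdivrMl // mulrC.
Qed.

Lemma opbnd_op_norm T : bounded_op T -> opbnd (op_norm T) T.
Proof.
move=> bT; have [M M0 hM] := bounded_opbnd bT; have [lT _] := bT.
have hs : has_sup [set ell2_norm (T xi) | xi in [set xi | ell2_norm xi <= 1]].
  split; first by exists (ell2_norm (T 0)), 0 => //=; rewrite ell2_norm0 ler01.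
  exists M => _ [xi /= x1 <-]; apply: (le_trans (hM _)).
  by rewrite ler_piMr.
have ub xi : ell2_norm xi <= 1 -> ell2_norm (T xi) <= op_norm T.
  by move=> x1; apply: ub_le_sup; [case: hs|exists xi].
apply: opbndP_linear => //.
apply: le_trans (ub 0 _); first exact: ell2_norm_ge0.
by rewrite ell2_norm0 ler01.
Qed.

Lemma op_norm_le M T : 0 <= M -> opbnd M T -> op_norm T <= M.
Proof.
move=> M0 hM; apply: ge_sup.
  by exists (ell2_norm (T 0)), 0 => //=; rewrite ell2_norm0 ler01.
move=> _ [xi /= x1 <-]; apply: (le_trans (hM _)).
by rewrite ler_piMr.
Qed.

Lemma norm_closureP A T : A `<=` bounded_op (I := I) -> norm_closure A T <->
  bounded_op T /\ forall e, 0 < e -> exists2 S, A S & opbnd e (T - S).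
Proof.
move=> Ab; split=> -[bT hT]; split=> // e e0.
  have [S AS hS] := hT e e0; exists S => //.
  apply: (opbnd_le (ltW hS)); apply: opbnd_op_norm.
  by rewrite addrC -scaleN1r; apply: bounded_op_comb => //; exact: Ab.
(* Halving recovers the strict inequality in [norm_closure]. *)
have e2 : 0 < e / 2 by rewrite divr_gt0.
have [S AS hS] := hT _ e2; exists S => //.
by apply: (@le_lt_trans _ _ (e / 2)); [exact: op_norm_le (ltW e2) hS|lra].
Qed.

Lemma sub_norm_closure A : A `<=` bounded_op (I := I) -> A `<=` norm_closure A.
Proof.
move=> Ab T AT; apply/(norm_closureP _ Ab); split; first exact: Ab.
by move=> e e0; exists T => //; rewrite subrr; apply: opbnd_le opbnd0; exact: ltW.
Qed.

Lemma norm_closure_closed_subalgebra D : D `<=` bounded_op (I := I) -> D 0 ->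
  (forall k S T, D S -> D T -> D (k *: S + T)) ->
  (forall S T, D S -> D T -> D (S \o T)) -> closed_subalgebra (norm_closure D).
Proof.
move=> Db D0 Dlin Dcomp; have P := fun T => norm_closureP T Db.
have cb : norm_closure D `<=` bounded_op (I := I) by move=> T [].
split; first exact: cb.
- exact: (sub_norm_closure Db).
- move=> k S T /P[bS hS] /P[bT hT]; apply/P; split.
    exact: bounded_op_comb.
  move=> e e0; have k1 : 0 < modulus k + 1 by rewrite ltr_wpDl ?modulus_ge0.
  have d0 : 0 < e / (modulus k + 1) by rewrite divr_gt0.
  have [S' DS' hS'] := hS _ d0; have [T' DT' hT'] := hT _ d0.
  exists (k *: S' + T'); first exact: Dlin.
  rewrite opprD addrACA -scalerBr.
  apply: opbnd_le (opbndD (opbndZ k hS') hT').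
  have -> : modulus k * (e / (modulus k + 1)) + e / (modulus k + 1) = e.
    by field; rewrite lt0r_neq0.
  exact: lexx.
- move=> S T /P[bS hS] /P[bT hT].
  have [M M0 hM] := bounded_opbnd bS; have [N N0 hN] := bounded_opbnd bT.
  have [lS _] := bS; have [lT _] := bT.
  apply/P; split.
    split; last by exists (M * N); exact: opbnd_comp.
    by move=> k u v; rewrite /= lT lS.
  move=> e e0.
  have M1 : 0 < M + 1 by lra.
  have d0 : 0 < e / (M + 1) / 2 by rewrite !divr_gt0.
  (* ST - S'T' = S(T - T') + (S - S')T'. [T'] comes first because the tolerance for [S'] uses a
     bound of [T']; the added 1 keeps the divisors positive. *)
  have [T' DT' hT'] := hT _ d0.
  have [N' N'0 hN'] := bounded_opbnd (Db _ DT').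
  have N1 : 0 < N' + 1 by lra.
  have d'0 : 0 < e / (N' + 1) / 2 by rewrite !divr_gt0.
  have [S' DS' hS'] := hS _ d'0.
  exists (S' \o T'); first exact: Dcomp.
  have -> : (S \o T) - (S' \o T') = (S \o (T - T')) + ((S - S') \o T').
    apply/funext => xi.
    rewrite -[LHS]/(S (T xi) - S' (T' xi)).
    rewrite -[RHS]/(S (T xi - T' xi) + (S (T' xi) - S' (T' xi))).
    by rewrite (linearB_op lS) addrA subrK.
  apply: opbnd_le (opbndD (opbnd_comp M0 hM hT') (opbnd_comp (ltW d'0) hS' hN')).
  have h1 : M * (e / (M + 1) / 2) <= e / 2.
    have -> : M * (e / (M + 1) / 2) = (e / 2) * (M / (M + 1)).
      by field; rewrite lt0r_neq0.
    by rewrite ler_piMr ?ler_pdivrMr ?mul1r; lra.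
  have h2 : e / (N' + 1) / 2 * N' <= e / 2.
    have -> : e / (N' + 1) / 2 * N' = (e / 2) * (N' / (N' + 1)).
      by field; rewrite lt0r_neq0.
    by rewrite ler_piMr ?ler_pdivrMr ?mul1r; lra.
  lra.
- move=> T /(norm_closureP _ cb)[bT hT]; apply/P; split=> // e e0.
  have e2 : 0 < e / 2 by rewrite divr_gt0.
  have [S /P[_ hS] hTS] := hT _ e2; have [S' DS' hS'] := hS _ e2.
  exists S' => //; have -> : T - S' = (T - S) + (S - S') by rewrite addrA subrK.
  by apply: opbnd_le (opbndD hTS hS'); lra.
Qed.

(** Pointwise limits exist by completeness of l^2, and [geom_le0] makes the limit linear. *)
Lemma op_geom_limit (T : nat -> op R I) (K : R) : 0 <= K ->
  (forall n, bounded_op (T n)) ->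
  (forall n m, (n <= m)%N -> opbnd (K * h ^+ n) (T m - T n)) ->
  exists2 L, bounded_op L & forall n, opbnd (2 * K * h ^+ n) (L - T n).
Proof.
move=> K0 bT hT.
have /choice[L hL] : forall xi, exists y, forall n,
    ell2_norm (y - T n xi) <= 2 * K * h ^+ n * ell2_norm xi.
  move=> xi; have Kx : 0 <= K * ell2_norm xi by rewrite mulr_ge0 ?ell2_norm_ge0.
  have hu n m : (n <= m)%N ->
      ell2_norm (T m xi - T n xi) <= K * ell2_norm xi * h ^+ n.
    by move=> nm; apply: (le_trans (hT n m nm xi)); rewrite mulrAC.
  have [y hy] := ell2_geom_limit (u := fun n => T n xi) Kx hu.
  exists y => n; apply: (le_trans (hy n)).
  by rewrite mulrA mulrAC.
have lL : linear L.
  move=> k u v; apply/eqP; rewrite -subr_eq0; apply/eqP/ell2_norm_eq0.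
  apply/eqP; rewrite eq_le ell2_norm_ge0 andbT.
  apply: (@geom_le0 _ _ (2 * K * (ell2_norm (k *: u + v) +
     modulus k * ell2_norm u + ell2_norm v))) => n.
  have [lTn _] := bT n.
  have -> : L (k *: u + v) - (k *: L u + L v) =
     (L (k *: u + v) - T n (k *: u + v)) - k *: (L u - T n u) - (L v - T n v).
    rewrite lTn scalerBr !opprD !opprK.
    move: (L _) (k *: T n u) (T n v) (k *: L u) (L v) => a b c d f.
    rewrite -!addrA; congr (a + _).
    rewrite [- c + _]addrCA [- b + _]addrCA; congr (- d + _).
    rewrite [- c + _]addrCA [- b + _]addrCA.
    by rewrite addNKr addrCA addNr addr0.
  have le1 := hL (k *: u + v) n; have le2 := hL u n; have le3 := hL v n.
  have le4 : ell2_norm (k *: (L u - T n u)) <=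
      modulus k * (2 * K * h ^+ n * ell2_norm u).
    by rewrite ell2_normZ ler_wpM2l ?modulus_ge0.
  apply: (le_trans (ler_ell2_normB _ _)).
  apply: (le_trans (lerD (le_trans (ler_ell2_normB _ _) (lerD le1 le4)) le3)).
  move: (h ^+ n) => p; lra.
exists L.
  split=> //; have [M M0 hM] := bounded_opbnd (bT 0%N).
  exists (2 * K * h ^+ 0 + M).
  have -> : L = (L - T 0%N) + T 0%N by rewrite subrK.
  by apply: opbndD => //; exact: (hL ^~ 0%N).
by move=> n xi; exact: hL.
Qed.

End Operators.

(** * Continuity of *-homomorphisms *)

Section Adjoints.
Variables (R : realType) (I : choiceType).
Implicit Types (S T : op R I) (A D : set (op R I)).
Local Notation h := (2^-1 : R).

Definition radj (S T : op R I) :=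
  forall xi eta, redot (S xi) eta = redot xi (T eta).

Lemma radj_sym S T : radj S T -> radj T S.
Proof. by move=> hST xi eta; rewrite redotC -hST redotC. Qed.

Lemma radj_comb (S S' T T' : op R I) (k : cplx R) : linear S -> linear T' ->
  radj S S' -> radj T T' -> radj (k *: S + T) (k^* *: S' + T').
Proof.
move=> lS lT' hS hT xi eta.
rewrite -[(k *: S + T) xi]/(k *: S xi + T xi).
rewrite -[(_ + T') eta]/(k^* *: S' eta + T' eta) redotDl redotDr hT.
congr (_ + _); rewrite -(linearZ_op lS) hS.
rewrite /redot /inner !Re_csum; congr rsum; apply/funext => i.
rewrite !ell2Z; case: k (xi i) (S' eta i) => a b [c d] [e f] /=; ring.
Qed.

Lemma radjB (S S' T T' : op R I) :
  radj S S' -> radj T T' -> radj (S - T) (S' - T').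
Proof. by move=> hS hT xi eta; rewrite redotBl redotBr hS hT. Qed.

Lemma radj_comp (S S' T T' : op R I) :
  radj S S' -> radj T T' -> radj (S \o T) (T' \o S').
Proof. by move=> hS hT xi eta; rewrite /= hS hT. Qed.

(** |T eta|^2 = <S T eta, eta> <= M |T eta| |eta|; divide by |T eta|. *)
Lemma radj_opbnd M S T : 0 <= M -> radj S T -> opbnd M S -> opbnd M T.
Proof.
move=> M0 hST hS eta.
have [/eqP ->|x0] := boolP (ell2_norm (T eta) == 0).
  by rewrite mulr_ge0 ?ell2_norm_ge0.
have xp : 0 < ell2_norm (T eta) by rewrite lt_def x0 ell2_norm_ge0.
rewrite -(ler_pM2l xp) -expr2 ell2_norm_sq -redot_self -hST.
apply: le_trans (redot_le_norm _ _) _.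
apply: (@le_trans _ _ (M * ell2_norm (T eta) * ell2_norm eta)).
  by rewrite ler_wpM2r ?ell2_norm_ge0.
by rewrite mulrCA mulrA.
Qed.

Lemma radj0 : radj 0 0.
Proof. by move=> xi eta; rewrite [LHS]redot0l [RHS]redotC [RHS]redot0l. Qed.

Lemma norm_closure_seq D T : D `<=` bounded_op (I := I) -> norm_closure D T ->
  exists2 S : nat -> op R I, (forall n, D (S n)) &
    forall n, opbnd (h ^+ n) (T - S n).
Proof.
move=> Db /(norm_closureP _ Db)[bT hT].
have /choice[S hS] : forall n, exists S, D S /\ opbnd (h ^+ n) (T - S).
  move=> n; have hp : 0 < h ^+ n by rewrite exprn_gt0 // invr_gt0.
  by have [S DS hS] := hT _ hp; exists S.
by exists S => n; have [] := hS n.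
Qed.

Lemma half_le n m : (n <= m)%N -> h ^+ m <= h ^+ n.
Proof.
by move=> nm; apply: ler_wiXn2l nm; rewrite ?invr_ge0 // invf_le1 // ler1n.
Qed.

Lemma opbnd_mid M N S T U : opbnd M (T - S) -> opbnd N (T - U) ->
  opbnd (M + N) (S - U).
Proof.
move=> /opbnd_distC h1 h2; have -> : S - U = (S - T) + (T - U).
  by rewrite addrA subrK.
exact: opbndD.
Qed.

Lemma radj_limit (T T' : op R I) (S S' : nat -> op R I) (K : R) :
  (forall n, radj (S n) (S' n)) -> (forall n, opbnd (K * h ^+ n) (T - S n)) ->
  (forall n, opbnd (K * h ^+ n) (T' - S' n)) -> radj T T'.
Proof.
move=> hS hT hT' xi eta.
pose d := redot (T xi) eta - redot xi (T' eta).
have dE n : d = redot ((T - S n) xi) eta - redot xi ((T' - S' n) eta).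
  by rewrite /d redotBl redotBr hS; lra.
have le n : `|d| <= 2 * K * (ell2_norm xi * ell2_norm eta) * h ^+ n.
  have cs (u v : ell2 R I) : `|redot u v| <= ell2_norm u * ell2_norm v.
    rewrite ler_norml redot_le_norm andbT lerNl -redotNl.
    by rewrite (le_trans (redot_le_norm _ _)) // ell2_normN.
  have h1 : `|redot ((T - S n) xi) eta| <=
      K * h ^+ n * ell2_norm xi * ell2_norm eta.
    by apply: (le_trans (cs _ _)); rewrite ler_wpM2r ?ell2_norm_ge0 //; exact: hT.
  have h2 : `|redot xi ((T' - S' n) eta)| <=
      ell2_norm xi * (K * h ^+ n * ell2_norm eta).
    by apply: (le_trans (cs _ _)); rewrite ler_wpM2l ?ell2_norm_ge0 //; exact: hT'.
  rewrite (dE n); apply: (le_trans (ler_normB _ _)).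
  move: (h ^+ n) h1 h2 => p; lra.
have : `|d| <= 0 by exact: geom_le0 le.
by rewrite normr_le0 subr_eq0 => /eqP.
Qed.

(** The adjoints of the approximants again form a geometric Cauchy sequence, since [radj_opbnd]
    gives their differences the same bounds; the limit is the adjoint. *)
Lemma norm_closure_radj D : D `<=` bounded_op (I := I) ->
  (forall S, D S -> exists2 S', D S' & radj S S') ->
  forall T, norm_closure D T -> exists2 T', norm_closure D T' & radj T T'.
Proof.
move=> Db Dadj T cT; have [S DS hS] := norm_closure_seq Db cT.
have /choice[S' hS'] : forall n, exists S', D S' /\ radj (S n) S'.
  by move=> n; have [S' ? ?] := Dadj _ (DS n); exists S'.
have bnd n m : (n <= m)%N -> opbnd (2 * h ^+ n) (S' m - S' n).
  move=> nm; apply: (@radj_opbnd _ (S m - S n)).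
  - by rewrite mulr_ge0 ?half_ge0.
  - by apply: radjB; [exact: (hS' m).2|exact: (hS' n).2].
  - by apply: opbnd_le (opbnd_mid (hS m) (hS n)); have := half_le nm; lra.
have [T' bT' hT'] := op_geom_limit (ler0n R 2) (fun n => Db _ (hS' n).1) bnd.
exists T'.
  apply/(norm_closureP _ Db); split=> // e e0.
  have [n hn] := geom_small (2 * 2) e0; exists (S' n); first exact: (hS' n).1.
  by apply: opbnd_le (hT' n); exact: ltW.
apply: (@radj_limit _ _ S S' (2 * 2)) => n; first exact: (hS' n).2.
  by apply: opbnd_le (hS n); have := half_ge0 R n; lra.
exact: hT'.
Qed.

Lemma closed_subalgebraZ A k T : closed_subalgebra A -> A T -> A (k *: T).
Proof. by move=> [_ A0 lin _ _] AT; rewrite -[_ *: _]addr0; exact: lin. Qed.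

Lemma closed_subalgebraB A S T : closed_subalgebra A -> A S -> A T -> A (S - T).
Proof.
move=> [_ _ lin _ _] AS AT; rewrite addrC -scaleN1r; exact: lin.
Qed.

(* The element [c] is 1 - sqrt (1 - b), computed without unit as the limit of
   the iteration c <- (b + c^2) / 2. *)
Lemma closed_subalgebra_sqrt A (b : op R I) : closed_subalgebra A -> A b ->
  radj b b -> opbnd (2^-2) b ->
  exists c, [/\ A c, radj c c & forall xi, b xi = creal 2 *: c xi - c (c xi)].
Proof.
move=> cA Ab sb hb; have [Ab' A0 lin cmp cl] := cA.
pose step (c : op R I) : op R I := creal h *: b + creal h *: (c \o c).
pose c n := iter n step 0.
have cS n : c n.+1 = step (c n) by [].
have Ac n : A (c n).
  elim: n => [//|n IH]; rewrite cS; apply: (lin) => //.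
  by apply: closed_subalgebraZ cA _; exact: cmp.
have h0 : 0 <= h by rewrite invr_ge0.
have mh : modulus (creal h) = h by exact: modulus_creal.
have lb : linear b by have [] := Ab' _ Ab.
have lc n : linear (c n) by have [] := Ab' _ (Ac n).
(* The bound 1/2 reproduces itself: half of 1/4 + (1/2)^2 is at most 1/2. *)
have hc n : opbnd h (c n).
  elim: n => [|n IH]; first by apply: opbnd_le (@opbnd0 R I).
  rewrite cS; apply: opbnd_le (opbndD (opbndZ (creal h) hb)
    (opbndZ (creal h) (opbnd_comp h0 IH IH))).
  by rewrite mh; lra.
(* The iteration contracts: a difference d of consecutive iterates c, c' becomes (c' d + d c) / 2,
   of norm at most |d| / 2 since c and c' have norm at most 1/2. *)
have hd n : opbnd (h * h ^+ n) (c n.+1 - c n).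
  elim: n => [|n IH].
    rewrite /c /= subr0; apply: opbnd_le (hc 1%N); by rewrite expr0 mulr1.
  have -> : c n.+2 - c n.+1 = creal h *: ((c n.+1 \o (c n.+1 - c n)) +
      ((c n.+1 - c n) \o c n)).
    apply/funext => xi; rewrite !cS.
    rewrite -[LHS]/(creal h *: b xi + creal h *: (c n.+1 (c n.+1 xi)) -
      (creal h *: b xi + creal h *: c n (c n xi))).
    rewrite -[RHS]/(creal h *: (c n.+1 (c n.+1 xi - c n xi) +
      (c n.+1 (c n xi) - c n (c n xi)))).
    by rewrite (linearB_op (lc n.+1)) addrA subrK opprD addrACA subrr add0r scalerBr.
  have h1 : 0 <= h * h ^+ n by rewrite mulr_ge0 // half_ge0.
  apply: opbnd_le (opbndZ (creal h) (opbndD (opbnd_comp h0 (hc n.+1) IH)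
    (opbnd_comp h1 IH (hc n)))).
  by rewrite mh exprS; move: (h ^+ n) => p; lra.
have hnm n m : (n <= m)%N -> opbnd (1 * h ^+ n) (c m - c n).
  move=> /subnK <-; move: (m - n)%N => k.
  suff : opbnd (h ^+ n - h ^+ (k + n)) (c (k + n)%N - c n).
    by apply: opbnd_le; have := half_ge0 R (k + n); lra.
  elim: k => [|k IH].
    by rewrite add0n !subrr; exact: opbnd0.
  rewrite addSn; have -> : c (k + n).+1 - c n =
      (c (k + n).+1 - c (k + n)%N) + (c (k + n)%N - c n) by rewrite addrA subrK.
  apply: opbnd_le (opbndD (hd _) IH).
  by rewrite exprS; move: (h ^+ (k + n)) => p; lra.
have [L bL hL] := op_geom_limit ler01 (fun n => Ab' _ (Ac n)) hnm.
have [M M0 hM] := bounded_opbnd bL; have [lL _] := bL.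
have AL : A L.
  apply: cl; apply/(norm_closureP _ Ab'); split=> // e e0.
  have [n hn] := geom_small (2 * 1) e0; exists (c n) => //.
  by apply: opbnd_le (hL n); exact: ltW.
have sc n : radj (c n) (c n).
  elim: n => [|n IH]; first exact: radj0.
  have ee : creal h = (creal h)^* by rewrite /creal /=; congr Complex; rewrite oppr0.
  have l2 : linear (creal h *: (c n \o c n)).
    by have [] := Ab' _ (closed_subalgebraZ (creal h) cA (cmp _ _ (Ac n) (Ac n))).
  have r2 : radj (creal h *: (c n \o c n)) (creal h *: (c n \o c n)).
    have lcc : linear (c n \o c n) by have [] := Ab' _ (cmp _ _ (Ac n) (Ac n)).
    have := @radj_comb _ _ 0 0 (creal h) lcc (bounded_op0 R I).1 (radj_comp IH IH).
    by rewrite -ee !addr0; apply; exact: radj0.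
  by have := radj_comb (creal h) lb l2 sb r2; rewrite -ee; exact.
exists L; split => //; first exact: (@radj_limit _ _ c c (2 * 1)).
move=> xi; apply/eqP; rewrite -subr_eq0; apply/eqP/ell2_norm_eq0.
apply/eqP; rewrite eq_le ell2_norm_ge0 andbT.
apply: (@geom_le0 _ _ ((2 + 2 * M + 1) * ell2_norm xi)) => n.
(* The recursion reads b = 2 c_{n+1} - c_n^2, and L^2 - c_n^2 = L (L - c_n) + (L - c_n) c_n; each of
   the three terms is of order 2^-n. *)
have -> : b xi - (creal 2 *: L xi - L (L xi)) =
    L ((L - c n) xi) + (L - c n) (c n xi) - creal 2 *: (L - c n.+1) xi.
  rewrite -[(L - c n) xi]/(L xi - c n xi).
  rewrite -[(L - c n) (c n xi)]/(L (c n xi) - c n (c n xi)).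
  rewrite -[(L - c n.+1) xi]/(L xi - c n.+1 xi) (linearB_op lL) addrA subrK.
  rewrite cS -[step (c n) xi]/(creal h *: b xi + creal h *: c n (c n xi)).
  rewrite scalerBr scalerDr !scalerA.
  have -> : creal 2 * creal h = 1.
    by apply/eqP; rewrite /creal eq_complex /= !mul0r !mulr0 subr0 addr0 divff // !eqxx.
  rewrite !scale1r !opprB.
  move: (b xi) (creal 2 *: L xi) (L (L xi)) (c n _) => x y z t.
  by rewrite [RHS]addrA [x + t]addrC [z - t + _]addrA subrK addrA [x + z]addrC.
have e1 := hM ((L - c n) xi).
have e2 := hL n xi; have e3 := hL n (c n xi); have e4 := hc n xi.
have e5 := hL n.+1 xi.
have e6 : ell2_norm (creal 2 *: (L - c n.+1) xi) = 2 * ell2_norm ((L - c n.+1) xi).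
  by rewrite ell2_normZ modulus_creal.
apply: (le_trans (ler_ell2_normB _ _)).
apply: (le_trans (lerD (ler_ell2_normD _ _) (lexx _))).
rewrite e6; move: e5; rewrite exprS => e5.
have hn := half_ge0 R n.
have e7 : 2 * 1 * h ^+ n * ell2_norm (c n xi) <= 2 * 1 * h ^+ n * (h * ell2_norm xi).
  by rewrite ler_wpM2l // !mulr_ge0.
have e8 : M * ell2_norm ((L - c n) xi) <= M * (2 * 1 * h ^+ n * ell2_norm xi).
  by rewrite ler_wpM2l.
move: (h ^+ n) e2 e3 e5 e7 e8 {hn} => p e2 e3 e5 e7 e8.
lra.
Qed.

End Adjoints.

Lemma star_hom_opbnd (R : realType) (I I' : choiceType) (A : set (op R I))
    (B : set (op R I')) (q : op R I -> op R I') :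
  closed_subalgebra A -> (forall T, A T -> exists2 T', A T' & radj T T') ->
  B `<=` bounded_op (I := I') -> star_hom A B q ->
  forall a, A a -> opbnd (2^-1) a -> opbnd 1 (q a).
Proof.
move=> cA Aadj Bb [qB qlin qmul qadj] a Aa ha; have [Ab A0 lin cmp cl] := cA.
have lA T : A T -> linear T by move=> AT; have [] := Ab _ AT.
have lq T : A T -> linear (q T) by move=> AT; have [] := Bb _ (qB _ AT).
have [a' Aa' haa'] := Aadj a Aa; have ha'a := radj_sym haa'.
have h0 : 0 <= (2^-1 : R) by rewrite invr_ge0.
have ha' : opbnd (2^-1) a' by exact: radj_opbnd haa' ha.
(* The scale 1/2 for [a] brings [a' \o a] under the bound 1/4 on which the square root iteration
   runs. *)
have hb : opbnd (2^-2) (a' \o a).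
  by apply: opbnd_le (opbnd_comp h0 ha' ha); rewrite -expr2 exprVn.
have [c [Ac sc hc]] :=
  closed_subalgebra_sqrt cA (cmp _ _ Aa' Aa) (radj_comp ha'a haa') hb.
have qadjr S T : A S -> A T -> radj S T -> radj (q S) (q T).
  move=> AS AT hST; apply/(adjoint_pairP _ (lq _ AT)).
  by apply: qadj => //; apply/adjoint_pairP => //; exact: lA.
have q0 : q 0 = 0.
  have := qlin 1 0 0 A0 A0; rewrite !scale1r addr0.
  by rewrite -[X in X = _]addr0 => /addrI.
have bE : a' \o a = (-1) *: (c \o c) + (creal 2 *: c + 0).
  by apply/funext => xi; rewrite addr0 addrC scaleN1r; exact: hc.
have A2 : A (creal 2 *: c + 0) by exact: lin.
have qb : q a' \o q a = creal 2 *: q c - (q c \o q c).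
  rewrite -(qmul _ _ Aa' Aa) bE (qlin _ _ _ (cmp _ _ Ac Ac) A2).
  by rewrite (qlin _ _ _ Ac A0) q0 addr0 (qmul _ _ Ac Ac) scaleN1r addrC.
move=> xi; rewrite mul1r ell2_norm_le ?ell2_norm_ge0 // ell2_norm_sq.
have e1 : nsq (q a xi) = redot (creal 2 *: q c xi) xi - nsq (q c xi).
  rewrite -redot_self -(qadjr _ _ Aa' Aa ha'a).
  rewrite -[q a' (q a xi)]/((q a' \o q a) xi) qb.
  rewrite -[(_ - _) xi]/(creal 2 *: q c xi - q c (q c xi)) redotBl.
  by rewrite (qadjr _ _ Ac Ac sc) redot_self.
have e2 : redot (creal 2 *: q c xi) xi = 2 * redot xi (q c xi).
  have -> : creal 2 *: q c xi = q c xi + q c xi.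
    have -> : creal 2 = 1 + 1 :> cplx R.
      by apply/eqP; rewrite eq_complex /= addr0 !eqxx.
    by rewrite scalerDl scale1r.
  by rewrite redotDl redotC; lra.
by have := nsq_ge0 (xi - q c xi); rewrite nsqB e1 e2; lra.
Qed.

Section Span.
Variables (R : realType) (I : choiceType).
Implicit Types (S T : op R I) (A D E : set (op R I)).

Inductive lspan E : op R I -> Prop :=
| lspan0 : lspan E 0
| lspanS k e T : E e -> lspan E T -> lspan E (k *: e + T).

Lemma lspan_comb E k S T : lspan E S -> lspan E T -> lspan E (k *: S + T).
Proof.
move=> hS hT; elim: hS => [|c e S' Ee _ IH]; first by rewrite scaler0 add0r.
by rewrite scalerDr scalerA -addrA; exact: lspanS.
Qed.

Lemma lspan_mem E e : E e -> lspan E e.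
Proof.
by move=> Ee; rewrite -[e]scale1r -[_ *: _]addr0; exact: lspanS Ee (lspan0 E).
Qed.

Lemma lspan_sub E A : A 0 -> (forall k S T, A S -> A T -> A (k *: S + T)) ->
  E `<=` A -> lspan E `<=` A.
Proof.
by move=> A0 lin EA S; elim=> [//|k e T Ee _ AT]; apply: lin => //; exact: EA.
Qed.

Lemma lspan_bounded E : E `<=` bounded_op (I := I) ->
  lspan E `<=` bounded_op (I := I).
Proof. by apply: lspan_sub; [exact: bounded_op0|exact: bounded_op_comb]. Qed.

Lemma lspan_comp E : E `<=` bounded_op (I := I) ->
  (forall e e', E e -> E e' -> lspan E (e \o e')) ->
  forall S T, lspan E S -> lspan E T -> lspan E (S \o T).
Proof.
move=> Eb Ecomp S T hS hT; elim: hS => [|k e S' Ee _ IH].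
  by rewrite (_ : 0 \o T = 0) //; exact: lspan0.
rewrite (_ : (k *: e + S') \o T = k *: (e \o T) + (S' \o T)) //.
apply: lspan_comb => //; have [le _] := Eb _ Ee.
elim: hT => [|c e' T' Ee' _ IH'].
  rewrite (_ : e \o 0 = 0); first exact: lspan0.
  by apply/funext => xi; exact: linear0_op.
rewrite (_ : e \o (c *: e' + T') = c *: (e \o e') + (e \o T')).
  by apply: lspan_comb => //; exact: Ecomp.
by apply/funext => xi; exact: le.
Qed.

Lemma lspan_radj E : E `<=` bounded_op (I := I) ->
  (forall e, E e -> exists2 e', E e' & radj e e') ->
  forall S, lspan E S -> exists2 S', lspan E S' & radj S S'.
Proof.
move=> Eb Eadj S; elim=> [|k e T Ee _ [T' sT' hT]].
  by exists 0; [exact: lspan0|exact: radj0].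
have [e' Ee' he] := Eadj e Ee; exists (k^* *: e' + T'); first exact: lspanS.
by apply: radj_comb => //; [case: (Eb _ Ee)|case: (lspan_bounded Eb sT')].
Qed.

Lemma lspan_range (X : Type) (f : X -> op R I) T : lspan (range f) T ->
  exists w : seq (cplx R * X), T = \sum_(p <- w) p.1 *: f p.2.
Proof.
elim=> [|k _ S [x _ <-] _ [w ->]]; first by exists [::]; rewrite big_nil.
by exists ((k, x) :: w); rewrite big_cons.
Qed.

End Span.

Section Compression.
Variables (R : realType) (I I' : choiceType).
Variables (A : set (op R I)) (B : set (op R I')) (q : op R I -> op R I').
Hypothesis cA : closed_subalgebra A.
Hypothesis Aadj : forall T, A T -> exists2 T', A T' & radj T T'.
Hypothesis Bb : B `<=` bounded_op (I := I').
Hypothesis hq : star_hom A B q.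

(** Rescaling by 1/(2e). The factor 2 is harmless, as only continuity is drawn from it;
    contractivity of q will come from its form as a compression. *)
Lemma star_hom_opbnd2 (e : R) a : 0 < e -> A a -> opbnd e a ->
  opbnd (2 * e) (q a).
Proof.
move=> e0 Aa ha; have [_ A0 _ _ _] := cA; have [_ qlin _ _] := hq.
have q0 : q 0 = 0.
  have := qlin 1 0 0 A0 A0; rewrite !scale1r addr0.
  by rewrite -[X in X = _]addr0 => /addrI.
have d0 : 0 < (2 * e)^-1 by rewrite invr_gt0 mulr_gt0.
pose k := creal (2 * e)^-1.
have hk : modulus k = (2 * e)^-1 by rewrite modulus_creal // ltW.
have h1 : opbnd 1 (q (k *: a)).
  apply: (star_hom_opbnd cA Aadj Bb hq); first exact: closed_subalgebraZ.
  apply: opbnd_le (opbndZ k ha); rewrite hk.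
  by rewrite invfM mulfVK ?lexx // lt0r_neq0.
have qk : q (k *: a) = k *: q a.
  by have := qlin k a 0 Aa A0; rewrite !addr0 q0 addr0.
move=> xi; have := h1 xi; rewrite qk -[(k *: q a) xi]/(k *: q a xi) ell2_normZ.
by rewrite hk mul1r ler_pdivrMl // mulr_gt0.
Qed.

Variables (P : ell2 R I -> ell2 R I') (iota : ell2 R I' -> ell2 R I).
Hypotheses (lP : linear P) (P1 : opbnd 1 P) (iota1 : opbnd 1 iota).

(** Both sides are linear and continuous in [T] and agree on [E], hence on the closure of its
    span. *)
Lemma star_hom_compression (E : set (op R I)) : E `<=` A ->
  (forall e, E e -> q e = P \o e \o iota) ->
  forall T, A T -> norm_closure (lspan E) T -> q T = P \o T \o iota.
Proof.
move=> EA hE T AT cT; have [Ab A0 lin _ _] := cA; have [_ qlin _ _] := hq.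
have q0 : q 0 = 0.
  have := qlin 1 0 0 A0 A0; rewrite !scale1r addr0.
  by rewrite -[X in X = _]addr0 => /addrI.
have sA : lspan E `<=` A by exact: lspan_sub.
have hS S : lspan E S -> q S = P \o S \o iota.
  elim=> [|k e U Ee sU IH].
    by rewrite q0; apply/funext => xi; rewrite /= (linear0_op lP).
  rewrite (qlin _ _ _ (EA _ Ee) (sA _ sU)) (hE _ Ee) IH.
  by apply/funext => xi; rewrite /= lP.
have Eb : lspan E `<=` bounded_op (I := I) by move=> S /sA/Ab.
have [S sS hTS] := norm_closure_seq Eb cT.
apply/funext => xi; apply/eqP; rewrite -subr_eq0; apply/eqP/ell2_norm_eq0.
apply/eqP; rewrite eq_le ell2_norm_ge0 andbT.
(* 3 = 2 + 1: the error of q on [T - S n], by [star_hom_opbnd2], and that of the compression. *)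
apply: (@geom_le0 _ _ (3 * ell2_norm xi)) => n.
have AS := sA _ (sS n).
have ATS : A (T - S n) by exact: closed_subalgebraB.
have hp : 0 < (2^-1 : R) ^+ n by rewrite exprn_gt0 // invr_gt0.
have := star_hom_opbnd2 hp ATS (hTS n).
rewrite addrC -scaleN1r (qlin _ _ _ AS AT) scaleN1r addrC (hS _ (sS n)) => e1.
have e2 : ell2_norm (P ((T - S n) (iota xi))) <= 2^-1 ^+ n * ell2_norm xi.
  apply: (le_trans (P1 _)); rewrite mul1r; apply: (le_trans (hTS n _)).
  by rewrite ler_pM2l //; apply: (le_trans (iota1 _)); rewrite mul1r.
have -> : q T xi - (P \o T \o iota) xi =
    (q T - ((P \o S n) \o iota)) xi - P ((T - S n) (iota xi)).
  rewrite -[(q T - _) xi]/(q T xi - P (S n (iota xi))).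
  rewrite -[(T - S n) _]/(T (iota xi) - S n (iota xi)) (linearB_op lP).
  by rewrite opprB addrA subrK.
apply: (le_trans (ler_ell2_normB _ _)).
apply: (le_trans (lerD (e1 xi) e2)); move: (_ ^+ n) => p; lra.
Qed.

End Compression.

(** * Matrix norms *)

Section MatrixNorm.
Variables (R : realType) (I : choiceType) (n : nat).
Implicit Types (a : 'M[op R I]_n).

Lemma ell2_norm_le1 (xi : 'I_n -> ell2 R I) :
  \sum_j ell2_norm (xi j) ^+ 2 <= 1 -> forall j, ell2_norm (xi j) <= 1.
Proof.
move=> h j; rewrite -(ler_sqr (x := ell2_norm _)) ?nnegrE ?ell2_norm_ge0 //.
rewrite expr1n; apply: le_trans h; rewrite (bigD1 j) //= lerDl.
by apply: sumr_ge0 => k _; rewrite sqr_ge0.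
Qed.

(** Needed before [mx_op_norm] can be used at all, since [sup] of an unbounded set is a default
    value. The crude bound is the Euclidean norm of the row sums of entry bounds. *)
Lemma mx_op_norm_has_sup a : (forall i j, bounded_op (a i j)) ->
  has_sup [set Num.sqrt (\sum_i ell2_norm (\sum_j a i j (xi j)) ^+ 2)
      | xi in [set xi : 'I_n -> ell2 R I | \sum_j ell2_norm (xi j) ^+ 2 <= 1]].
Proof.
move=> ab; split.
  exists (Num.sqrt (\sum_i ell2_norm (\sum_j a i j 0) ^+ 2)), (fun=> 0) => //=.
  by rewrite big1 ?ler01 // => j _; rewrite ell2_norm0 expr0n.
have /choice[M hM] : forall p : 'I_n * 'I_n, exists M, 0 <= M /\ opbnd M (a p.1 p.2).
  by move=> p; have [M M0 hM] := bounded_opbnd (ab p.1 p.2); exists M.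
exists (Num.sqrt (\sum_i (\sum_j M (i, j)) ^+ 2)) => _ [xi /= x1 <-].
rewrite ler_sqrt; last by apply: sumr_ge0 => i _; rewrite sqr_ge0.
apply: ler_sum => i _.
rewrite lerXn2r ?nnegrE ?ell2_norm_ge0 //.
  by apply: sumr_ge0 => j _; have [] := hM (i, j).
apply: (le_trans (ler_ell2_norm_sum _ _)); apply: ler_sum => j _.
have [M0 hm] := hM (i, j); apply: (le_trans (hm _)).
by rewrite ler_piMr // ell2_norm_le1.
Qed.

Lemma mx_op_norm_ge0 a : (forall i j, bounded_op (a i j)) -> 0 <= mx_op_norm a.
Proof.
move=> ab; have [ne ub] := mx_op_norm_has_sup ab.
have [x Ex] := ne; apply: le_trans (ub_le_sup ub Ex).
by case: Ex => xi _ <-; exact: sqrtr_ge0.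
Qed.

(** By homogeneity: rescale the vector to norm 1, after treating the zero vector apart. *)
Lemma mx_op_normP a (xi : 'I_n -> ell2 R I) : (forall i j, bounded_op (a i j)) ->
  \sum_i nsq (\sum_j a i j (xi j)) <= mx_op_norm a ^+ 2 * \sum_j nsq (xi j).
Proof.
move=> ab; set s := \sum_j nsq (xi j).
have s0 : 0 <= s by apply: sumr_ge0 => j _; exact: nsq_ge0.
have [se|sn] := eqVneq s 0.
  have x0 j : xi j = 0.
    apply: ell2_norm_eq0; apply/eqP; rewrite -sqrf_eq0 ell2_norm_sq.
    move/eqP: se; rewrite psumr_eq0 => [|k _]; last exact: nsq_ge0.
    by move=> /allP /(_ j (mem_index_enum _)).
  rewrite se mulr0 big1 // => i _; rewrite big1 => [|j _].
    by rewrite -ell2_norm_sq ell2_norm0 expr0n.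
  by rewrite x0; apply: linear0_op; have [] := ab i j.
have sp : 0 < s by rewrite lt_def sn.
pose t := (Num.sqrt s)^-1.
have tp : 0 < t by rewrite invr_gt0 sqrtr_gt0.
have t2 : t ^+ 2 = s^-1 by rewrite exprVn sqr_sqrtr.
pose eta j := creal t *: xi j.
have mt : modulus (creal t) = t by rewrite modulus_creal // ltW.
have e1 : \sum_j ell2_norm (eta j) ^+ 2 <= 1.
  rewrite (eq_bigr (fun j => t ^+ 2 * nsq (xi j))) => [|j _].
    by rewrite -mulr_sumr t2 mulVf.
  by rewrite ell2_norm_sq nsqZ mt.
have [_ ub] := mx_op_norm_has_sup ab.
have : Num.sqrt (\sum_i ell2_norm (\sum_j a i j (eta j)) ^+ 2) <= mx_op_norm a.
  by apply: ub_le_sup => //; exists eta.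
rewrite -ler_sqr ?nnegrE ?sqrtr_ge0 ?mx_op_norm_ge0 // sqr_sqrtr; last first.
  by apply: sumr_ge0 => i _; rewrite sqr_ge0.
rewrite (eq_bigr (fun i => t ^+ 2 * nsq (\sum_j a i j (xi j)))) => [|i _].
  by rewrite -mulr_sumr t2 ler_pdivrMl // mulrC.
rewrite ell2_norm_sq -mt -nsqZ; congr nsq; rewrite scaler_sumr.
by apply: eq_bigr => j _; apply: linearZ_op; have [] := ab i j.
Qed.

Lemma mx_op_norm_le a (M : R) : 0 <= M ->
  (forall xi : 'I_n -> ell2 R I,
    \sum_i nsq (\sum_j a i j (xi j)) <= M ^+ 2 * \sum_j nsq (xi j)) ->
  mx_op_norm a <= M.
Proof.
move=> M0 hM; apply: ge_sup.
  exists (Num.sqrt (\sum_i ell2_norm (\sum_j a i j 0) ^+ 2)), (fun=> 0) => //=.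
  by rewrite big1 ?ler01 // => j _; rewrite ell2_norm0 expr0n.
move=> _ [xi /= x1 <-].
rewrite -(ler_sqr (x := Num.sqrt _)) ?nnegrE ?sqrtr_ge0 // sqr_sqrtr; last first.
  by apply: sumr_ge0 => i _; rewrite sqr_ge0.
rewrite (eq_bigr (fun i => nsq (\sum_j a i j (xi j)))) => [|i _]; last first.
  by rewrite ell2_norm_sq.
apply: (le_trans (hM _)); rewrite ler_piMr ?sqr_ge0 //.
rewrite (eq_bigr (fun j => ell2_norm (xi j) ^+ 2)) // => j _.
by rewrite ell2_norm_sq.
Qed.

End MatrixNorm.

(** * Decomposition over fibres *)

Section Fibres.
Variables (R : realType) (I X : choiceType) (fib : I -> X).

Definition restr_fun (x : X) (i : I) := if fib i == x then Some i else None.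

Lemma restr_pinj x : pinjective (restr_fun x).
Proof.
by move=> i j k; rewrite /restr_fun; case: ifP => // _ [->]; case: ifP => // _ [].
Qed.

Definition restr x : op R I := pinj (@restr_pinj x).

Lemma restr_linear x : linear (restr x).
Proof. exact: pinj_linear. Qed.

Lemma restrE x xi i : restr x xi i = if fib i == x then xi i else 0.
Proof. by rewrite pinjE /restr_fun; case: ifP. Qed.

Lemma nsq_restr (xi : ell2 R I) : (nsq xi)%:E = nsum (fun x => nsq (restr x xi)).
Proof.
rewrite -nsqE /sqsum.
pose J (x : X) := [set i | fib i = x].
transitivity (\esum_(x in [set: X]) \esum_(i in J x) (modulus (xi i) ^+ 2)%:E).
  rewrite esum_esum => [|x i _ _]; last by rewrite lee_fin sqr_ge0.
  apply: (@reindex_esum _ _ _ _ _ (fun p : X * I => p.2)); split=> //.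
  - by move=> [x i] [x' i'] /set_mem [_ /= <-] /set_mem [_ /= <-] /= ->.
  - by move=> i _; exists (fib i, i).
apply: eq_esum => x _; rewrite -nsqE /sqsum esum_mkcond.
apply: eq_esum => i _; rewrite restrE.
have [e|ne] := eqVneq (fib i) x; first by rewrite mem_set.
have -> : (i \in J x) = false by apply: memNset => e; rewrite [fib i]e eqxx in ne.
by rewrite modulus0 expr0n.
Qed.

(** Operators commuting with the restrictions are block diagonal over the fibres, so fibre bounds
    with one constant [M] add up. This allows one source character to be treated at a time. *)
Lemma fibrewise_bound (n : nat) (a : 'M[op R I]_n) (M : R) :
  (forall i j x xi, a i j (restr x xi) = restr x (a i j xi)) ->
  (forall x (xi : 'I_n -> ell2 R I),
    \sum_i nsq (\sum_j a i j (restr x (xi j))) <=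
    M ^+ 2 * \sum_j nsq (restr x (xi j))) ->
  forall xi : 'I_n -> ell2 R I,
    \sum_i nsq (\sum_j a i j (xi j)) <= M ^+ 2 * \sum_j nsq (xi j).
Proof.
move=> comm hM xi; rewrite -lee_fin EFinM -!sumEFin.
under eq_bigr do rewrite nsq_restr.
under [X in (_ <= _ * X)%E]eq_bigr do rewrite nsq_restr.
rewrite /nsum -!esum_sum; try by move=> *; rewrite lee_fin nsq_ge0.
under eq_esum do rewrite sumEFin.
under [X in (_ <= _ * X)%E]eq_esum do rewrite sumEFin.
rewrite -/(nsum _) -/(nsum (fun x => \sum_j nsq (restr x (xi j)))).
rewrite -nsumZ ?sqr_ge0 //; last first.
  by move=> x; apply: sumr_ge0 => j _; exact: nsq_ge0.
apply: nsum_le => x; apply: le_trans (hM x xi).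
rewrite le_eqVlt; apply/orP; left; apply/eqP/eq_bigr => i _; congr nsq.
rewrite (linear_sum_op (restr_linear x)).
by apply: eq_bigr => j _; rewrite comm.
Qed.

End Fibres.

Section ApproximateTransfer.
Variables (R : realType) (I I' : choiceType) (n : nat).
Variables (D : set (op R I)) (q : op R I -> op R I').

(** Vectors can be moved to the boundary exactly only for entries in [D] and finite supports. The
    resulting [eta] change with the approximation and need not converge, but all of them obey the
    same bound [M], which survives the limit. *)
Lemma approximate_transfer (a : 'M[op R I]_n) (xi : 'I_n -> ell2 R I) (M : R) :
  D `<=` bounded_op (I := I) ->
  (forall i j, norm_closure D (a i j)) ->
  (forall S T e, 0 < e -> D S -> norm_closure D T -> opbnd e (T - S) ->
     opbnd e (q T - q S)) ->
  (forall eta : 'I_n -> ell2 R I',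
    \sum_i nsq (\sum_j q (a i j) (eta j)) <= M ^+ 2 * \sum_j nsq (eta j)) ->
  (forall (S : 'M[op R I]_n) (F : 'I_n -> {fset I}), (forall i j, D (S i j)) ->
     exists eta : 'I_n -> ell2 R I',
     (forall j, ell2_norm (eta j) = ell2_norm (trunc (F j) (xi j))) /\
     forall i, ell2_norm (\sum_j S i j (trunc (F j) (xi j))) =
               ell2_norm (\sum_j q (S i j) (eta j))) ->
  \sum_i nsq (\sum_j a i j (xi j)) <= M ^+ 2 * \sum_j nsq (xi j).
Proof.
move=> Db Da qD hM htr.
have P := fun T => norm_closureP T Db.
have /choice[B hB] : forall p : 'I_n * 'I_n, exists M, 0 <= M /\ opbnd M (a p.1 p.2).
  by move=> p; have [ba _] := Da p.1 p.2; have [N ? ?] := bounded_opbnd ba; exists N.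
pose K := \sum_i \sum_j B (i, j).
pose X := \sum_j ell2_norm (xi j).
set W := M ^+ 2 * _.
have W0 : 0 <= W.
  by rewrite mulr_ge0 ?sqr_ge0 // sumr_ge0 // => j _; exact: nsq_ge0.
have X0 : 0 <= X by rewrite sumr_ge0 // => j _; exact: ell2_norm_ge0.
have B0 p : 0 <= B p by have [] := hB p.
have K0 : 0 <= K by rewrite sumr_ge0 // => i _; rewrite sumr_ge0.
(* [K] pays for truncating [xi]; the two copies of [X] pay for exchanging [a] with [S], once without
   and once with [q]. *)
pose L := K + 2 * X.
have L0 : 0 <= L by rewrite addr_ge0 // mulr_ge0.
rewrite -subr_le0.
apply: (@geom_le0 _ _ (n%:R * (2 * L * (W + 1) + L ^+ 2))) => m.
set e := 2^-1 ^+ m.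
have e0 : 0 < e by rewrite exprn_gt0 // invr_gt0.
have e1 : e <= 1 by rewrite exprn_ile1 ?invr_ge0 // invf_le1 // ler1n.
have /choice[S hS] : forall p : 'I_n * 'I_n, exists S, D S /\ opbnd e (a p.1 p.2 - S).
  by move=> p; have /P[_ /(_ _ e0) [S ? ?]] := Da p.1 p.2; exists S.
have /choice[F hF] : forall j, exists F, ell2_norm (xi j - trunc F (xi j)) <= e.
  by move=> j; exact: trunc_approx.
have [eta [heta hSeta]] := htr (\matrix_(i, j) S (i, j)) F
  (fun i j => eq_ind_r D (hS (i, j)).1 (mxE _ _ i j)).
pose y i := ell2_norm (\sum_j q (a i j) (eta j)).
have etaX j : ell2_norm (eta j) <= ell2_norm (xi j).
  by rewrite heta trunc_norm_le.
have hx i : ell2_norm (\sum_j a i j (xi j)) <= y i + e * L.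
  have -> : \sum_j a i j (xi j) =
      \sum_j S (i, j) (trunc (F j) (xi j)) +
      (\sum_j a i j (xi j - trunc (F j) (xi j)) +
       \sum_j (a i j - S (i, j)) (trunc (F j) (xi j))).
    rewrite -!big_split /=; apply: eq_bigr => j _.
    have [[la _] _] := Da i j.
    rewrite (linearB_op la) -[(_ - S (i, j)) _]/(a i j _ - S (i, j) _).
    by rewrite [X in _ + X]addrA subrK addrC subrK.
  have h1 : ell2_norm (\sum_j S (i, j) (trunc (F j) (xi j))) <= y i + e * X.
    have -> : ell2_norm (\sum_j S (i, j) (trunc (F j) (xi j))) =
        ell2_norm (\sum_j q (S (i, j)) (eta j)).
      have := hSeta i; under eq_bigr do rewrite mxE.
      by move=> ->; under eq_bigr do rewrite mxE.
    have -> : \sum_j q (S (i, j)) (eta j) = \sum_j q (a i j) (eta j) -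
        \sum_j (q (a i j) - q (S (i, j))) (eta j).
      rewrite -sumrB; apply: eq_bigr => j _.
      rewrite -[(_ - q (S (i, j))) _]/(q (a i j) (eta j) - q (S (i, j)) (eta j)).
      by rewrite opprB addrC subrK.
    apply: (le_trans (ler_ell2_normB _ _)); rewrite lerD2l.
    apply: (le_trans (ler_ell2_norm_sum _ _)); rewrite mulr_sumr.
    apply: ler_sum => j _.
    apply: (le_trans (qD _ _ _ e0 (hS (i, j)).1 (Da i j) (hS (i, j)).2 _)).
    by rewrite ler_pM2l.
  have h2 : ell2_norm (\sum_j a i j (xi j - trunc (F j) (xi j))) <= e * K.
    apply: (le_trans (ler_ell2_norm_sum _ _)).
    apply: (@le_trans _ _ (\sum_j B (i, j) * e)).
      apply: ler_sum => j _; apply: (le_trans ((hB (i, j)).2 _)).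
      by rewrite ler_wpM2l.
    rewrite -mulr_suml mulrC ler_pM2l // /K [leRHS](bigD1 i) //= lerDl.
    by rewrite sumr_ge0 // => k _; rewrite sumr_ge0.
  have h3 : ell2_norm (\sum_j (a i j - S (i, j)) (trunc (F j) (xi j))) <= e * X.
    apply: (le_trans (ler_ell2_norm_sum _ _)); rewrite mulr_sumr.
    apply: ler_sum => j _; apply: (le_trans ((hS (i, j)).2 _)).
    by rewrite ler_pM2l // trunc_norm_le.
  apply: (le_trans (ler_ell2_normD _ _)).
  apply: (le_trans (lerD h1 (ler_ell2_normD _ _))).
  by rewrite /L; have := lerD h2 h3; lra.
have hy : \sum_i y i ^+ 2 <= W.
  under eq_bigr do rewrite ell2_norm_sq.
  apply: (le_trans (hM eta)); rewrite ler_wpM2l ?sqr_ge0 //.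
  apply: ler_sum => j _; rewrite -!ell2_norm_sq.
  by rewrite lerXn2r ?nnegrE ?ell2_norm_ge0.
have y0 i : 0 <= y i by exact: ell2_norm_ge0.
(* From y <= y^2 + 1; it makes the cross term 2 e L y in (y + e L)^2 of order e. *)
have yW i : y i <= W + 1.
  have : y i ^+ 2 <= W.
    apply: le_trans hy; rewrite (bigD1 i) //= lerDl.
    by rewrite sumr_ge0 // => k _; exact: sqr_ge0.
  have := sqr_ge0 (y i - 1); have := y0 i; lra.
rewrite lerBlDr.
have hx2 i : nsq (\sum_j a i j (xi j)) <=
    y i ^+ 2 + e * (2 * L * (W + 1) + L ^+ 2).
  rewrite -ell2_norm_sq.
  apply: (@le_trans _ _ ((y i + e * L) ^+ 2)).
    by rewrite lerXn2r ?nnegrE ?ell2_norm_ge0 // addr_ge0 // mulr_ge0 // ltW.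
  have h1 : e * (L * y i) <= e * (L * (W + 1)).
    by rewrite ler_pM2l // ler_wpM2l.
  have h2 : e * e * L ^+ 2 <= e * L ^+ 2.
    by rewrite ler_wpM2r ?sqr_ge0 // ler_piMr // ltW.
  by move: (y i) h1 => z h1; lra.
apply: (le_trans (ler_sum _ (fun i _ => hx2 i))).
rewrite big_split /= sumr_const card_ord -[_ *+ n]mulr_natl.
by rewrite addrC mulrA -(mulrA n%:R) (mulrC e) mulrA lerD2l.
Qed.

End ApproximateTransfer.

(** * Constructible ideals and characters *)

Section Category.
Variable C : small_category.
Hypothesis lc : left_cancellative C.
Local Notation mul := (@Defs.comp C).
Implicit Types (s t : @graph C) (x y z : C) (X Y Z : @J C).

(** Left cancellation makes the generators injective. Single-valuedness and injectivity pass through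
    the induction together because inversion exchanges them. *)
Lemma Il_gen_inj s : Il_gen s ->
  (forall x y y', s x y -> s x y' -> y = y') /\
  (forall x x' y, s x y -> s x' y -> x = x').
Proof.
elim=> [c|{}s t _ [fs js] _ [ft jt]|{}s _ [fs js]].
- split=> [x y y' [_ ->] [_ ->] //|x x' y [tx ->] [tx' e]].
  by apply: (lc (c := c)) => //; rewrite -?tx -?tx'.
- split=> [x z z' [y txy syz] [y' txy' syz']|x x' z [y txy syz] [y' txy' syz']].
    by have e := ft _ _ _ txy txy'; rewrite -e in syz'; exact: fs syz syz'.
  by have e := js _ _ _ syz syz'; rewrite -e in txy'; exact: jt txy txy'.
- by split=> [x y y'|x x' y]; [exact: js|exact: fs].
Qed.

(** Left multiplications commute with right multiplications, and this passes to compositions and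
    inverses: s(xz) = s(x)z. So s(x) determines [s] on xC, and s(x) is again an arrow with domain
    d(x). *)
Lemma Il_gen_equivariant s x y : Il_gen s -> s x y -> dm x = dm y /\
  forall z, dm x = tg z -> s (mul x z) (mul y z).
Proof.
move=> gs; elim: gs x y => [c|{}s t _ IHs _ IHt|{}s _ IHs] x y.
- move=> [tx ->]; rewrite dm_comp ?tx //; split=> // z xz; split.
    by rewrite tg_comp.
  by rewrite Defs.compA // tx.
- move=> [w txw swy]; have [e ht] := IHt _ _ txw; have [e' hs] := IHs _ _ swy.
  split; first by rewrite e.
  by move=> z xz; exists (mul w z); [exact: ht|apply: hs; rewrite -e].
- move=> syx; have [e hs] := IHs _ _ syx; split=> // z xz.
  by apply: hs; rewrite e.
Qed.

Definition Il_inv (s : @Il C) : @Il C := Il_of (Il_inv (Il_gen_val s)).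

Lemma Il_fun (s : @Il C) x y y' : (val s : @graph C) x y ->
  (val s : @graph C) x y' -> y = y'.
Proof. by case: (Il_gen_inj (Il_gen_val s)) => h _; exact: h. Qed.

Lemma Il_inj (s : @Il C) x x' y : (val s : @graph C) x y ->
  (val s : @graph C) x' y -> x = x'.
Proof. by case: (Il_gen_inj (Il_gen_val s)) => _; apply. Qed.

Definition inJ X x := (val X : set C) x.

Lemma J_dom X : exists s : @Il C, val X = graph_dom (val s).
Proof. by case: X => X /= /set_mem [s hs <-]; exists (Il_of hs). Qed.

Lemma J_ext X Y : (forall x, inJ X x <-> inJ Y x) -> X = Y.
Proof. by move=> h; apply/val_inj/seteqP; split=> x /h. Qed.

(** The intersection of dom(s) and dom(t) is the domain of s t^-1 t, since t^-1 t is the identity of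
    dom(t). *)
Lemma J_cap_ex X Y : exists Z, val Z = val X `&` val Y.
Proof.
have [s es] := J_dom X; have [t et] := J_dom Y.
exists (domJ (Ilmul s (Ilmul (Il_inv t) t))); apply/seteqP; split=> x /=.
  move=> [z [y [w txw tyw] syz]]; rewrite [sval X]es [sval Y]et.
  by split; [exists z; rewrite (Il_inj txw tyw)|exists w].
rewrite [sval X]es [sval Y]et => -[[z sxz] [w txw]]; exists z, x => //.
by exists w.
Qed.

Definition capJ X Y : @J C := projT1 (cid (J_cap_ex X Y)).

Lemma val_capJ X Y : val (capJ X Y) = val X `&` val Y.
Proof. by rewrite /capJ; case: cid. Qed.

Lemma inJ_cap X Y x : inJ (capJ X Y) x <-> inJ X x /\ inJ Y x.
Proof. by rewrite /inJ val_capJ. Qed.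

(** xC is the image of left multiplication by x, hence the domain of its inverse. *)
Lemma principalJ x : exists X, forall y,
  inJ X y <-> exists2 z, dm x = tg z & y = mul x z.
Proof.
exists (domJ (Il_inv (Ilgen x))) => y; split.
  by move=> [z [tz ->]]; exists z.
by move=> [z tz ->]; exists z; split.
Qed.

Section Characters.
Implicit Type chi : {ptws @J C -> bool}.

Lemma char_nonempty chi X : is_character chi -> chi X -> exists x, inJ X x.
Proof.
move=> [_ _ h0] cX; apply/not_existsP => h.
have : val X = set0 by apply/seteqP; split=> x // /(h x).
by move=> /h0; rewrite cX.
Qed.

Lemma char_mono chi X Y : is_character chi -> chi X ->
  (forall x, inJ X x -> inJ Y x) -> chi Y.
Proof.
move=> [_ hcap _] cX sub; have e : val X = val X `&` val Y.
  by apply/seteqP; split=> x; [move=> Xx; split=> //; exact: sub|case].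
by have := hcap _ _ _ e; rewrite cX /= => <-.
Qed.

Lemma char_cap chi X Y : is_character chi -> chi (capJ X Y) = chi X && chi Y.
Proof. by move=> [_ hcap _]; apply: hcap; exact: val_capJ. Qed.

Lemma char_capI chi X Y : is_character chi -> chi X -> chi Y -> chi (capJ X Y).
Proof. by move=> hc cX cY; rewrite char_cap // cX cY. Qed.

Lemma char_local chi X Y Y' : is_character chi -> chi X ->
  (forall x, inJ X x -> inJ Y x <-> inJ Y' x) -> chi Y = chi Y'.
Proof.
move=> hc cX h; apply/idP/idP => cY.
  apply: (char_mono hc (char_capI hc cX cY)) => x /inJ_cap[Xx].
  by move/(h x Xx).
apply: (char_mono hc (char_capI hc cX cY)) => x /inJ_cap[Xx].
by move/(h x Xx).
Qed.

(** Characters are the nonempty proper filters of [J], and are built as such from here on. *)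
Lemma char_intro chi : (exists X, chi X) ->
  (forall X Y, chi X -> chi Y -> chi (capJ X Y)) ->
  (forall X Y, chi X -> (forall x, inJ X x -> inJ Y x) -> chi Y) ->
  (forall X, chi X -> exists x, inJ X x) -> is_character chi.
Proof.
move=> h1 h2 h3 h4; split=> // [X Y Z e|X X0].
  have Zcap : Z = capJ X Y by apply/val_inj; rewrite val_capJ.
  rewrite Zcap; apply/idP/andP => [cc|[]]; last exact: h2.
  by split; apply: (h3 _ _ cc) => x /inJ_cap[].
by apply/negP => /h4[x]; rewrite /inJ X0.
Qed.

(** Unlike in the definition of [Omega], the cover may overshoot [X] and contain empty ideals:
    intersect with [X] and discard the empty pieces. [{classic J}] supplies the equality test for
    list membership. *)
Lemma Omega_cover chi X (s : seq {classic @J C}) : Omega chi -> chi X ->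
  (forall x, inJ X x -> exists2 Y : {classic @J C}, Y \in s & inJ Y x) ->
  exists2 Y : {classic @J C}, Y \in s & chi Y.
Proof.
move=> [hc hcov] cX hX.
pose s' : seq {classic @J C} :=
  [seq Z <- [seq capJ X Y | Y : {classic @J C} <- s] | `[< val Z !=set0 >]].
have [] := hcov X (size s') (fun i => tnth (in_tuple s') i) _ _ _ cX.
- have [x Xx] := char_nonempty hc cX; by exists x.
- move=> i; have : tnth (in_tuple s') i \in s' by exact: mem_tnth.
  by rewrite mem_filter => /andP[/asboolP].
- apply/seteqP; split=> [x Xx|x [i _]].
    have [Y sY Yx] := hX x Xx.
    have Zs : (capJ X Y : {classic @J C}) \in s'.
      rewrite mem_filter; apply/andP; split; first by apply/asboolP; exists x; apply/inJ_cap.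
      by apply/mapP; exists Y.
    have /tnthP[i ei] : (capJ X Y : {classic @J C}) \in in_tuple s' by [].
    by exists i => //; rewrite -ei; apply/inJ_cap.
  have : tnth (in_tuple s') i \in s' by exact: mem_tnth.
  by rewrite mem_filter => /andP[_ /mapP[Y sY ->]] /inJ_cap[].
- move=> i; have : tnth (in_tuple s') i \in s' by exact: mem_tnth.
  rewrite mem_filter => /andP[_ /mapP[Y sY ->]].
  by rewrite char_cap // => /andP[_ cY]; exists Y.
Qed.

Lemma Omega_intro chi : is_character chi ->
  (forall X (s : seq {classic @J C}), chi X ->
    (forall x, inJ X x -> exists2 Y : {classic @J C}, Y \in s & inJ Y x) ->
    exists2 Y : {classic @J C}, Y \in s & chi Y) -> Omega chi.
Proof.
move=> hc h; split=> // X n Xs _ _ e cX.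
have [Y] : exists2 Y : {classic @J C}, Y \in [seq (Xs i : {classic @J C}) | i <- enum 'I_n] & chi Y.
  apply: h cX _ => x; rewrite /inJ e => -[i _ Xx]; exists (Xs i) => //.
  by apply/mapP; exists i => //; rewrite mem_enum.
by move=> /mapP[i _ ->] cY; exists i.
Qed.

Lemma prin_subproof x :
  (fun X : @J C => `[< inJ X x >] : bool) \in @Omega C.
Proof.
apply/mem_set/Omega_intro.
  apply: char_intro => [|X Y /asboolP Xx /asboolP Yx|X Y /asboolP Xx sub|X /asboolP Xx].
  - exists (domJ (Ilgen (tg x))); apply/asboolP; exists (mul (tg x) x); split=> //.
    by rewrite dm_tg.
  - by apply/asboolP/inJ_cap.
  - by apply/asboolP; exact: sub.
  - by exists x.
move=> X s /asboolP Xx /(_ _ Xx) [Y sY Yx]; exists Y => //; exact/asboolP.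
Qed.

Definition prin x : @Omega C := exist (fun c => c \in @Omega C) _ (prin_subproof x).

Lemma prinE x X : val (prin x) X <-> inJ X x.
Proof. by split=> [/asboolP|?]; [|exact/asboolP]. Qed.

(* The trace on C of the neighbourhoods of [chi], an arrow x standing for the
   character of all ideals containing x. *)
Definition near_char chi : set_system C := [set A | exists X (s : seq {classic @J C}),
  [/\ chi X, forall Y : {classic @J C}, Y \in s -> chi Y = false &
      forall x, inJ X x -> (forall Y : {classic @J C}, Y \in s -> ~ inJ Y x) -> A x]].

(** Properness is the density of the characters [prin x]: if a basic set held no arrow, the ideals
    in [s] would cover [X], and [chi], lying in [Omega], would be 1 on one of them. *)
Lemma near_char_filter chi : Omega chi -> ProperFilter (near_char chi).
Proof.
move=> hO; have [hc _] := hO; apply: Build_ProperFilter_ex => [A [X [s [cX hs hA]]]|].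
  apply/not_existsP => hn.
  have [] := Omega_cover (X := X) (s := s) hO cX; last by move=> Y sY; rewrite hs.
  move=> x Xx; have := hn x; apply: contra_notP => hY; apply: hA => // Y sY Yx.
  by apply: hY; exists Y.
split.
- by have [[X cX] _ _] := hc; exists X, [::].
- move=> A B [X [s [cX hs hA]]] [Y [t [cY ht hB]]]; exists (capJ X Y), (s ++ t).
  split; first exact: char_capI.
    by move=> Z; rewrite mem_cat => /orP[/hs|/ht].
  move=> x /inJ_cap[Xx Yx] hn; split; [apply: hA|apply: hB] => // Z hZ;
    by apply: hn; rewrite mem_cat hZ ?orbT.
- move=> A B AB [X [s [cX hs hA]]]; exists X, s; split=> // x Xx hn.
  by apply: AB; exact: hA.
Qed.

Lemma near_char_in chi X : chi X -> near_char chi [set x | inJ X x].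
Proof. by move=> cX; exists X, [::]; split. Qed.

Lemma near_char_notin chi X : Omega chi -> chi X = false ->
  near_char chi [set x | ~ inJ X x].
Proof.
move=> [[[Y cY] _ _] _] cX; exists Y, [:: (X : {classic @J C})]; split=> //.
  by move=> Z; rewrite inE => /eqP ->.
by move=> x _ h; apply: h; rewrite inE.
Qed.

Lemma near_char_iff chi X : Omega chi ->
  near_char chi [set x | val (prin x) X = chi X].
Proof.
move=> hO; have [cX|cX] := boolP (chi X).
  have := near_char_in cX; case=> Y [s [cY hs h]]; exists Y, s; split=> // x Yx hn.
  by apply/prinE; exact: h.
have := near_char_notin hO (negbTE cX); case=> Y [s [cY hs h]].
exists Y, s; split=> // x Yx hn; apply/negbTE/negP => /prinE; exact: h.
Qed.

Definition jfilter (A : set (@J C)) :=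
  [/\ forall X Y, A X -> A Y -> A (capJ X Y),
      forall X Y, A X -> (forall x, inJ X x -> inJ Y x) -> A Y &
      forall X, A X -> exists x, inJ X x].

Lemma maximal_character_above (A : set (@J C)) : jfilter A -> (exists X, A X) ->
  exists chi, maximal_character chi /\ forall X, A X -> chi X.
Proof.
move=> fA [X0 AX0].
(* [Zorn_bigcup] also tests the empty chain, whose union is empty; so [P] admits the empty family,
   and [jfilter] does not ask for a member. *)
pose P := [set B | jfilter B /\ (B = set0 \/ A `<=` B)].
have [|B [[fB hB] maxB]] := @Zorn_bigcup _ P.
  move=> F FP totF.
  have dir B1 B2 X Y : F B1 -> F B2 -> B1 X -> B2 Y ->
      exists B, [/\ F B, B X & B Y].
    move=> FB1 FB2 BX BY; have [le|le] := totF _ _ FB1 FB2.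
      by exists B2; split=> //; exact: le.
    by exists B1; split=> //; exact: le.
  split.
    split=> [X Y [B1 FB1 BX] [B2 FB2 BY]|X Y [B FB BX] sub|X [B FB BX]].
    - have [B [FB {}BX {}BY]] := dir _ _ _ _ FB1 FB2 BX BY.
      by exists B => //; have [[h _ _] _] := FP _ FB; exact: h.
    - by exists B => //; have [[_ h _] _] := FP _ FB; exact: h sub.
    - by have [[_ _ h] _] := FP _ FB; exact: h BX.
  have [[B [FB AB]]|hn] := pselect (exists B, F B /\ A `<=` B).
    by right=> X AX; exists B => //; exact: AB.
  left; apply/seteqP; split=> // X [B FB BX]; have [_ [B0|AB]] := FP _ FB.
    by rewrite B0 in BX.
  by apply: hn; exists B.
have AB : A `<=` B.
  case: hB => // B0; exfalso; apply: (maxB A); last by split=> //; right.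
  by rewrite B0; split=> // /(_ _ AX0).
pose chi : {ptws @J C -> bool} := fun X => `[< B X >].
have cB X : chi X <-> B X by split=> [/asboolP|?]; [|exact/asboolP].
have [B1 B2 B3] := fB.
exists chi; split; last by move=> X /AB/cB.
split.
  apply: char_intro => [|X Y /cB BX /cB BY|X Y /cB BX sub|X /cB BX].
  - by exists X0; apply/cB/AB.
  - by apply/cB/B1.
  - by apply/cB; exact: B2 BX sub.
  - exact: B3 BX.
move=> gam hg le; apply/seteqP; split=> // X gX; apply/cB.
apply: contrapT => nBX; apply: (maxB [set X | gam X]).
  split; first by move=> Y /cB; exact: le.
  by move=> /(_ _ gX).
split; last by right=> Y /AB/cB; exact: le.
by split=> [Y Z|Y Z gY sub|Y]; [exact: char_capI|exact: char_mono sub|exact: char_nonempty].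
Qed.

(** As for ultrafilters: if [X] met every ideal of [chi], then [gam], the filter generated by [chi]
    and [X], would be strictly larger. *)
Lemma maximal_character_disjoint chi X : maximal_character chi -> chi X = false ->
  exists2 Y, chi Y & forall x, inJ X x -> inJ Y x -> False.
Proof.
move=> [hc hmax] cX; apply: contrapT => hn.
have meet Y : chi Y -> exists2 x, inJ X x & inJ Y x.
  move=> cY; apply: contrapT => h; apply: hn; exists Y => // x Xx Yx.
  by apply: h; exists x.
pose gam : {ptws @J C -> bool} := fun Z =>
  `[< exists2 Y, chi Y & forall x, inJ X x -> inJ Y x -> inJ Z x >].
have gP Z : gam Z <-> exists2 Y, chi Y & forall x, inJ X x -> inJ Y x -> inJ Z x.
  by split=> [/asboolP|?]; [|exact/asboolP].
have gchi Y : chi Y -> gam Y by move=> cY; apply/gP; exists Y.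
have hg : is_character gam.
  have [[Y0 cY0] _ _] := hc.
  apply: char_intro => [|Z Z' /gP[Y cY h] /gP[Y' cY' h']|Z Z' /gP[Y cY h] sub|Z /gP[Y cY h]].
  - by exists Y0; exact: gchi.
  - apply/gP; exists (capJ Y Y'); first exact: char_capI.
    by move=> x Xx /inJ_cap[Yx Y'x]; apply/inJ_cap; split; [exact: h|exact: h'].
  - by apply/gP; exists Y => // x Xx Yx; apply: sub; exact: h.
  - by have [x Xx Yx] := meet _ cY; exists x; exact: h.
have e := hmax _ hg gchi.
have [[Y0 cY0] _ _] := hc.
have : [set Z | gam Z] X by apply/gP; exists Y0.
by rewrite e /= cX.
Qed.

(** If no member of a finite cover of [X] belonged to [chi], each would be disjoint from some ideal
    of [chi]; the intersection of these ideals with [X] would be nonempty and uncovered. *)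
Lemma maximal_character_Omega chi : maximal_character chi -> Omega chi.
Proof.
move=> hm; have [hc _] := hm; apply: Omega_intro => // X s cX cov.
apply: contrapT => hn.
have [Y cY hY] : exists2 Y, chi Y &
    forall Z : {classic @J C}, Z \in s -> forall x, inJ Z x -> inJ Y x -> False.
  have : forall Z : {classic @J C}, Z \in s -> chi Z = false.
    by move=> Z sZ; apply/negbTE/negP => cZ; apply: hn; exists Z.
  elim: s {cov hn} => [|Z s IH] hs; first by exists X.
  have [|Y cY hY] := IH.
    by move=> W sW; apply: hs; rewrite inE sW orbT.
  have [|Y' cY' hY'] := @maximal_character_disjoint chi Z hm.
    by apply: hs; rewrite mem_head.
  exists (capJ Y Y'); first exact: char_capI.
  move=> W; rewrite inE => /predU1P[->|sW] x Wx /inJ_cap[Yx Y'x].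
    exact: hY' Wx Y'x.
  exact: (hY _ sW _ Wx Yx).
have [x /inJ_cap[Xx Yx]] := char_nonempty hc (char_capI hc cX cY).
by have [Z sZ Zx] := cov x Xx; exact: hY Zx Yx.
Qed.

Lemma char_act (s : @Il C) chi : is_character chi -> chi (domJ s) ->
  is_character (act s chi).
Proof.
move=> hc cs; apply: char_intro => [|X Y cX cY|X Y cX sub|X cX].
- exists (domJ (Il_inv s)); rewrite /act; apply: (char_mono hc cs) => x [y sxy].
  by exists y => //; exists x.
- apply: (char_mono hc (char_capI hc cX cY)) => x /inJ_cap[[y Xy sxy] [y' Yy' sxy']].
  exists y => //; apply/inJ_cap; split=> //; by rewrite (Il_fun sxy sxy').
- apply: (char_mono hc cX) => x [y Xy sxy]; exists y => //; exact: sub.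
- by have [x [y Xy _]] := char_nonempty hc cX; exists y.
Qed.

Lemma act_Omega (s : @Il C) chi : Omega chi -> chi (domJ s) -> Omega (act s chi).
Proof.
move=> hO cs; have [hc _] := hO; apply: Omega_intro; first exact: char_act.
move=> X r cX cov.
pose r' := [seq (preimJ s Y : {classic @J C}) | Y : {classic @J C} <- r].
have [] := @Omega_cover chi (preimJ s X) r' hO cX.
  move=> x [y Xy sxy]; have [Y rY Yy] := cov y Xy.
  by exists (preimJ s Y); [apply/mapP; exists Y|exists y].
by move=> Z /mapP[Y rY ->] cY; exists Y.
Qed.

Lemma act_local (s t : @Il C) chi X : is_character chi -> chi X ->
  (forall x, inJ X x -> exists2 y, (val s : @graph C) x y & (val t : @graph C) x y) ->
  act s chi = act t chi.
Proof.
move=> hc cX h; apply/funext => Y; apply: (char_local hc cX) => x Xx.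
have [y sxy txy] := h x Xx.
by split=> -[z Yz hz]; exists y => //;
  [rewrite (Il_fun sxy hz)|rewrite (Il_fun txy hz)].
Qed.

Lemma act_comp (s t : @Il C) chi : act (Ilmul s t) chi = act s (act t chi).
Proof.
apply/funext => X; congr (chi _); apply/J_ext => x; split.
  by move=> [z Xz [y txy syz]]; exists y => //; exists z.
by move=> [y [z Xz syz] txy]; exists z => //; exists y.
Qed.

Lemma act_invK (s : @Il C) chi : is_character chi -> chi (domJ s) ->
  act (Il_inv s) (act s chi) = chi.
Proof.
move=> hc cs; apply/funext => X; apply: (char_local hc cs) => x [y sxy]; split.
  move=> [y' [x' Xx' syx'] sxy']; have e := Il_fun sxy sxy'; rewrite -e in syx'.
  by rewrite (Il_inj sxy syx').
by move=> Xx; exists y => //; exists x.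
Qed.

Lemma act_inv_dom (s : @Il C) chi : is_character chi -> chi (domJ s) ->
  act s chi (domJ (Il_inv s)).
Proof.
move=> hc cs; apply: (char_mono hc cs) => x [y sxy].
by exists y => //; exists x.
Qed.

(** s^-1 carries a character above s.chi to one above chi. *)
Lemma act_maximal (s : @Il C) chi : maximal_character chi -> chi (domJ s) ->
  maximal_character (act s chi).
Proof.
move=> [hc hmax] cs; split; first exact: char_act.
move=> gam hg le.
have gs : gam (domJ (Il_inv s)) by apply: le; exact: act_inv_dom.
have hg' : is_character (act (Il_inv s) gam) by exact: char_act.
have e : [set X | act (Il_inv s) gam X] = [set X | chi X].
  apply: hmax => // X cX; rewrite -(act_invK hc cs) in cX.
  exact: (le (preimJ (Il_inv s) X)).
apply/seteqP; split=> // X gX.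
have ss : Il_inv (Il_inv s) = s by exact: val_inj.
have : gam X = act s (act (Il_inv s) gam) X.
  by have h := act_invK hg gs; rewrite ss in h; rewrite h.
by rewrite gX => /esym h; have : [set X | act (Il_inv s) gam X] (preimJ s X);
  [exact: h|rewrite e].
Qed.

End Characters.

End Category.

(** * The groupoid of germs *)

Section OmegaTopology.
Variable C : small_category.
Hypothesis lc : left_cancellative C.
Implicit Types (X : @J C) (chi : @Omega C).

Lemma Omega_eval_near chi X : \forall psi \near chi, val psi X = val chi X.
Proof.
have /cvg_sup/(_ X) h1 : nbhs (val chi : {ptws @J C -> bool}) --> val chi by exact: cvg_id.
have h3 : nbhs (val chi : {ptws @J C -> bool}) [set f | f X = val chi X].
  apply: h1; exists [set f | f X = val chi X]; split=> //.
  by exists [set val chi X] => //; exact: discrete_open.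
exact: (@initial_continuous _ _ (set_val : @Omega C -> _) chi _ h3).
Qed.

Lemma Omega_cvg (F : set_system (@Omega C)) chi : Filter F ->
  (forall X, F [set psi | val psi X = val chi X]) -> F --> chi.
Proof.
move=> FF hF.
have h : {ptws, (set_val @ F) --> (val chi : {ptws @J C -> bool})}.
  apply/cvg_sup => X A [_ [[V Vop <-] /= VX] sub].
  suff : F (set_val @^-1` A) by [].
  apply: filterS (hF X) => psi /= e; apply: sub => /=.
  by rewrite -e in VX; exact: VX.
move=> U [_ [[B Bop <-] /= Bchi sub]].
have : nbhs (val chi : {ptws @J C -> bool}) B by apply: open_nbhs_nbhs.
move=> /h hB; have FB : F (set_val @^-1` B) by [].
exact: (filterS sub FB).
Qed.

Lemma prin_cvg chi : prin lc @ near_char (val chi) --> chi.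
Proof.
have FF := near_char_filter lc (set_mem (valP chi)).
apply: Omega_cvg => X.
exact: near_char_iff (set_mem (valP chi)).
Qed.

Lemma open_OmegaX X : open (OmegaX X).
Proof.
rewrite openE => chi /= cX; apply: filterS (Omega_eval_near chi X) => psi /= e.
by rewrite /OmegaX /= e.
Qed.

(** The limit of an ultrafilter is 1 on [Y] exactly when [OmegaX Y] is large. It is nonzero because
    [OmegaX X] is large, and it respects finite covers because the complements of finitely many sets
    that are not large have a large intersection. *)
Lemma compact_OmegaX X : compact (OmegaX X).
Proof.
rewrite compact_ultra => F UF FX.
pose c : {ptws @J C -> bool} := fun Y => `[< F (OmegaX Y) >].
have cP Y : c Y <-> F (OmegaX Y) by split=> [/asboolP|?]; [|exact/asboolP].
have ch (psi : @Omega C) : is_character (val psi) by have [] := set_mem (valP psi).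
have FN Y : c Y = false -> F [set psi : @Omega C | val psi Y = false].
  move=> cY; have [FY|FY] := in_ultra_setVsetC (OmegaX Y) UF.
    by move/cP: FY; rewrite cY.
  by apply: filterS FY => psi /negP/negbTE.
have hO : Omega c.
  apply: Omega_intro.
    apply: (@char_intro _ lc c) => [|Y Z /cP FY /cP FZ|Y Z /cP FY sub|Y /cP FY].
    - by exists X; apply/cP.
    - apply/cP; apply: filterS (filterI FY FZ) => psi [pY pZ].
      exact: (char_capI lc (ch psi)).
    - by apply/cP; apply: filterS FY => psi pY; exact: char_mono (ch psi) pY sub.
    - by have [psi pY] := filter_ex FY; exact: char_nonempty (ch psi) pY.
  move=> Y s /cP FY cov; apply: contrapT => hn.
  have FA : F [set psi : @Omega C | forall Z : {classic @J C}, Z \in s -> val psi Z = false].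
    have hs : forall Z : {classic @J C}, Z \in s -> c Z = false.
      by move=> Z sZ; apply/negbTE/negP => cZ; apply: hn; exists Z.
    elim: s hs {cov hn} => [|Z s IH] hs; first by apply: filterE => psi.
    have F1 := IH (fun W sW => hs W (etrans (in_cons _ _ _) (introT orP (or_intror sW)))).
    apply: filterS (filterI (FN Z (hs Z (mem_head _ _))) F1) => psi [/= pZ pW] W.
    by rewrite inE => /predU1P[->|/pW].
  have [psi [pY pA]] := filter_ex (filterI FY FA).
  have [Z sZ] := Omega_cover lc (set_mem (valP psi)) pY cov.
  by rewrite pA.
pose chi : @Omega C := exist (fun c => c \in @Omega C) c (mem_set hO).
exists chi; split; first by apply/cP.
apply: Omega_cvg => Y /=.
case: (boolP (c Y)) => [cY|/negbTE cY]; last exact: FN.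
by move/cP: cY.
Qed.

End OmegaTopology.

Section Germs.
Variable C : small_category.
Hypothesis lc : left_cancellative C.
Implicit Types (X : @J C) (chi : @Omega C) (s t r : @Il C) (g h k : germs C).

Lemma Omega_char chi : is_character (val chi).
Proof. by have [] := set_mem (valP chi). Qed.

Definition agree chi s t := exists2 X, val chi X &
  forall x, inJ X x -> exists2 y, (val s : @graph C) x y & (val t : @graph C) x y.

Lemma agree_refl chi s : val chi (domJ s) -> agree chi s s.
Proof. by move=> cs; exists (domJ s) => // x [y sxy]; exists y. Qed.

Lemma agree_sym chi s t : agree chi s t -> agree chi t s.
Proof. by move=> [X cX h]; exists X => // x /h[y sxy txy]; exists y. Qed.

Lemma agree_trans chi s t r : agree chi s t -> agree chi t r -> agree chi s r.
Proof.
move=> [X cX h] [Y cY h']; exists (capJ lc X Y).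
  exact: (char_capI lc (Omega_char chi)).
move=> x /inJ_cap[/h[y sxy txy] /h'[z txz rxz]]; exists y => //.
by rewrite (Il_fun lc txy txz).
Qed.

Lemma agree_dom chi s t : agree chi s t -> val chi (domJ s).
Proof.
move=> [X cX h]; apply: char_mono (Omega_char chi) cX _ => x /h[y sxy _].
by exists y.
Qed.

Lemma agree_mulr chi s t t' : agree chi t t' -> val chi (domJ (Ilmul s t)) ->
  agree chi (Ilmul s t) (Ilmul s t').
Proof.
move=> [X cX h] cd; exists (capJ lc X (domJ (Ilmul s t))).
  exact: (char_capI lc (Omega_char chi)).
move=> x /inJ_cap[/h[y txy t'xy] [z [y' txy' syz]]]; exists z; first by exists y'.
by exists y => //; rewrite (Il_fun lc txy txy').
Qed.

Lemma agree_mull chi psi s s' t : val psi = act t (val chi) ->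
  agree psi s s' -> agree chi (Ilmul s t) (Ilmul s' t).
Proof.
move=> e [X pX h]; exists (preimJ t X); first by rewrite e in pX.
by move=> x [y Xy txy]; have [z syz s'yz] := h y Xy; exists z; exists y.
Qed.

Lemma agree_act chi s t : agree chi s t -> act s (val chi) = act t (val chi).
Proof. by move=> [X cX h]; exact: act_local (Omega_char chi) cX h. Qed.

Lemma germ_ex g : exists s chi, is_germ g s chi.
Proof. by case: g => A [s [chi [cs e]]]; exists s, chi; split. Qed.

Lemma germ_mk s chi : val chi (domJ s) -> exists g, is_germ g s chi.
Proof.
move=> cs; have hA : exists s' chi', OmegaX (domJ s') chi' /\
    germ_class s chi = germ_class s' chi' by exists s, chi.
by exists (exist _ (germ_class s chi) hA); split.
Qed.

Lemma is_germ_dom g s chi : is_germ g s chi -> val chi (domJ s).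
Proof. by case. Qed.

Lemma is_germ_inj g s t chi psi : is_germ g s chi -> is_germ g t psi ->
  chi = psi /\ agree chi s t.
Proof.
move=> [cs es] [ct et].
have : germ_class t psi (t, psi).
  by split=> //; split=> //=; exact: agree_refl.
by rewrite -et es => -[_ [/= e h]]; split.
Qed.

Lemma agree_class chi s t : agree chi s t -> germ_class s chi = germ_class t chi.
Proof.
move=> h; apply/seteqP; split=> -[r psi] [/= cr [/= e h']]; split=> //; split=> //=.
  exact: agree_trans (agree_sym h) h'.
exact: agree_trans h h'.
Qed.

Lemma is_germ_agree g s t chi : is_germ g s chi -> agree chi s t -> is_germ g t chi.
Proof.
move=> [cs e] h; split; first exact: agree_dom (agree_sym h).
by rewrite e; exact: agree_class.
Qed.

Lemma is_germ_eq g h s chi : is_germ g s chi -> is_germ h s chi -> g = h.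
Proof.
move=> [_ e] [_ e']; case: g e => A hA /= e; case: h e' => B hB /= e'.
by rewrite -e in e'; subst B; congr exist; exact: Prop_irrelevance.
Qed.

(* [k] is the product of the germ of [s] at the range of [h] with [h]. *)
Definition mulrel s h k := exists t chi, is_germ h t chi /\ is_germ k (Ilmul s t) chi.

Lemma mulrel_germ s t h k chi : is_germ h t chi -> mulrel s h k ->
  is_germ k (Ilmul s t) chi.
Proof.
move=> ht [t' [chi' [ht' kt']]]; have [e a] := is_germ_inj ht' ht; subst chi'.
exact: is_germ_agree kt' (agree_mulr a (is_germ_dom kt')).
Qed.

Lemma mulrel_fun s h k k' : mulrel s h k -> mulrel s h k' -> k = k'.
Proof.
move=> hk hk'; have [t [chi [ht kt]]] := hk.
exact: is_germ_eq kt (mulrel_germ ht hk').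
Qed.

Lemma Ilmul_invl_agree s t chi : val chi (domJ (Ilmul s t)) ->
  agree chi (Ilmul (Il_inv s) (Ilmul s t)) t.
Proof.
move=> cd; exists (domJ (Ilmul s t)) => // x [z [y txy syz]]; exists y => //.
by exists z => //; exists y.
Qed.

Lemma mulrel_inv s h k : mulrel s h k -> mulrel (Il_inv s) k h.
Proof.
move=> [t [chi [ht kt]]]; exists (Ilmul s t), chi; split=> //.
exact: is_germ_agree ht (agree_sym (Ilmul_invl_agree (is_germ_dom kt))).
Qed.

Lemma Il_invK s : Il_inv (Il_inv s) = s.
Proof. exact: val_inj. Qed.

Lemma mulrel_inj s h h' k : mulrel s h k -> mulrel s h' k -> h = h'.
Proof. by move=> /mulrel_inv a /mulrel_inv; exact: mulrel_fun a. Qed.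

Lemma IlmulA s t r : Ilmul (Ilmul s t) r = Ilmul s (Ilmul t r).
Proof.
apply/val_inj/funext => x; apply/funext => y; apply/propext; split.
  by move=> [z rxz [w tzw swy]]; exists w => //; exists z.
by move=> [w [z rxz tzw] swy]; exists z => //; exists w.
Qed.

Lemma mulrel_comp s t h k : mulrel (Ilmul s t) h k <->
  exists2 k', mulrel t h k' & mulrel s k' k.
Proof.
split=> [[r [chi [hr kr]]]|[k' [r [chi [hr kr]]] /(mulrel_germ kr) hk]].
  rewrite IlmulA in kr.
  have [|k' hk'] := @germ_mk (Ilmul t r) chi.
    apply: char_mono (Omega_char chi) (is_germ_dom kr) _ => x [y [z trz sy]].
    by exists z.
  by exists k'; [exists r, chi|exists (Ilmul t r), chi].
by exists r, chi; rewrite IlmulA.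
Qed.

(** The preimage of [k] under left translation by [s], in the backward form that [pinj] takes. *)
Definition pre s k : option (germs C) :=
  if pselect (exists h, mulrel s h k) is left e then Some (projT1 (cid e)) else None.

Lemma preP s h k : pre s k = Some h <-> mulrel s h k.
Proof.
rewrite /pre; case: pselect => [e|n]; last first.
  by split=> // hk; exfalso; apply: n; exists h.
case: cid => h' /= hk'; split=> [[<-] //|hk].
by congr Some; exact: mulrel_inj hk' hk.
Qed.

Lemma pre_None s k : (forall h, ~ mulrel s h k) -> pre s k = None.
Proof. by move=> hn; case e: (pre s k) => [h|//]; move/preP: e => /hn. Qed.

Lemma pre_inj s h k k' : pre s k = Some h -> pre s k' = Some h -> k = k'.
Proof. by move=> /preP a /preP; exact: mulrel_fun a. Qed.

Definition src_range g chi (psi : @Omega C) :=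
  exists2 s, is_germ g s chi & val psi = act s (val chi).

Lemma src_range_ex g : exists chi psi, src_range g chi psi.
Proof.
have [s [chi hg]] := germ_ex g.
have hO : Omega (act s (val chi)).
  exact: (act_Omega lc (set_mem (valP chi)) (is_germ_dom hg)).
by exists chi, (exist (fun c => c \in @Omega C) _ (mem_set hO)), s.
Qed.

Lemma src_range_fun g chi psi chi' psi' : src_range g chi psi ->
  src_range g chi' psi' -> chi = chi' /\ psi = psi'.
Proof.
move=> [s hs e] [s' hs' e']; have [ec a] := is_germ_inj hs hs'.
by split=> //; apply: val_inj; rewrite e e' -ec; exact: agree_act.
Qed.

Lemma is_germ_range g s chi psi psi' : is_germ g s chi -> src_range g psi psi' ->
  chi = psi /\ val psi' = act s (val chi).
Proof.
move=> hs [s' hs' e]; have [ec a] := is_germ_inj hs hs'.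
by split=> //; rewrite e -ec; exact/esym/agree_act.
Qed.

(** A left factor from the bisection acts as [mulrel s] and is itself determined by the range of
    [h]. Hence convolution by the indicator of the bisection has at most one term. *)
Lemma germ_mul_bisection s g h k : germ_mul g h k ->
  bisection s (OmegaX (domJ s)) g -> mulrel s h k /\
  forall chi psi, src_range h chi psi -> is_germ g s psi.
Proof.
move=> [s' [t [chi [psi [e gs ht kst]]]]] [psi' cs' gs'].
have [ep a] := is_germ_inj gs gs'; subst psi'; split.
  by exists t, chi; split=> //; apply: is_germ_agree kst (agree_mull e a).
move=> chi' psi' /(is_germ_range ht)[_ e'].
by have -> : psi' = psi by apply: val_inj; rewrite e'.
Qed.

Lemma mulrel_germ_mul s h k : mulrel s h k -> exists2 g, germ_mul g h k &
  bisection s (OmegaX (domJ s)) g.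
Proof.
move=> [t [chi [ht kst]]].
have [chi' [psi hpsi]] := src_range_ex h; have [_ e] := is_germ_range ht hpsi.
have cs : val psi (domJ s).
  rewrite e; apply: char_mono (Omega_char chi) (is_germ_dom kst) _ => x.
  by move=> [z [y txy syz]]; exists y => //; exists z.
have [g hg] := germ_mk cs; exists g; first by exists s, t, chi, psi.
by exists psi.
Qed.

Lemma germ_mul_unique s g h g' h' k : germ_mul g h k -> germ_mul g' h' k ->
  bisection s (OmegaX (domJ s)) g -> bisection s (OmegaX (domJ s)) g' ->
  g = g' /\ h = h'.
Proof.
move=> m m' b b'; have [r1 c1] := germ_mul_bisection m b.
have [r2 c2] := germ_mul_bisection m' b'.
have e := mulrel_inj r1 r2; subst h'; split=> //.
have [chi [psi sr]] := src_range_ex h.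
exact: is_germ_eq (c1 _ _ sr) (c2 _ _ sr).
Qed.

Lemma germ_mul_range g h k : germ_mul g h k -> exists chi psi phi,
  [/\ src_range h chi psi, src_range g psi phi & src_range k chi phi].
Proof.
move=> [s [t [chi [psi [e gs ht kst]]]]].
have [psi' [phi hphi]] := src_range_ex g; have [ep ephi] := is_germ_range gs hphi.
exists chi, psi, phi; split; first by exists t.
  by exists s.
by exists (Ilmul s t) => //; rewrite act_comp ephi e.
Qed.

Lemma bd_germsP g chi psi : src_range g chi psi ->
  bd_germs g <-> bdOmega chi /\ bdOmega psi.
Proof.
move=> sr; split=> [[s [chi' [psi' [gs e b1 b2]]]]|[b1 b2]].
  have [-> e2] := src_range_fun sr (ex_intro2 _ _ s gs e).
  by rewrite e2.
by have [s gs e] := sr; exists s, chi, psi.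
Qed.

(** Continuity of psi |-> [s, psi] at chi. By the choice of subbase it suffices to consider a basic
    bisection [t, W] through the germ, and the ideal on which s and t agree belongs to all
    characters near chi. *)
Lemma section_near s chi g (U : set (germs C)) : is_germ g s chi -> nbhs g U ->
  \forall psi \near chi, forall g', is_germ g' s psi -> U g'.
Proof.
move=> gs; rewrite nbhsE => -[V [Vop Vg] VU].
suff : \forall psi \near chi, forall g', is_germ g' s psi -> V g'.
  by apply: filterS => psi hp g' /hp /VU.
case: Vop Vg => D' D'sub <- [A D'A Ag].
suff : \forall psi \near chi, forall g', is_germ g' s psi -> A g'.
  by apply: filterS => psi hp g' /hp Ag'; exists A.
have [F Fsub eF] := D'sub _ D'A.
have hF : forall B, B \in F -> \forall psi \near chi, forall g', is_germ g' s psi -> B g'.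
  move=> B BF; have Bg : B g by move: Ag; rewrite -eF; apply.
  have [t [W [Wsub Wc Wop eB]]] := set_mem (Fsub _ BF).
  rewrite eB in Bg *; have [chi' Wchi gt] := Bg.
  have [e [X cX a]] := is_germ_inj gs gt; subst chi'.
  have n1 : \forall psi \near chi, W psi by exact: open_nbhs_nbhs.
  have n2 := Omega_eval_near chi X.
  apply: filterS (filterI n1 n2) => psi [Wpsi e] g' g's; exists psi => //.
  by apply: is_germ_agree g's _; exists X => //; rewrite e.
have : nbhs chi (\bigcap_(B in [set` F])
    [set psi | forall g', is_germ g' s psi -> B g']) by exact: filter_bigI.
by apply: filterS => psi hp g' gs'; rewrite -eF => B BF; exact: hp BF g' gs'.
Qed.

(** Along an ultrafilter the sources converge in the compact set [OmegaX (domJ s)], and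
    [section_near] lifts the limit to a germ of [s]. *)
Lemma compact_bisection s : compact (bisection s (OmegaX (domJ s))).
Proof.
rewrite compact_ultra => F UF FB.
pose src g := projT1 (cid (src_range_ex g)).
have srcP g t chi : is_germ g t chi -> src g = chi.
  rewrite /src; case: cid => chi' /= [psi sr] gt.
  by have [] := is_germ_range gt sr.
have FU : ProperFilter (src @ F) by exact: fmap_proper_filter.
have Fs : (src @ F) (OmegaX (domJ s)).
  suff : F (src @^-1` OmegaX (domJ s)) by [].
  by apply: filterS FB => g [chi cs gs]; rewrite /= (srcP _ _ _ gs).
have [chi [cs cl]] := compact_OmegaX lc FU Fs.
have [g gs] := germ_mk cs; exists g; split; first by exists chi.
move=> U Ug; have := section_near gs Ug.
have [FUg|FUg] := in_ultra_setVsetC U UF; first by [].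
move=> nU; exfalso.
have [psi [[g' [nUg' [chi' cs' gs']] e] nU2]] :
    ((src @` (~` U `&` bisection s (OmegaX (domJ s)))) `&`
     [set psi | forall g', is_germ g' s psi -> U g']) !=set0.
  apply: cl => //; suff : F (src @^-1` (src @` (~` U `&` bisection s (OmegaX (domJ s))))) by [].
  apply: filterS (filterI FUg FB) => g' h; by exists g'.
by apply: nUg'; apply: nU2; rewrite -e (srcP _ _ _ gs').
Qed.

Lemma open_bisection s : open (bisection s (OmegaX (domJ s))).
Proof.
pose B := bisection s (OmegaX (domJ s)).
have bB : basic_bisections B.
  exists s, (OmegaX (domJ s)); split=> //; [exact: compact_OmegaX|exact: open_OmegaX].
exists [set B]; last by rewrite bigcup_set1.
move=> _ ->; exists [fset B]%fset.
  by move=> A /=; rewrite in_fset1 => /eqP ->; exact: mem_set.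
apply/seteqP; split=> g; first by move=> h; exact: (h B (fset11 B)).
by move=> Bg A; rewrite /= in_fset1 => /eqP ->.
Qed.

End Germs.

(** * Left multiplication operators *)

Lemma fsbig_single (T : choiceType) (V : nmodType) (D : set T) (F : T -> V) p :
  D p -> (forall p', D p' -> F p' != 0 -> p' = p) -> \sum_(i \in D) F i = F p.
Proof.
move=> Dp hF; rewrite -(@fsbig_widen _ _ _ _ [set p]) ?fsbig_set1 //.
  by move=> _ ->.
by move=> i [Di /= ni]; apply/eqP/negPn/negP => /(hF i Di).
Qed.

Section RegularRep.
Variables (R : realType) (G : topologicalType) (m : G -> G -> G -> Prop).

Lemma regular_rep_unique (f : G -> cplx R) (S T : op R G) :
  is_regular_rep m f S -> is_regular_rep m f T -> S = T.
Proof.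
move=> [_ hS] [_ hT]; apply/funext => xi; apply: ell2P => g.
by rewrite hS hT.
Qed.

(** A sum over a fibre takes the default value 0 when its support is infinite; this condition is
    what makes convolution additive in [f]. *)
Definition fibre_finite (f : G -> cplx R) :=
  forall g, finite_set [set p : G * G | m p.1 p.2 g /\ f p.1 != 0].

Lemma regular_rep_sum (f : G -> cplx R) (xi : ell2 R G) g (W : set (G * G)) :
  finite_set W -> W `<=` [set p | m p.1 p.2 g] ->
  [set p : G * G | m p.1 p.2 g /\ f p.1 != 0] `<=` W ->
  \sum_(p \in [set p : G * G | m p.1 p.2 g]) f p.1 * xi p.2 =
  \sum_(p <- fset_set W) f p.1 * xi p.2.
Proof.
move=> fW sub sup; rewrite -(@fsbig_widen _ _ _ _ W) ?fsbig_finite //.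
move=> p [Dp nW] /=; have [f0|n0] := eqVneq (f p.1) 0.
  by rewrite f0 mul0r.
by exfalso; apply: nW; apply: sup.
Qed.

Lemma regular_rep_comb (f f' : G -> cplx R) (S T : op R G) k :
  fibre_finite f -> fibre_finite f' ->
  is_regular_rep m f S -> is_regular_rep m f' T ->
  is_regular_rep m (fun g => k * f g + f' g) (k *: S + T).
Proof.
move=> ff ff' [bS hS] [bT hT]; split; first exact: bounded_op_comb.
move=> xi g; rewrite -[LHS]/(k * S xi g + T xi g) hS hT.
pose W := [set p : G * G | m p.1 p.2 g /\ f p.1 != 0] `|`
  [set p : G * G | m p.1 p.2 g /\ f' p.1 != 0].
have fW : finite_set W by rewrite finite_setU; split; [exact: ff|exact: ff'].
have sW : W `<=` [set p | m p.1 p.2 g] by move=> p [] [].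
rewrite (regular_rep_sum xi fW sW); last by left.
rewrite (regular_rep_sum xi fW sW); last by right.
rewrite (regular_rep_sum (f := fun g => k * f g + f' g) xi fW sW).
  rewrite mulr_sumr -big_split /=; apply: eq_bigr => p _.
  by rewrite mulrDl mulrA.
move=> p /= [mp n0]; have [f0|f0] := eqVneq (f p.1) 0; last by left.
by right; split=> //; move: n0; rewrite f0 mulr0 add0r.
Qed.

Lemma fibre_finite_comb (f f' : G -> cplx R) k :
  fibre_finite f -> fibre_finite f' -> fibre_finite (fun g => k * f g + f' g).
Proof.
move=> ff ff' g; apply: (@sub_finite_set _ _
  ([set p : G * G | m p.1 p.2 g /\ f p.1 != 0] `|`
   [set p : G * G | m p.1 p.2 g /\ f' p.1 != 0])).
  move=> p /= [mp n0]; have [f0|f0] := eqVneq (f p.1) 0; last by left.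
  by right; split=> //; move: n0; rewrite f0 mulr0 add0r.
by rewrite finite_setU; split; [exact: ff|exact: ff'].
Qed.

Lemma Cc_comb (f f' : G -> cplx R) k : Cc f -> Cc f' ->
  Cc (fun g => k * f g + f' g).
Proof.
move=> [cf kf] [cf' kf']; split.
  move=> g; apply: (@cvgD _ (cplx R : normedModType _)); last exact: cf'.
  by apply: (@cvgMr _ _); exact: cf.
apply: (@subclosed_compact _ _
  (closure [set g | f g != 0] `|` closure [set g | f' g != 0])).
- exact: closed_closure.
- exact: compactU.
- rewrite -closureU; apply: closure_subset => g /= n0.
  have [f0|f0] := eqVneq (f g) 0; last by left.
  by right; move: n0; rewrite f0 mulr0 add0r.
Qed.

(** Hausdorffness makes the compact set closed, so its indicator is continuous. This puts the
    indicators of the bisections into [Cc]. *)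
Lemma Cc_indic (B : set G) : hausdorff_space G -> open B -> compact B ->
  Cc (\1_B : G -> cplx R).
Proof.
move=> hG oB kB; have cB := compact_closed hG kB; split.
  move=> g; have [Bg|Bg] := pselect (B g).
    apply: cvg_near_cst; have : nbhs g B by exact: open_nbhs_nbhs.
    by apply: filterS => h Bh; rewrite !indicE !mem_set.
  apply: cvg_near_cst.
  have : nbhs g (~` B) by apply: open_nbhs_nbhs; split=> //; exact: closed_openC.
  by apply: filterS => h Bh; rewrite !indicE !memNset.
rewrite (_ : [set g | _] = B); first by rewrite closure_id in cB; rewrite -cB.
apply/seteqP; split=> g /=; rewrite indicE.
  by case: (boolP (g \in B)) => [/set_mem //|]; rewrite eqxx.
by move=> Bg; rewrite mem_set // oner_neq0.
Qed.

End RegularRep.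

Section Lam.
Variables (R : realType) (C : small_category).
Hypothesis lc : left_cancellative C.
Implicit Types (s t : @Il C) (g h k : germs C) (xi : ell2 R (germs C)).

Lemma pre_pinj s : pinjective (pre s).
Proof. by move=> i j k; exact: (pre_inj lc). Qed.

Definition lam s : op R (germs C) := pinj (@pre_pinj s).

Lemma lam_some s h k xi : mulrel s h k -> lam s xi k = xi h.
Proof. by move=> /(preP lc) e; rewrite pinjE e. Qed.

Lemma lam_none s k xi : (forall h, ~ mulrel s h k) -> lam s xi k = 0.
Proof. by move=> e; rewrite pinjE pre_None. Qed.

Lemma lam_cases s k : (exists h, mulrel s h k) \/ (forall h, ~ mulrel s h k).
Proof.
have [?|n] := pselect (exists h, mulrel s h k); [by left|right].
by move=> h hk; apply: n; exists h.
Qed.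

Lemma lam_bounded s : bounded_op (lam s).
Proof.
split; first exact: pinj_linear.
by exists 1; exact: pinj_opbnd.
Qed.

Lemma lam_linear s : linear (lam s). Proof. by have [] := lam_bounded s. Qed.

Lemma lam_comp s t : lam s \o lam t = lam (Ilmul s t).
Proof.
apply/funext => xi; apply: ell2P => k; rewrite /comp.
have [[h hk]|n] := lam_cases s k.
  rewrite (lam_some _ hk); have [[h' hk']|n'] := lam_cases t h.
    rewrite (lam_some _ hk') (lam_some (h := h')) //.
    by apply/(mulrel_comp lc); exists h.
  rewrite (lam_none _ n') lam_none // => h' /(mulrel_comp lc)[k' r1 r2].
  by rewrite (mulrel_inj lc hk r2) in n'; exact: n' r1.
rewrite (lam_none _ n) lam_none // => h' /(mulrel_comp lc)[k' _ r2].
exact: n r2.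
Qed.

Lemma lam_radj s : radj (lam s) (lam (Il_inv s)).
Proof.
move=> xi eta; apply: pinj_adjoint => i j; split=> /(preP lc) r; apply/(preP lc).
  exact: (mulrel_inv lc).
by rewrite -[s]Il_invK; exact: (mulrel_inv lc).
Qed.

Lemma lam_delta s h k : mulrel s h k -> lam s (delta R h) = delta R k.
Proof.
move=> hk; apply: ell2P => j; rewrite deltaE.
have [[i ij]|n] := lam_cases s j.
  rewrite (lam_some _ ij) deltaE; congr ((nat_of_bool _)%:R : cplx R).
  apply/idP/idP => /eqP e; apply/eqP.
    by rewrite e in ij; exact: (mulrel_fun lc) ij hk.
  by rewrite e in ij; exact: (mulrel_inj lc) ij hk.
rewrite (lam_none _ n); case: eqP => // e; exfalso.
by rewrite e in n; exact: n hk.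
Qed.

Lemma lam_delta0 s h : (forall k, ~ mulrel s h k) -> lam s (delta R h) = 0.
Proof.
move=> n; apply: ell2P => j; have [[i ij]|n'] := lam_cases s j; last first.
  by rewrite (lam_none _ n').
rewrite (lam_some _ ij) deltaE; case: eqP => // e; exfalso.
by rewrite e in ij; exact: n ij.
Qed.

Lemma fibre_finite_indic s :
  fibre_finite (@germ_mul C) (\1_(bisection s (OmegaX (domJ s))) : _ -> cplx R).
Proof.
move=> k; set A := [set p | _].
have [[p Ap]|n] := pselect (exists p, A p); last first.
  by rewrite (_ : A = set0) //; apply/seteqP; split=> p // Ap; apply: n; exists p.
apply: (@sub_finite_set _ _ [set p]); last exact: finite_set1.
have bis g : (\1_(bisection s (OmegaX (domJ s))) g : cplx R) != 0 ->
    bisection s (OmegaX (domJ s)) g.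
  by rewrite indicE; case: (boolP (g \in _)) => [/set_mem //|]; rewrite eqxx.
move=> q Aq; case: p q Ap Aq => [g h] [g' h'] /= [m n0] [m' n0'].
by have [/= -> ->] := germ_mul_unique lc m' m (bis _ n0') (bis _ n0).
Qed.

Lemma lam_regular s :
  is_regular_rep (@germ_mul C) (\1_(bisection s (OmegaX (domJ s)))) (lam s).
Proof.
split; first exact: lam_bounded.
move=> xi k; set B := bisection _ _.
have bis g : (\1_B g : cplx R) != 0 -> B g.
  by rewrite indicE; case: (boolP (g \in _)) => [/set_mem //|]; rewrite eqxx.
have [[h hk]|n] := lam_cases s k.
  have [g m Bg] := mulrel_germ_mul lc hk.
  rewrite (@fsbig_single _ _ _ _ (g, h)) //.
    by rewrite (lam_some _ hk) indicE mem_set // mul1r.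
  move=> [g' h'] /= m' n0; have Bg' : B g'.
    by apply: bis; apply: contra n0 => /eqP ->; rewrite mul0r.
  by have [-> ->] := germ_mul_unique lc m' m Bg' Bg.
rewrite (lam_none _ n) fsbig1 // => -[g h] /= m.
have [/eqP ->|/bis Bg] := boolP ((\1_B g : cplx R) == 0); first by rewrite mul0r.
by have [/n] := germ_mul_bisection lc m Bg.
Qed.

Lemma lam_Cc s : hausdorff_space (germs C) ->
  Cc (\1_(bisection s (OmegaX (domJ s))) : germs C -> cplx R).
Proof.
move=> hG; apply: Cc_indic => //; [exact: (open_bisection lc)|exact: (compact_bisection lc)].
Qed.

Definition bd_incl (g : germs C) : option (@bd_germs C) :=
  if pselect (bd_germs g) is left e
  then Some (exist (fun g => g \in @bd_germs C) g (mem_set e)) else None.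

Lemma bd_inclP g (b : @bd_germs C) : bd_incl g = Some b <-> g = val b.
Proof.
rewrite /bd_incl; case: pselect => [e|n]; last first.
  by split=> // e; exfalso; apply: n; rewrite e; exact: set_mem (valP b).
split=> [[<-] //|e']; congr Some; exact: val_inj.
Qed.

Lemma bd_incl_pinj : pinjective bd_incl.
Proof. by move=> g h b /bd_inclP -> /bd_inclP ->. Qed.

Lemma bd_val_pinj : pinjective (fun b : @bd_germs C => Some (val b)).
Proof. by move=> b c g [<-] [e]; exact/esym/val_inj. Qed.

Definition bd_extend : ell2 R (@bd_germs C) -> ell2 R (germs C) := pinj bd_incl_pinj.
Definition bd_restrict : ell2 R (germs C) -> ell2 R (@bd_germs C) := pinj bd_val_pinj.

Definition compress (T : op R (germs C)) : op R (@bd_germs C) :=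
  bd_restrict \o T \o bd_extend.

Lemma bd_restrict_linear : linear bd_restrict.
Proof. exact: pinj_linear. Qed.

Lemma bd_extend_linear : linear bd_extend.
Proof. exact: pinj_linear. Qed.

Lemma bd_restrictE xi b : bd_restrict xi b = xi (val b). Proof. by []. Qed.

Lemma bd_extend_val (xi : ell2 R (@bd_germs C)) (b : @bd_germs C) : bd_extend xi (val b) = xi b.
Proof. by rewrite pinjE ((bd_inclP (val b) b).2 erefl). Qed.

Lemma bd_extend_out (xi : ell2 R (@bd_germs C)) g : ~ bd_germs g -> bd_extend xi g = 0.
Proof. by move=> n; rewrite pinjE /bd_incl; case: pselect. Qed.

Lemma bd_extend_delta b : bd_extend (delta R b) = delta R (val b).
Proof.
apply: ell2P => g; rewrite deltaE; have [e|n] := pselect (bd_germs g).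
  pose c : @bd_germs C := exist (fun g => g \in @bd_germs C) g (mem_set e).
  by rewrite -[g]/(val c) bd_extend_val.
rewrite bd_extend_out //; case: eqP => // e; exfalso; apply: n; rewrite e.
exact: set_mem (valP b).
Qed.

Lemma bd_restrict_delta (b : @bd_germs C) : bd_restrict (delta R (val b)) = delta R b.
Proof.
by apply: ell2P => c; rewrite bd_restrictE.
Qed.

(** By invariance of the boundary: if [h] and gh are boundary germs, so is g, whose source and range
    are their ranges. So the single term that survives in the full convolution sum also occurs in
    the sum over boundary germs. *)
Lemma bd_regular s T : is_regular_rep (@bd_germ_mul C)
    ((\1_(bisection s (OmegaX (domJ s))) : germs C -> cplx R) \o val) T ->
  T = compress (lam s).
Proof.
move=> [_ hT]; apply/funext => xi; apply: ell2P => b; rewrite hT /compress /comp bd_restrictE.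
set B := bisection _ _.
have bis g : (\1_B g : cplx R) != 0 -> B g.
  by rewrite indicE; case: (boolP (g \in _)) => [/set_mem //|]; rewrite eqxx.
have term0 (p : @bd_germs C * @bd_germs C) : \1_B (val p.1) * xi p.2 != 0 -> B (val p.1).
  by move=> n0; apply: bis; apply: contra n0 => /eqP ->; rewrite mul0r.
have [[h hk]|n] := lam_cases s (val b); last first.
  rewrite (lam_none _ n) fsbig1 // => p m.
  apply/eqP/negPn/negP => /term0 Bg.
  by have [/n] := germ_mul_bisection lc m Bg.
rewrite (lam_some _ hk); have [bh|nh] := pselect (bd_germs h); last first.
  rewrite bd_extend_out // fsbig1 // => p m; apply/eqP/negPn/negP => /term0 Bg.
  have [r _] := germ_mul_bisection lc m Bg.
  by apply: nh; rewrite (mulrel_inj lc hk r); exact: set_mem (valP p.2).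
have [g m Bg] := mulrel_germ_mul lc hk.
have bg : bd_germs g.
  have [chi [psi [phi [sh sg sk]]]] := germ_mul_range lc m.
  have [_ bpsi] := (bd_germsP lc sh).1 bh.
  have [_ bphi] := (bd_germsP lc sk).1 (set_mem (valP b)).
  exact: (bd_germsP lc sg).2 (conj bpsi bphi).
pose h' : @bd_germs C := exist (fun g => g \in @bd_germs C) h (mem_set bh).
pose g' : @bd_germs C := exist (fun g => g \in @bd_germs C) g (mem_set bg).
rewrite -[h]/(val h') bd_extend_val (@fsbig_single _ _ _ _ (g', h')) //.
  by rewrite [X in X * _]indicE mem_set // mul1r.
move=> [g1 h1] /= m' /(@term0 (g1, h1)) /= Bg'.
have [e1 e2] := germ_mul_unique lc m' m Bg' Bg.
by congr (_, _); apply: val_inj.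
Qed.

Lemma lspan_lam_regular : hausdorff_space (germs C) ->
  lspan (range lam) `<=` [set T | exists2 f, Cc f &
    is_regular_rep (@germ_mul C) f T].
Proof.
move=> hG T hT.
(* [fibre_finite] is carried through the induction because [regular_rep_comb] asks for it. *)
suff [f [cf rf _]] : exists f : germs C -> cplx R, [/\ Cc f,
    is_regular_rep (@germ_mul C) f T & fibre_finite (@germ_mul C) f].
  by exists f.
elim: hT => [|k e S [s _ <-] _ [f [cf rf ff]]].
  exists (fun=> 0); split.
  - split; first exact: (@cst_continuous (germs C) (cplx R) 0).
    rewrite (_ : [set g | _] = set0); first by rewrite closure0; exact: compact0.
    by apply/seteqP; split=> g //=; rewrite eqxx.
  - split; first exact: bounded_op0.
    by move=> xi g; rewrite fsbig1 // => p _; rewrite mul0r.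
  - move=> g; rewrite (_ : [set p | _] = set0) //.
    by apply/seteqP; split=> p //= [_]; rewrite eqxx.
exists (fun g => k * \1_(bisection s (OmegaX (domJ s))) g + f g); split.
- by apply: Cc_comb => //; exact: lam_Cc.
- apply: regular_rep_comb => //; [exact: fibre_finite_indic|exact: lam_regular].
- by apply: fibre_finite_comb => //; exact: fibre_finite_indic.
Qed.

End Lam.

(** * The algebras spanned by the translations *)

Section Algebra.
Variables (R : realType) (C : small_category).
Hypothesis lc : left_cancellative C.
Implicit Types (s t : @Il C) (g h k : germs C) (xi : ell2 R (germs C)).

Local Notation lam := (@lam R C lc).
Local Notation lamc := (fun c : C => lam (Ilgen c)).

Lemma range_lam_bounded : range lam `<=` bounded_op (I := germs C).
Proof. by move=> _ [s _ <-]; exact: lam_bounded. Qed.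

Lemma range_lamc_sub : range lamc `<=` range lam.
Proof. by move=> _ [c _ <-]; exists (Ilgen c). Qed.

Lemma range_lamc_bounded : range lamc `<=` bounded_op (I := germs C).
Proof. by move=> _ [c _ <-]; exact: lam_bounded. Qed.

Lemma Ilgen_mul (c d : C) : dm c = tg d ->
  Ilmul (Ilgen c) (Ilgen d) = Ilgen (Defs.comp c d).
Proof.
move=> cd; apply/val_inj/funext => x; apply/funext => y; apply/propext; split.
  move=> [z [tx ->] [_ ->]]; split; first by rewrite dm_comp.
  by rewrite Defs.compA.
move=> [tx ->]; rewrite dm_comp // in tx; exists (Defs.comp d x); first by split.
by split; [rewrite tg_comp|rewrite Defs.compA].
Qed.

(** The composed graph is empty, and no character contains the empty ideal. *)
Lemma lam_Ilgen_mul0 (c d : C) : dm c <> tg d ->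
  lam (Ilmul (Ilgen c) (Ilgen d)) = 0.
Proof.
move=> cd; apply/funext => xi; apply: ell2P => k.
apply: lam_none => h [t [chi [_ kt]]].
have [x [y [z _ [w [tz ez] [tw _]]]]] :=
  char_nonempty (Omega_char chi) (is_germ_dom kt).
by apply: cd; rewrite -tw ez tg_comp.
Qed.

Lemma lspan_lam_algebra : closed_subalgebra (norm_closure (lspan (range lam))).
Proof.
apply: norm_closure_closed_subalgebra.
- exact: lspan_bounded range_lam_bounded.
- exact: lspan0.
- by move=> k S T; exact: lspan_comb.
- apply: lspan_comp range_lam_bounded _ => _ _ [s _ <-] [t _ <-].
  by apply: lspan_mem; exists (Ilmul s t) => //; rewrite lam_comp.
Qed.

(** Together with 0 the translations by arrows are closed under products, so their span is already
    an algebra. *)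
Lemma lspan_lamc_algebra : closed_subalgebra (norm_closure (lspan (range lamc))).
Proof.
apply: norm_closure_closed_subalgebra.
- exact: lspan_bounded range_lamc_bounded.
- exact: lspan0.
- by move=> k S T; exact: lspan_comb.
- apply: lspan_comp range_lamc_bounded _ => _ _ [c _ <-] [d _ <-].
  rewrite lam_comp; have [cd|cd] := pselect (dm c = tg d).
    by apply: lspan_mem; exists (Defs.comp c d) => //; rewrite Ilgen_mul.
  by rewrite lam_Ilgen_mul0 //; exact: lspan0.
Qed.

Lemma Ar_sub : @Ar R C `<=` norm_closure (lspan (range lamc)).
Proof.
move=> T; apply; split; first exact: lspan_lamc_algebra.
move=> S [c rS]; apply: sub_norm_closure; first exact: lspan_bounded range_lamc_bounded.
apply: lspan_mem; exists c => //.
exact: (regular_rep_unique (lam_regular R lc (Ilgen c)) rS).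
Qed.

Lemma norm_closure_mono (I : choiceType) (A B : set (op R I)) :
  A `<=` B -> norm_closure A `<=` norm_closure B.
Proof.
move=> AB T [bT hT]; split=> // e e0; have [S AS hS] := hT e e0.
by exists S => //; exact: AB.
Qed.

Lemma lspan_lamc_sub : lspan (range lamc) `<=` lspan (range lam).
Proof.
apply: lspan_sub; first exact: lspan0.
  by move=> k S T; exact: lspan_comb.
by move=> S /range_lamc_sub; exact: lspan_mem.
Qed.

Definition src g : @Omega C := projT1 (cid (src_range_ex lc g)).

Lemma srcP g s chi : is_germ g s chi -> src g = chi.
Proof.
rewrite /src; case: cid => chi' /= [psi sr] gs.
by have [] := is_germ_range lc gs sr.
Qed.

(** Left translation keeps the source of a germ. *)
Lemma lam_restr s chi xi : lam s (restr src chi xi) = restr src chi (lam s xi).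
Proof.
apply: ell2P => k; rewrite [RHS]restrE; have [[h hk]|n] := lam_cases s k.
  rewrite !(lam_some _ _ hk) restrE.
  by have [t [psi [ht kt]]] := hk; rewrite (srcP ht) (srcP kt).
by rewrite !(lam_none _ _ n); case: ifP.
Qed.

Lemma restr_opbnd chi : opbnd 1 (@restr R _ _ src chi).
Proof. exact: pinj_opbnd. Qed.

Lemma closure_restr (T : op R (germs C)) chi xi :
  norm_closure (lspan (range lam)) T ->
  T (restr src chi xi) = restr src chi (T xi).
Proof.
have Db := lspan_bounded range_lam_bounded.
have hS S : lspan (range lam) S -> forall xi,
    S (restr src chi xi) = restr src chi (S xi).
  elim=> [|k _ U [s _ <-] _ IH] eta.
    by rewrite /= (linear0_op (restr_linear _ _)).
  rewrite -[LHS]/(k *: lam s (restr src chi eta) + U (restr src chi eta)).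
  by rewrite lam_restr IH -(restr_linear src chi).
move=> cT; have [S sS hTS] := norm_closure_seq Db cT.
apply/eqP; rewrite -subr_eq0; apply/eqP/ell2_norm_eq0.
apply/eqP; rewrite eq_le ell2_norm_ge0 andbT.
apply: (@geom_le0 _ _ (2 * ell2_norm xi)) => n.
have -> : T (restr src chi xi) - restr src chi (T xi) =
    (T - S n) (restr src chi xi) - restr src chi ((T - S n) xi).
  rewrite -[(T - S n) (restr _ _ _)]/(T _ - S n _) -[(T - S n) xi]/(T xi - S n xi).
  by rewrite (linearB_op (restr_linear src chi)) (hS _ (sS n)) opprB addrA subrK.
apply: (le_trans (ler_ell2_normB _ _)).
have e1 : ell2_norm ((T - S n) (restr src chi xi)) <= 2^-1 ^+ n * ell2_norm xi.
  apply: (le_trans (hTS n _)); rewrite ler_wpM2l ?half_ge0 //.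
  by have := restr_opbnd chi xi; rewrite mul1r.
have e2 : ell2_norm (restr src chi ((T - S n) xi)) <= 2^-1 ^+ n * ell2_norm xi.
  by apply: (le_trans (restr_opbnd chi _)); rewrite mul1r; exact: hTS.
by apply: (le_trans (lerD e1 e2)); move: (_ ^+ n) => p; lra.
Qed.

End Algebra.

Lemma combine_families (R : realType) (I : choiceType) (X Y : Type)
    (T : X -> op R I) (v : Y -> ell2 R I) (mul : X -> Y -> Y)
    (w : seq (cplx R * X)) (W : seq (cplx R * Y)) :
  (forall x, linear (T x)) -> (forall x y, T x (v y) = v (mul x y)) ->
  (\sum_(p <- w) p.1 *: T p.2) (\sum_(r <- W) r.1 *: v r.2) =
  \sum_(z <- [seq (p.1 * r.1, mul p.2 r.2) | p <- w, r <- W]) z.1 *: v z.2.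
Proof.
move=> lT hT; rewrite big_allpairs_dep /=.
elim: w => [|p w IH]; first by rewrite !big_nil.
rewrite !big_cons -IH; set S := \sum_(i <- w) _.
rewrite -[LHS]/(p.1 *: T p.2 (\sum_(r <- W) r.1 *: v r.2) + S _).
congr (_ + _); rewrite (linear_sum_op (lT p.2)) scaler_sumr.
apply: eq_bigr => r _.
by rewrite (linearZ_op (lT p.2)) scalerA hT.
Qed.

(** * Transfer to the boundary *)

Section Transfer.
Variables (R : realType) (C : small_category).
Hypotheses (lc : left_cancellative C) (rc : right_cancellative C).
Hypothesis hG : hausdorff_space (germs C).
Implicit Types (s t : @Il C) (g h k : germs C) (xi : ell2 R (germs C)).

Local Notation lam := (@lam R C lc).
Local Notation lamc := (fun c : C => lam (Ilgen c)).

(** The value 0 off the domain makes [lam_germ_vec] hold without side conditions. *)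
Definition germ_vec (chi : @Omega C) s : ell2 R (germs C) :=
  if pselect (val chi (domJ s)) is left e
  then delta R (projT1 (cid (germ_mk e))) else 0.

Lemma germ_vec_some chi s g : is_germ g s chi -> germ_vec chi s = delta R g.
Proof.
rewrite /germ_vec => gs; case: pselect => [e|n]; last by case: n; exact: is_germ_dom gs.
by case: cid => g' /= gs'; rewrite (is_germ_eq gs' gs).
Qed.

Lemma germ_vec_none (chi : @Omega C) s : ~ val chi (domJ s) -> germ_vec chi s = 0.
Proof. by rewrite /germ_vec; case: pselect. Qed.

Lemma lam_germ_vec chi s t : lam s (germ_vec chi t) = germ_vec chi (Ilmul s t).
Proof.
have [ct|nt] := pselect (val chi (domJ t)); last first.
  rewrite (germ_vec_none nt) (linear0_op (lam_linear lc _)) germ_vec_none //.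
  apply: contra_not nt => /(char_mono (Omega_char chi)); apply.
  by move=> x [y [z txz _]]; exists z.
have [h ht] := germ_mk ct; rewrite (germ_vec_some ht).
have [cst|nst] := pselect (val chi (domJ (Ilmul s t))).
  have [k kst] := germ_mk cst; rewrite (germ_vec_some kst).
  by apply: lam_delta; exists t, chi.
rewrite (germ_vec_none nst) lam_delta0 // => k /(mulrel_germ lc ht) /is_germ_dom.
exact: nst.
Qed.

(* A maximal character [omega] containing every ideal through the object
   [dm x] turns l^2 of the arrows with domain [dm x] into a subspace of l^2 of
   the fibre over [omega]. *)
Section BoundaryFibre.
Variables (x : C) (omega : @Omega C).
Hypothesis max_omega : maximal_character (val omega).
Hypothesis omega_x : forall X : @J C, inJ X (dm x) -> val omega X.

Lemma omega_dom (y : C) : dm y = dm x -> val omega (domJ (Ilgen y)).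
Proof.
move=> yx; apply: omega_x; exists (Defs.comp y (dm x)); split=> //.
by rewrite yx tg_dm.
Qed.

Lemma bd_germ_ex (y : C) : dm y = dm x ->
  exists b : @bd_germs C, is_germ (val b) (Ilgen y) omega.
Proof.
move=> /omega_dom cy; have [g gy] := germ_mk cy.
have mx := act_maximal lc max_omega cy.
pose psi : @Omega C := exist (fun c => c \in @Omega C) _
  (mem_set (maximal_character_Omega lc mx)).
have bg : bd_germs g.
  exists (Ilgen y), omega, psi; split=> //; exact: subset_closure.
by exists (exist (fun g => g \in @bd_germs C) g (mem_set bg)).
Qed.

(** The boundary counterpart of [germ_vec]: [s] enters only through the arrow s(x), and the germ at
    [omega] is that of left multiplication by this arrow, not of [s]. *)
Definition bd_vec s : ell2 R (@bd_germs C) :=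
  if pselect (exists b : @bd_germs C, exists2 y, (val s : @graph C) x y &
     is_germ (val b) (Ilgen y) omega) is left e
  then delta R (projT1 (cid e)) else 0.

Lemma bd_vec_some s y (b : @bd_germs C) : (val s : @graph C) x y ->
  is_germ (val b) (Ilgen y) omega -> bd_vec s = delta R b.
Proof.
rewrite /bd_vec => sxy gb; case: pselect => [e|n]; last first.
  by case: n; exists b, y.
case: cid => b' /= [y' sxy' gb']; congr delta; apply: val_inj.
by rewrite -(Il_fun lc sxy sxy') in gb'; exact: is_germ_eq gb' gb.
Qed.

Lemma bd_vec_none s : (forall y, ~ (val s : @graph C) x y) -> bd_vec s = 0.
Proof.
move=> n; rewrite /bd_vec; case: pselect => // e; exfalso.
by case: (e) => b [y sxy _]; exact: n sxy.
Qed.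

(** Equal germs of y and y' agree on an ideal of [omega], which is nonempty; so yz = y'z for some z,
    and z cancels on the right. *)
Lemma bd_germ_inj (y y' : C) (g : germs C) : dm y = dm x -> dm y' = dm x ->
  is_germ g (Ilgen y) omega -> is_germ g (Ilgen y') omega -> y = y'.
Proof.
move=> yx y'x gy gy'; have [_ [X cX h]] := is_germ_inj gy gy'.
have [z Xz] := char_nonempty (Omega_char omega) cX.
have [w [tz ->] [tz' e]] := h z Xz.
exact: rc e.
Qed.

(** With y = s(x), the arrow cy and the product of [y, omega] with a germ of c exist under the same
    condition d(c) = t(y). *)
Lemma compressed_lam_bd_vec (c : C) s :
  bd_restrict (lam (Ilgen c) (bd_extend (bd_vec s))) = bd_vec (Ilmul (Ilgen c) s).
Proof.
have [[y sxy]|n] := pselect (exists y, (val s : @graph C) x y); last first.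
  rewrite (bd_vec_none (s := s)) => [|y sxy]; last by apply: n; exists y.
  rewrite (linear0_op (@bd_extend_linear R C)) (linear0_op (lam_linear lc _)).
  rewrite (linear0_op (@bd_restrict_linear R C)) bd_vec_none // => z [y sxy _].
  by apply: n; exists y.
have yx : dm y = dm x.
  by have [] := Il_gen_equivariant (Il_gen_val s) sxy.
have [b gb] := bd_germ_ex yx; rewrite (bd_vec_some sxy gb) bd_extend_delta.
have [cy|cy] := pselect (dm c = tg y).
  have cyx : dm (Defs.comp c y) = dm x by rewrite dm_comp.
  have [b' gb'] := bd_germ_ex cyx.
  rewrite (@bd_vec_some _ (Defs.comp c y) b') //; last by exists y.
  rewrite (@lam_delta _ _ _ _ _ (val b')) ?bd_restrict_delta //.
  by exists (Ilgen y), omega; split=> //; rewrite Ilgen_mul.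
rewrite lam_delta0.
  rewrite (linear0_op (@bd_restrict_linear R C)) bd_vec_none // => z [y' sxy' [ty' _]].
  by apply: cy; rewrite -ty' (Il_fun lc sxy sxy').
move=> k /(mulrel_germ lc gb) /is_germ_dom.
move=> /(char_nonempty (Omega_char omega))[w [z [z' [tw ez] [tz' _]]]].
by apply: cy; rewrite -tz' ez tg_comp.
Qed.

End BoundaryFibre.

(** The pair s, t looks the same at [x] as at [chi]. Only the domain of [s] is compared; that of [t]
    is covered by exchanging the two. *)
Definition good_point (chi : @Omega C) (x : C) s t :=
  (val chi (domJ s) <-> exists y, (val s : @graph C) x y) /\
  (val chi (domJ s) -> val chi (domJ t) ->
   (agree chi s t <-> exists2 y, (val s : @graph C) x y & (val t : @graph C) x y)).

(** The witness is xC: by equivariance s(xw) = s(x)w = t(x)w = t(xw). *)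
Lemma agree_prin x s t y : (val s : @graph C) x y -> (val t : @graph C) x y ->
  agree (prin lc x) s t.
Proof.
move=> sxy txy; have [X hX] := principalJ x; exists X.
  apply/(prinE lc)/hX; exists (dm x); first by rewrite tg_dm.
  by rewrite comp_dm.
move=> z /hX[w xw ->]; exists (Defs.comp y w).
  by have [_] := Il_gen_equivariant (Il_gen_val s) sxy; exact.
by have [_] := Il_gen_equivariant (Il_gen_val t) txy; exact.
Qed.

(** If s and t agree at chi, they agree on an ideal of chi, which contains the nearby x. Otherwise
    their germs have disjoint neighbourhoods, which by [section_near] still contain the germs at
    [prin x] for x near chi; then s(x) = t(x) is impossible, as it would make those germs equal. *)
Lemma near_good_point (chi : @Omega C) s t :
  near_char (val chi) [set x | good_point chi x s t].
Proof.
have hO : Omega (val chi) := set_mem (valP chi).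
have FF := near_char_filter lc hO.
have n1 := @near_char_iff C lc (val chi) (domJ s) hO.
have n2 : near_char (val chi) [set x | val chi (domJ s) -> val chi (domJ t) ->
    (agree chi s t <-> exists2 y, (val s : @graph C) x y & (val t : @graph C) x y)].
  have [cs|cs] := pselect (val chi (domJ s)); last by apply: filterE => x /cs.
  have [ct|ct] := pselect (val chi (domJ t)); last by apply: filterE => x _ /ct.
  have [[X cX h]|na] := pselect (agree chi s t).
    by apply: filterS (near_char_in cX) => x Xx _ _; split=> _; [exact: h|exists X].
  have [g gs] := germ_mk cs; have [h ht] := germ_mk ct.
  have gh : g != h.
    by apply/eqP => e; apply: na; rewrite -e in ht; have [] := is_germ_inj gs ht.
  have := hG; rewrite open_hausdorff => /(_ g h gh)[[U V] /= [Ug Vh] [oU oV /eqP UV]].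
  have nU := section_near lc gs (open_nbhs_nbhs (conj oU (set_mem Ug))).
  have nV := section_near lc ht (open_nbhs_nbhs (conj oV (set_mem Vh))).
  have nUV : nbhs chi ([set psi | forall g', is_germ g' s psi -> U g'] `&`
      [set psi | forall g', is_germ g' t psi -> V g']) by exact: filterI.
  have FUV : near_char (val chi) (prin lc @^-1`
      ([set psi | forall g', is_germ g' s psi -> U g'] `&`
       [set psi | forall g', is_germ g' t psi -> V g'])) := prin_cvg lc nUV.
  apply: filterS FUV => x [pU pV] _ _; split=> // -[y sxy txy].
  have a := agree_prin sxy txy; have [g' gs'] := germ_mk (agree_dom a).
  have : (U `&` V) g'.
    by split; [exact: pU|apply: pV; exact: is_germ_agree gs' a].
  by rewrite UV.
apply: filterS (filterI n1 n2) => x [e h]; split=> //.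
have {}e : val (prin lc x) (domJ s) = val chi (domJ s) := e.
by rewrite -e; split=> [/(prinE lc)|?]; [|exact/(prinE lc)].
Qed.

Lemma good_point_ex (chi : @Omega C) (Q : seq {classic @Il C}) :
  exists x, forall s t : {classic @Il C}, s \in Q -> t \in Q -> good_point chi x s t.
Proof.
have FF := near_char_filter lc (set_mem (valP chi)).
have near_all (A : {classic @Il C} -> set C) (r : seq {classic @Il C}) :
    (forall s, near_char (val chi) (A s)) ->
    near_char (val chi) [set x | forall s : {classic @Il C}, s \in r -> A s x].
  move=> hA; elim: r => [|s r IH]; first exact: filterE.
  apply: filterS (filterI (hA s) IH) => x [As Ar] t.
  by rewrite inE => /predU1P[->|/Ar].
have [] := @filter_ex _ _ FF [set x | forall s : {classic @Il C}, s \in Q ->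
    [set x | forall t : {classic @Il C}, t \in Q -> good_point chi x s t] x].
  apply: (near_all (fun s => [set x | forall t : {classic @Il C}, t \in Q ->
    good_point chi x s t])) => s.
  apply: (near_all (fun t => [set x | good_point chi x s t])) => t.
  exact: near_good_point.
by move=> x hx; exists x => s t sQ tQ; exact: hx.
Qed.

Lemma maximal_above_object (x : C) : exists omega : @Omega C,
  maximal_character (val omega) /\ forall X : @J C, inJ X (dm x) -> val omega X.
Proof.
have [||w [mw hw]] := @maximal_character_above C lc [set X | inJ X (dm x)].
- split=> [X Y Xx Yx|X Y Xx sub|X Xx]; [by apply/inJ_cap|exact: sub|by exists (dm x)].
- exists (domJ (Ilgen (dm x))), (Defs.comp (dm x) (dm x)); split=> //.
  by rewrite tg_dm dm_dm.
by exists (exist (fun c => c \in @Omega C) w (mem_set (maximal_character_Omega lc mw))).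
Qed.

(** All vectors are multiples of basis vectors or zero, and a good point preserves which vanish and
    which coincide; [bd_germ_inj] leads back from equal boundary germs to agreement at chi. *)
Lemma gram_vec (chi omega : @Omega C) (x : C) (s t : @Il C) (a b : cplx R) :
  maximal_character (val omega) ->
  (forall X : @J C, inJ X (dm x) -> val omega X) ->
  good_point chi x s t -> good_point chi x t s ->
  redot (a *: germ_vec chi s) (b *: germ_vec chi t) =
  redot (a *: bd_vec x omega s) (b *: bd_vec x omega t).
Proof.
move=> mo ho [ds a1] [dt a2].
have zl (I : choiceType) (u : ell2 R I) : redot (a *: 0) u = 0.
  by rewrite scaler0 redot0l.
have zr (I : choiceType) (u : ell2 R I) : redot u (b *: 0) = 0.
  by rewrite scaler0 redotC redot0l.
have [cs|cs] := pselect (val chi (domJ s)); last first.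
  rewrite (germ_vec_none cs) bd_vec_none ?zl // => y sxy.
  by apply: cs; apply/ds; exists y.
have [ct|ct] := pselect (val chi (domJ t)); last first.
  rewrite (germ_vec_none ct) [bd_vec x omega t]bd_vec_none ?zr // => y sxy.
  by apply: ct; apply/dt; exists y.
have [g gs] := germ_mk cs; have [h ht] := germ_mk ct.
have [y sxy] := ds.1 cs; have [z txz] := dt.1 ct.
have yx : dm y = dm x by have [] := Il_gen_equivariant (Il_gen_val s) sxy.
have zx : dm z = dm x by have [] := Il_gen_equivariant (Il_gen_val t) txz.
have [b1 gb1] := bd_germ_ex mo ho yx; have [b2 gb2] := bd_germ_ex mo ho zx.
rewrite (germ_vec_some gs) (germ_vec_some ht) (bd_vec_some sxy gb1).
rewrite (bd_vec_some txz gb2) !redot_delta; congr ((nat_of_bool _)%:R * _).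
apply/eqP/eqP => e.
  have ag : agree chi s t by rewrite -e in ht; have [] := is_germ_inj gs ht.
  have [w sxw txw] := (a1 cs ct).1 ag.
  rewrite (Il_fun lc sxy sxw) in gb1; rewrite (Il_fun lc txz txw) in gb2.
  by apply: val_inj; exact: is_germ_eq gb1 gb2.
rewrite -e in gb2; have yz := bd_germ_inj yx zx gb1 gb2.
have ag : agree chi s t by apply/(a1 cs ct); exists y => //; rewrite yz.
exact: is_germ_eq gs (is_germ_agree lc ht (agree_sym ag)).
Qed.

Lemma restricted_trunc (chi : @Omega C) (F : {fset germs C}) xi :
  exists W : seq (cplx R * {classic @Il C}),
  trunc F (restr (src lc) chi xi) = \sum_(p <- W) p.1 *: germ_vec chi p.2.
Proof.
have /choice[rep hrep] : forall g, exists s : @Il C, src lc g = chi -> is_germ g s chi.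
  move=> g; have [s [psi gs]] := germ_ex g; exists s => <-.
  by rewrite (srcP lc gs).
(* For g outside the fibre the coefficient is 0 and [rep g] is arbitrary. *)
exists [seq (restr (src lc) chi xi g, rep g : {classic @Il C}) | g <- F].
rewrite big_map; apply: eq_bigr => g _.
have [e|ne] := eqVneq (src lc g) chi; first by rewrite (germ_vec_some (hrep g e)).
have z : restr (src lc) chi xi g = 0 by rewrite restrE (negbTE ne).
by rewrite z !scale0r.
Qed.

Lemma transfer (n : nat) (chi : @Omega C) (xi : 'I_n -> ell2 R (germs C))
    (S : 'M[op R (germs C)]_n) (F : 'I_n -> {fset germs C}) :
  (forall i j, lspan (range lamc) (S i j)) ->
  exists eta : 'I_n -> ell2 R (@bd_germs C),
  (forall j, ell2_norm (eta j) =
     ell2_norm (trunc (F j) (restr (src lc) chi (xi j)))) /\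
  forall i, ell2_norm (\sum_j S i j (trunc (F j) (restr (src lc) chi (xi j)))) =
    ell2_norm (\sum_j (compress (S i j)) (eta j)).
Proof.
move=> hS.
have /choice[w hw] : forall p : 'I_n * 'I_n, exists w : seq (cplx R * C),
    S p.1 p.2 = \sum_(q <- w) q.1 *: lam (Ilgen q.2).
  by move=> p; exact: (lspan_range (hS p.1 p.2)).
have /choice[W hW] : forall j, exists W : seq (cplx R * {classic @Il C}),
    trunc (F j) (restr (src lc) chi (xi j)) = \sum_(p <- W) p.1 *: germ_vec chi p.2.
  by move=> j; exact: restricted_trunc.
pose act_seq (u : seq (cplx R * C)) (V : seq (cplx R * {classic @Il C})) :
  seq (cplx R * {classic @Il C}) :=
  [seq (p.1 * r.1, Ilmul (Ilgen p.2) r.2 : {classic @Il C}) | p <- u, r <- V].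
pose U i := flatten [seq act_seq (w (i, j)) (W j) | j <- enum 'I_n].
(* [Q] lists the germs of the vectors and of all their images, so that one x and one omega serve
   every row and every component. *)
pose Q : seq {classic @Il C} :=
  [seq p.2 | p <- flatten [seq W j | j <- enum 'I_n] ++ flatten [seq U i | i <- enum 'I_n]].
have [x hx] := good_point_ex chi Q; have [omega [mo ho]] := maximal_above_object x.
have gram := @gram_norm R _ _ {classic @Il C} (germ_vec chi) (bd_vec x omega) Q.
have {}gram V : (forall p, p \in V -> p.2 \in Q) ->
    ell2_norm (\sum_(p <- V) p.1 *: germ_vec chi p.2) =
    ell2_norm (\sum_(p <- V) p.1 *: bd_vec x omega p.2).
  by apply: gram => s t sQ tQ a b; apply: gram_vec => //; exact: hx.
exists (fun j => \sum_(p <- W j) p.1 *: bd_vec x omega p.2); split.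
  move=> j; rewrite hW; apply/esym/gram => p pW; apply/mapP; exists p => //.
  rewrite mem_cat; apply/orP; left; apply/flattenP; exists (W j) => //.
  by apply/mapP; exists j => //; rewrite mem_enum.
move=> i.
have e1 : \sum_j S i j (trunc (F j) (restr (src lc) chi (xi j))) =
    \sum_(p <- U i) p.1 *: germ_vec chi p.2.
  rewrite /U big_flatten big_map big_enum; apply: eq_bigr => j _.
  rewrite hW (hw (i, j)).
  exact: (@combine_families R (germs C) C {classic @Il C}
    (fun c => lam (Ilgen c)) (germ_vec chi) (fun c s => Ilmul (Ilgen c) s)
    (w (i, j)) (W j) (fun c => lam_linear lc _)
    (fun c s => lam_germ_vec chi (Ilgen c) s)).
have e2 : \sum_j (compress (S i j))
    (\sum_(p <- W j) p.1 *: bd_vec x omega p.2) =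
    \sum_(p <- U i) p.1 *: bd_vec x omega p.2.
  rewrite /U big_flatten big_map big_enum; apply: eq_bigr => j _.
  have -> : compress (S i j) =
      \sum_(q <- w (i, j)) q.1 *: compress (lam (Ilgen q.2)).
    rewrite (hw (i, j)) /=; elim: (w (i, j)) => [|q u IH].
      rewrite !big_nil; apply/funext => eta.
      by rewrite /compress /comp (linear0_op (@bd_restrict_linear R C)).
    rewrite !big_cons -IH; apply/funext => eta; exact: bd_restrict_linear.
  have lin c : linear (compress (lam (Ilgen c))).
    move=> k u v; rewrite /compress /comp bd_extend_linear lam_linear.
    exact: bd_restrict_linear.
  exact: (@combine_families R (@bd_germs C) C {classic @Il C}
    (fun c => compress (lam (Ilgen c))) (bd_vec x omega)
    (fun c s => Ilmul (Ilgen c) s) (w (i, j)) (W j) lin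
    (fun c s => compressed_lam_bd_vec mo ho c s)).
rewrite e1 e2; apply: gram => p pU; apply/mapP; exists p => //.
rewrite mem_cat; apply/orP; right; apply/flattenP; exists (U i) => //.
by apply/mapP; exists i => //; rewrite mem_enum.
Qed.

End Transfer.

(** * The boundary quotient on the algebra *)

Section Main.
Variables (R : realType) (C : small_category).
Variable q : op R (germs C) -> op R (@bd_germs C).
Hypotheses (lc : left_cancellative C) (rc : right_cancellative C).
Hypothesis hG : hausdorff_space (germs C).
Hypothesis hq : is_boundary_quotient q.

Local Notation lam := (@lam R C lc).
Local Notation lamc := (fun c : C => lam (Ilgen c)).
Local Notation A := (norm_closure (lspan (range lam))).

Lemma lam_closure_Cstar : A `<=` Cstar_r (R := R) (@germ_mul C).
Proof. exact/norm_closure_mono/lspan_lam_regular. Qed.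

Lemma boundary_quotient_lam s : q (lam s) = compress (lam s).
Proof.
have [_ _ hreg] := hq; apply: (bd_regular lc).
by apply: hreg; [exact: lam_Cc|exact: lam_regular].
Qed.

(** q is explicit on the [lam s], and continuity extends the formula. All of [Il] is taken here so
    that the algebra contains adjoints, on which the continuity argument rests. *)
Lemma boundary_quotient_compression T : A T ->
  q T = compress T.
Proof.
have [[qB qlin qmul qadj] _ _] := hq; have sub := lam_closure_Cstar.
have hqA : star_hom A (Cstar_r (R := R) (@bd_germ_mul C)) q.
  split=> [a /sub/qB //|k a b /sub Aa /sub|a b /sub Aa /sub|a b /sub Aa /sub].
  - exact: qlin.
  - exact: qmul.
  - exact: qadj.
have Db := lspan_bounded (@range_lam_bounded R C lc).
have Aadj U : A U -> exists2 U', A U' & radj U U'.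
  apply: norm_closure_radj Db _ _; apply: lspan_radj (@range_lam_bounded R C lc) _ => _ [s _ <-].
  by exists (lam (Il_inv s)); [exists (Il_inv s)|exact: lam_radj].
have EA : range lam `<=` A.
  by move=> _ [s _ <-]; apply: sub_norm_closure Db _ _; apply: lspan_mem; exists s.
have bdb : Cstar_r (R := R) (@bd_germ_mul C) `<=` bounded_op (I := @bd_germs C).
  by move=> S [].
have hE e : range lam e -> q e = @bd_restrict R C \o e \o @bd_extend R C.
  by move=> [s _ <-]; exact: boundary_quotient_lam.
move=> AT; apply: (star_hom_compression (lspan_lam_algebra R lc) Aadj bdb hqA
  (@bd_restrict_linear R C) _ _ EA hE AT AT); exact: pinj_opbnd.
Qed.

Lemma boundary_quotient_completely_isometric :
  completely_isometric_on (@Ar R C) q.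
Proof.
move=> n a Aa.
have cA i j : norm_closure (lspan (range lamc)) (a i j) by exact: Ar_sub.
have sub := norm_closure_mono (@lspan_lamc_sub R C lc).
have ba i j : bounded_op (a i j) by have [] := cA i j.
have bq i j : bounded_op (map_mx q a i j).
  have [[qB _ _ _] _ _] := hq; rewrite mxE.
  by have [] := qB _ (lam_closure_Cstar (sub _ (cA i j))).
have qE i j : map_mx q a i j = compress (a i j).
  by rewrite mxE; apply: boundary_quotient_compression; exact: sub.
apply/eqP; rewrite eq_le; apply/andP; split.
  (* Extending by 0, applying [a] and restricting cannot increase the norm. *)
  apply: mx_op_norm_le => [|xi]; first exact: mx_op_norm_ge0.
  apply: (@le_trans _ _ (\sum_i nsq (\sum_j a i j (bd_extend (xi j))))).
    apply: ler_sum => i _; under eq_bigr do rewrite qE.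
    rewrite -(linear_sum_op (pinj_linear (@bd_val_pinj C))); exact: pinj_nsq.
  apply: (le_trans (mx_op_normP _ ba)); rewrite ler_wpM2l ?sqr_ge0 //.
  by apply: ler_sum => j _; exact: pinj_nsq.
(* The lower estimate: one fibre of the source map at a time, then by approximation inside the
   fibre. *)
apply: mx_op_norm_le => [|xi]; first exact: mx_op_norm_ge0.
apply: (fibrewise_bound (fib := src lc)) => {xi} [i j chi xi|chi xi].
  by apply: closure_restr; exact: sub.
apply: (@approximate_transfer _ _ _ _ (lspan (range lamc)) q) => //.
- exact: lspan_bounded (@range_lamc_bounded R C lc).
- move=> S T e e0 sS cT hST.
  have AS : A S.
    apply: sub_norm_closure; last exact: lspan_lamc_sub.
    exact: lspan_bounded (@range_lam_bounded R C lc).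
  rewrite (boundary_quotient_compression (sub _ cT)).
  rewrite (boundary_quotient_compression AS) => eta.
  have -> : (compress T -
      compress S) eta =
      bd_restrict ((T - S) (bd_extend eta)).
    rewrite -[(T - S) _]/(T (bd_extend eta) - S (bd_extend eta)).
    by rewrite (linearB_op (@bd_restrict_linear R C)).
  apply: (le_trans (pinj_norm _ _)); apply: (le_trans (hST _)).
  by rewrite ler_pM2l // pinj_norm.
- move=> eta; have := mx_op_normP eta bq; congr (_ <= _).
  apply: eq_bigr => i _; congr nsq; apply: eq_bigr => j _.
  by rewrite mxE.
- move=> S F sS; have [eta [h1 h2]] := @transfer R C lc rc hG n chi xi S F sS.
  exists eta; split=> // i; rewrite h2; congr ell2_norm; apply: eq_bigr => j _.
  rewrite boundary_quotient_compression //; apply: sub_norm_closure.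
    exact: lspan_bounded (@range_lam_bounded R C lc).
  exact: lspan_lamc_sub.
Qed.

End Main.

Theorem theorem4p3 (R : realType) (C : small_category)
    (q : op R (germs C) -> op R (@bd_germs C)) :
  cancellative C -> hausdorff_space (germs C) -> is_boundary_quotient q ->
  completely_isometric_on (@Ar R C) q.
Proof.
move=> [lc rc] hG hq.
exact: (boundary_quotient_completely_isometric lc rc hG hq).
Qed.
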